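(* Let $H$ be a complex Hilbert space and let $f$ be an operator monotone function on $(0,\infty)$. Then, for every unitarily invariant norm $|||\cdot|||$ on $B(H)$ and all positive definite operators $A,B\in B(H)$, $$\left|\left|\left|\frac{f(A)+3f\left(\frac{2A+B}{3}\right)+3f\left(\frac{A+2B}{3}\right)+f(B)}{8}-\int_0^1f((1-t)A+tB)\,dt\right|\right|\right| \leq \frac{25}{288}\,|||B-A|||\,\max\{\|f'(A)\|,\|f'(B)\|\}.$$
   Context: $B(H)$ is the algebra of bounded linear operators on $H$, $\|\cdot\|$ is the operator norm, and $Sp(A)$ is the spectrum of $A$. A positive definite operator means a bounded self-adjoint operator $A$ with $\langle Ax,x\rangle>0$ for all $x\ne 0$ and $Sp(A)\subseteq(0,\infty)$. For a continuous real function $g$ on $(0,\infty)$, $g(A)$ is defined by the continuous functional calculus. A continuous real function $f$ on an interval $I$ is operator monotone if $A\le B$ implies $f(A)\le f(B)$ for all bounded self-adjoint operators $A,B$ with spectra in $I$ (on any complex Hilbert space). Operator monotone functions on $(0,\infty)$ are infinitely differentiable; $f'$ is the derivative of the scalar function $f$. A norm $|||\cdot|||$ on $B(H)$ is unitarily invariant if $|||UXV|||=|||X|||$ for all $X\in B(H)$ and all unitary $U,V\in B(H)$. *)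

(* Defs.v *)
From HB Require Import structures.
From mathcomp Require Import all_boot all_order all_algebra.
From mathcomp Require Import sesquilinear complex.
From mathcomp Require Import all_classical all_reals all_analysis.

Set Implicit Arguments.
Unset Strict Implicit.
Unset Printing Implicit Defensive.

Import Order.TTheory GRing.Theory Num.Theory.
Import numFieldNormedType.Exports.

Local Open Scope classical_set_scope.
Local Open Scope ring_scope.
Local Open Scope complex_scope.

(* The norm of a normedModType R[i] takes its values in R[i]; on R[i], x <= y
   means that y - x is a nonnegative real.  The inner product is linear in its
   first argument. *)
HB.mixin Record isHilbert (R : realType) (H : Type)
    of CompleteNormedModule R[i] H := {
  hdot : {dot H for (@Num.conj R[i])} ;
  hdotE : forall x : H, hdot x x = `|x| ^+ 2
}.

#[short(type="hilbertType")]
HB.structure Definition Hilbert (R : realType) :=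
  {H of isHilbert R H & CompleteNormedModule R[i] H}.

Definition inner (R : realType) (H : hilbertType R) (x y : H) : R[i] :=
  (hdot : {dot H for (@Num.conj R[i])}) x y.

Section BoundedOperators.
Variables (R : realType) (H : hilbertType R).

Definition bounded_linear : {pred H -> H} := mem [set A : H -> H |
  linear A /\ exists M : R, forall x, `|A x| <= M%:C * `|x|].

Lemma bounded_linearP (A : H -> H) : reflect
  (linear A /\ exists M : R, forall x, `|A x| <= M%:C * `|x|)
  (A \in bounded_linear).
Proof. exact: (iffP (asboolP _)). Qed.

Fact bounded_linear_subsemimod : subsemimod_closed bounded_linear.
Proof.
split; first split.
- apply/bounded_linearP; split=> [a u v|]; first by rewrite scaler0 addr0.
  by exists 0 => x; rewrite mul0r normr0.
- move=> A B /bounded_linearP[lA [M AM]] /bounded_linearP[lB [N BN]].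
  apply/bounded_linearP; split=> [a u v|].
    by rewrite !fctE lA lB scalerDr addrACA.
  exists (M + N) => x; rewrite fctE rmorphD mulrDl.
  by rewrite (le_trans (ler_normD _ _))// lerD.
- move=> c A /bounded_linearP[lA [M AM]].
  apply/bounded_linearP; split=> [a u v|].
    by rewrite !scalrfctE lA scalerDr !scalerA mulrC.
  exists (complex.Re `|c| * M) => x; rewrite scalrfctE normrZ.
  rewrite [X in _ <= X * _](rmorphM (real_complex R))/= -mulrA.
  by rewrite (RRe_real (normr_real c)) ler_wpM2l.
Qed.

HB.instance Definition _ := GRing.isSubSemiModClosed.Build R[i] (H -> H)
  bounded_linear bounded_linear_subsemimod.

Record bop := Bop { bop_fun :> H -> H ; _ : bop_fun \in bounded_linear }.

HB.instance Definition _ := [isSub for bop_fun].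
HB.instance Definition _ := [Choice of bop by <:].
HB.instance Definition _ := [SubChoice_isSubLmodule of bop by <:].

Lemma bop_linear (A : bop) : linear A.
Proof. by have /bounded_linearP[] := valP A. Qed.

HB.instance Definition _ (A : bop) :=
  GRing.isLinear.Build R[i] H H _ A (bop_linear A).

Lemma bopP (A B : bop) : A =1 B -> A = B.
Proof. by move=> AB; apply/val_inj/funext. Qed.

Fact bop_one_subproof : idfun \in bounded_linear.
Proof.
by apply/bounded_linearP; split=> //; exists 1 => x; rewrite mul1r.
Qed.
Definition bop_one : bop := Bop bop_one_subproof.

Fact bop_mul_subproof (A B : bop) : A \o B \in bounded_linear.
Proof.
have /bounded_linearP[_ [M AM]] := valP A.
have /bounded_linearP[_ [N BN]] := valP B.
apply/bounded_linearP; split=> [a u v|]; first by rewrite /= !linearP.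
exists (`|M| * N) => x /=.
rewrite [X in _ <= X * _](rmorphM (real_complex R))/= -mulrA.
apply: (le_trans (AM _)); apply: (@le_trans _ _ (`|M|%:C * `|B x|)).
  by rewrite ler_wpM2r// lecR ler_norm.
by rewrite ler_wpM2l// lecR.
Qed.
Definition bop_mul (A B : bop) : bop := Bop (bop_mul_subproof A B).

Fact bop_mulA : associative bop_mul.
Proof. by move=> A B C; exact: bopP. Qed.
Fact bop_mul1 : left_id bop_one bop_mul.
Proof. by move=> A; exact: bopP. Qed.
Fact bop_mulr1 : right_id bop_one bop_mul.
Proof. by move=> A; exact: bopP. Qed.
Fact bop_mulDl : left_distributive bop_mul +%R.
Proof. by move=> A B C; exact: bopP. Qed.
Fact bop_mulDr : right_distributive bop_mul +%R.
Proof. by move=> A B C; apply: bopP => x; exact: (linearD A). Qed.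

(* The zero space is allowed, so that 1 = 0 is possible in this ring. *)
HB.instance Definition _ := GRing.Zmodule_isPzRing.Build bop
  bop_mulA bop_mul1 bop_mulr1 bop_mulDl bop_mulDr.

Definition opnorm (A : bop) : R :=
  sup [set complex.Re `|A x| | x in [set x : H | `|x| <= 1]].

Lemma Re_norm (V : normedModType R[i]) (x : V) : (complex.Re `|x|)%:C = `|x|.
Proof. by rewrite RRe_real. Qed.

Lemma Re_normC (c : R[i]) : (complex.Re `|c|)%:C = `|c|.
Proof. by rewrite RRe_real. Qed.

Lemma opnorm_ub (A : bop) (x : H) :
  `|x| <= 1 -> complex.Re `|A x| <= opnorm A.
Proof.
move=> x1; apply: ub_le_sup; last by exists x.
have /bounded_linearP[_ [M AM]] := valP A.
exists `|M| => _ [y /= y1 <-]; rewrite -lecR Re_norm (le_trans (AM y))//.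
apply: (@le_trans _ _ (`|M|%:C * `|y|)).
  by rewrite ler_wpM2r// lecR ler_norm.
by rewrite ler_piMr// lecR.
Qed.

Lemma opnorm_lub (A : bop) (c : R) :
  (forall x, `|x| <= 1 -> complex.Re `|A x| <= c) -> opnorm A <= c.
Proof.
move=> Ac; apply: ge_sup => [|_ [x /= x1 <-]]; last exact: Ac.
by exists (complex.Re `|A 0|), 0 => //=; rewrite normr0.
Qed.

Fact opnormD (A B : bop) : opnorm (A + B) <= opnorm A + opnorm B.
Proof.
apply: opnorm_lub => x x1.
apply: le_trans (lerD (opnorm_ub A x1) (opnorm_ub B x1)).
by rewrite -lecR rmorphD/= !Re_norm ler_normD.
Qed.

Fact opnorm_eq0 (A : bop) : opnorm A = 0 -> A = 0.
Proof.
move=> A0; apply: bopP => x; apply/eqP/contraT => /= Ax0.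
have x0 : x != 0 by apply: contraNneq Ax0 => ->; rewrite linear0.
have nx0 : `|x| != 0 by rewrite normr_eq0.
have : complex.Re `|A (`|x|^-1 *: x)| <= opnorm A.
  by apply: opnorm_ub; rewrite normrZ normfV normr_id mulVf.
rewrite A0 -lecR Re_norm linearZ normrZ normfV normr_id.
by rewrite pmulr_rle0 ?invr_gt0 ?normr_gt0// normr_le0 (negbTE Ax0).
Qed.

Fact opnormZ_le (c : R[i]) (A : bop) :
  opnorm (c *: A) <= complex.Re `|c| * opnorm A.
Proof.
apply: opnorm_lub => x x1.
rewrite -lecR (rmorphM (real_complex R))/= Re_norm Re_normC.
rewrite -[leLHS]/(`|c *: A x|) normrZ ler_wpM2l//.
by rewrite -Re_norm lecR opnorm_ub.
Qed.

Fact opnormZ (c : R[i]) (A : bop) :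
  (opnorm (c *: A))%:C = `|c| * (opnorm A)%:C.
Proof.
rewrite -[`|c|]Re_normC -(rmorphM (real_complex R)); congr (_%:C).
apply/eqP; rewrite eq_le opnormZ_le andTb.
have [->|c0] := eqVneq c 0.
  have -> : complex.Re `|0 : R[i]| = 0 by rewrite normr0.
  rewrite scale0r mul0r.
  apply: le_trans (opnorm_ub 0 (x := 0) _); last by rewrite normr0.
  by rewrite -lecR Re_norm; exact: normr_ge0.
have cn : 0 < complex.Re `|c| by rewrite -ltcR Re_normC normr_gt0.
rewrite -ler_pdivlMl//; have := opnormZ_le c^-1 (c *: A).
rewrite scalerA mulVf// scale1r => /le_trans; apply.
suff -> : complex.Re `|c^-1| = (complex.Re `|c|)^-1 by [].
apply: (@complexI R); rewrite Re_normC normfV (fmorphV (real_complex R)).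
by rewrite /= Re_normC.
Qed.

Fact opnormCD (A B : bop) :
  (opnorm (A + B))%:C <= (opnorm A)%:C + (opnorm B)%:C.
Proof. by rewrite -(rmorphD (real_complex R)) lecR opnormD. Qed.

Fact opnormC_eq0 (A : bop) : (opnorm A)%:C = 0 -> A = 0.
Proof. by move=> /(@complexI R); exact: opnorm_eq0. Qed.

HB.instance Definition _ := @Lmodule_isNormed.Build R[i] bop
  (fun A : bop => (opnorm A)%:C) opnormCD opnormZ opnormC_eq0.

End BoundedOperators.

Section Operators.
Variables (R : realType) (H : hilbertType R).
Implicit Types (A B T U V : bop H).

Definition is_adjoint A B := forall x y, inner (A x) y = inner x (B y).

Definition self_adjoint A := is_adjoint A A.

Definition unitary U := exists V, [/\ is_adjoint U V, V * U = 1 & U * V = 1].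

Definition spectrum A : set R[i] :=
  [set z | ~ exists B, let Az := A - z *: (1 : bop H) in
    Az * B = 1 /\ B * Az = 1].

Definition spectrum_in A (I : set R) := spectrum A `<=` [set x%:C | x in I].

Definition bop_le A B := forall x, inner (A x) x <= inner (B x) x.

Definition positive_definite A :=
  [/\ self_adjoint A,
      forall x, x != 0 -> 0 < inner (A x) x &
      spectrum_in A [set` `]0, +oo[] ].

Definition bop_poly (p : {poly R}) A : bop H :=
  \sum_(i < size p) (p`_i)%:C *: A ^+ i.

(* For A self-adjoint and g continuous on the spectrum of A, g(A) is the limit
   in operator norm of p_n(A), where the polynomials p_n tend to g uniformly on
   the spectrum; by the Weierstrass theorem and the isometry of the polynomial
   calculus this limit exists, and it does not depend on the sequence. *)
Definition is_cfc (g : R -> R) A T := exists p : nat -> {poly R},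
  (forall e : R, 0 < e -> \forall n \near \oo, forall x : R,
      spectrum A x%:C -> `|(p n).[x] - g x| < e) /\
  bop_poly (p n) A @[n --> \oo] --> T.

Definition cfc (g : R -> R) A : bop H := get (is_cfc g A).

Record unitarily_invariant_norm (N : bop H -> R) : Prop := {
  uin_triangle : forall A B, N (A + B) <= N A + N B ;
  uin_homogeneous : forall (c : R[i]) A, (N (c *: A))%:C = `|c| * (N A)%:C ;
  uin_definite : forall A, N A = 0 -> A = 0 ;
  uin_unitary : forall U V A, unitary U -> unitary V -> N (U * A * V) = N A
}.

End Operators.

Definition operator_monotone (R : realType) (I : interval R) (f : R -> R) :=
  {within [set` I], continuous f} /\
  forall (H : hilbertType R) (A B : bop H),
    self_adjoint A -> self_adjoint B ->
    spectrum_in A [set` I] -> spectrum_in B [set` I] ->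
    bop_le A B -> bop_le (cfc f A) (cfc f B).

Section RiemannIntegral.
Variables (R : realType) (V : normedModType R[i]).
Implicit Types (a b : R) (F : R -> V) (s : seq R) (t : nat -> R).

(* A partition of [a, b] is the sequence s of its points other than a; its
   i-th subinterval, of tag t i, is [node a s i, node a s i.+1]. *)
Definition node a s i := nth a (a :: s) i.

Definition riemann_sum a s t F : V :=
  \sum_(i < size s) (node a s i.+1 - node a s i)%:C *: F (t i).

Definition is_riemann_integral a b F (S : V) :=
  forall e : R, 0 < e -> exists2 d : R, 0 < d & forall s t,
    itv_partition a b s ->
    (forall i, (i < size s)%N ->
       t i \in `[node a s i, node a s i.+1] /\
       node a s i.+1 - node a s i < d) ->
    `|riemann_sum a s t F - S| < e%:C.

Definition riemann_integral a b F : V := get (is_riemann_integral a b F).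

End RiemannIntegral.

(* Main.v *)
Require Import Defs.
From HB Require Import structures.
From mathcomp Require Import all_boot all_order all_algebra.
From mathcomp Require Import sesquilinear complex.
From mathcomp Require Import all_classical all_reals all_analysis.
From mathcomp Require Import ring lra zify.

(** Why the estimate holds.

    Cut [0, 1] at 1/8, 1/2 and 7/8: the four pieces have lengths 1/8, 3/8, 3/8
    and 1/8 and contain the nodes 0, 1/3, 2/3 and 1.  The quadrature error is
    therefore the integral of f(C_p) - f(C_t), where C_t = (1 - t)A + tB and p
    is the node in the piece of t.  If |||f(C_s) - f(C_t)||| <= L |s - t|, the
    error is at most L times the integral of |p - t|, which is 25/288
    ([three_eighths_mid_sum]).

    One may take L = f'(m) |||B - A|||, where m is the least point of the two
    spectra ([cfc_lip]).  As m belongs to one of them, f'(m) is at most the norm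
    of f'(A) or of f'(B) ([cfc_ge]).

    The Lipschitz estimate is usually read off from Loewner's integral
    representation of f.  A weaker property suffices: the divided differences
    of f have alternating signs, (-1)^(n-1) [z_0, ..., z_n]f >= 0 for n >= 1
    ([opmono_alternating]).  With nodes z_i to the right of the spectra, Newton's
    interpolation polynomial of f is then a constant minus a nonnegative
    combination of products of factors z_i - t.  For such a product P, a
    telescoping sum and N(SZ) <= |S| N(Z) bound N(P(X) - P(Y)) by
    -P'(m) N(X - Y), so that the Newton polynomial p satisfies the estimate with
    p'(m) ([newton_lip]).  The same signs make p and p' converge to f and f',
    uniformly and at a geometric rate for p ([newton_err_geo], [newton_nodes]);
    they also give the differentiability of f ([alt_derivative]).

    The signs come from finite matrices.  For 2k nodes, the functional
    g |-> [z_1, ..., z_2k]g has k positive and k negative weights and vanishes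
    on polynomials of degree less than 2k - 1.  The polynomials of degree less
    than k thus carry a single inner product, computed either at the nodes of
    negative weight or at those of positive weight.  Multiplication by the
    variable has two compressions A and B to this space, diagonal on the
    respective nodes, and B - A is positive of rank one ([dd_rank_one]).
    Evaluating f(A) <= f(B) at a polynomial q gives [z_1, ..., z_2k](q^2 f) >= 0
    ([opmono_dd_sqr]); q = 1 settles an even number of nodes, and q = X - z_2k with
    z_2k tending to infinity an odd number. *)

Set Implicit Arguments.
Unset Strict Implicit.
Unset Printing Implicit Defensive.

Import Order.TTheory GRing.Theory Num.Theory.
Import numFieldNormedType.Exports.

Local Open Scope classical_set_scope.
Local Open Scope ring_scope.
Local Open Scope complex_scope.

(** * Divided differences and Newton interpolation *)

Section DividedDifferences.
Variable F : fieldType.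
Implicit Types (s : seq F) (g : F -> F) (x y z t : F).

Definition dd_weight s z : F := (\prod_(y <- s | y != z) (z - y))^-1.

(** The weights are those of Lagrange interpolation: for distinct nodes this is
    the classical divided difference, in a form that is symmetric in the nodes. *)
Definition dd g s : F := \sum_(z <- s) g z * dd_weight s z.

Definition nodal s : {poly F} := \prod_(z <- s) ('X - z%:P).

(** The head of the list is the node added last. *)
Fixpoint newton g s : {poly F} :=
  if s is z :: s' then newton g s' + (dd g s) *: nodal s' else 0.

Lemma dd_weight_cons x s z : x != z -> dd_weight (x :: s) z = dd_weight s z / (z - x).
Proof. by move=> xz; rewrite /dd_weight big_cons xz invfM mulrC. Qed.

Lemma dd_weight_neq0 s z : dd_weight s z != 0.
Proof.
rewrite invr_neq0 // prodf_seq_neq0; apply/allP => y _.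
by apply/implyP; rewrite eq_sym subr_eq0.
Qed.

Lemma dd_perm g s s' : perm_eq s s' -> dd g s = dd g s'.
Proof.
move=> ss'; rewrite /dd (perm_big _ ss'); apply: eq_bigr => z _.
by rewrite /dd_weight (perm_big _ ss').
Qed.

Lemma eq_dd g h s : {in s, g =1 h} -> dd g s = dd h s.
Proof. by move=> gh; apply: eq_big_seq => z /gh ->. Qed.

Lemma ddD g h s : dd (fun t => g t + h t) s = dd g s + dd h s.
Proof. by rewrite -big_split; apply: eq_bigr => z _; rewrite mulrDl. Qed.

Lemma ddZ c g s : dd (fun t => c * g t) s = c * dd g s.
Proof. by rewrite mulr_sumr; apply: eq_bigr => z _; rewrite mulrA. Qed.

Lemma dd_single g x : dd g [:: x] = g x.
Proof.
by rewrite /dd big_seq1 /dd_weight big_cons eqxx big_nil invr1 mulr1.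
Qed.

(** The factor t - x kills the term of the node x and cancels x from the other
    weights.  All the algebra of divided differences below rests on this. *)
Lemma dd_subX g x s : x \notin s ->
  dd (fun t => (t - x) * g t) (x :: s) = dd g s.
Proof.
move=> xs; rewrite /dd big_cons subrr !mul0r add0r.
apply: eq_big_seq => z zs; have xz : x != z by apply: contraNneq xs => ->.
have zx0 : z - x != 0 by rewrite subr_eq0 eq_sym.
by rewrite dd_weight_cons // mulrAC [dd_weight s z / _]mulrC !mulrA mulfV // mul1r mulrC.
Qed.

(** Write both terms on the right as divided differences at the full list of
    nodes, of (t - y) g and of (t - x) g. *)
Lemma dd_rec g x y s : uniq (x :: y :: s) ->
  (x - y) * dd g (x :: y :: s) = dd g (x :: s) - dd g (y :: s).
Proof.
rewrite cons_uniq inE negb_or => /and3P[/andP[xy xs] ys us].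
have xs' : x \notin y :: s by rewrite inE negb_or xy.
have ys' : y \notin x :: s by rewrite inE negb_or eq_sym xy.
rewrite -(dd_subX g xs').
have -> : dd g (x :: s) = dd (fun t => (t - y) * g t) (x :: y :: s).
  rewrite -(dd_subX g ys'); apply: dd_perm.
  by rewrite (perm_catCA [:: y] [:: x] s).
rewrite -[X in _ = _ - X]mul1r -mulNr -!ddZ -ddD.
by apply: eq_dd => z _ /=; ring.
Qed.

Lemma dd_cst1 x y s : uniq (x :: y :: s) -> dd (fun=> 1) (x :: y :: s) = 0.
Proof.
elim: s x y => [|z s IHs] x y us;
  have := dd_rec (fun=> 1) us; have : x - y != 0 by
    rewrite subr_eq0; case/andP: us; rewrite in_cons negb_or => /andP[].
- by move=> xy0; rewrite !dd_single subrr => /eqP; rewrite mulf_eq0 (negPf xy0) => /eqP.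
- move=> xy0; move: (us); rewrite /= !inE !negb_or -!andbA.
  case/and5P => ? xz xs yz /and3P[ys zs u].
  rewrite !IHs ?subrr /= ?inE ?negb_or ?xz ?xs ?yz ?ys ?zs ?u //.
  by move=> /eqP; rewrite mulf_eq0 (negPf xy0) => /eqP.
Qed.

(** By induction on the nodes: p - p(x) is a multiple of X - x, and this factor
    removes the node x. *)
Lemma dd_poly (p : {poly F}) x s : uniq (x :: s) ->
  (size p <= (size s).+1)%N -> dd (horner p) (x :: s) = p`_(size s).
Proof.
elim: s x p => [|y s IHs] x p us sp.
  by rewrite dd_single (size1_polyC sp) hornerC coefC.
have [xs uys] := andP us.
have /factor_theorem [q pq] : root (p - p.[x]%:P) x.
  by rewrite rootE !hornerE subrr.
have Ep : p = p.[x]%:P + q * ('X - x%:P) by rewrite -pq addrC subrK.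
have sq : (size q <= (size s).+1)%N.
  have [->|q0] := eqVneq q 0; first by rewrite size_poly0.
  have := size_Mmonic q0 (monicXsubC x); rewrite -pq size_XsubC addn2 /= => sq.
  rewrite -ltnS -sq.
  by rewrite (leq_trans (size_polyD _ _))// size_polyN geq_max sp size_polyC; case: eqP.
rewrite (@eq_dd _ (fun t => p.[x] * 1 + (t - x) * q.[t])); last first.
  by move=> t _; rewrite {1}Ep !hornerE [_ * (t - x)]mulrC.
rewrite ddD ddZ dd_cst1 // mulr0 add0r dd_subX // IHs //.
have cq i : (size s < i)%N -> q`_i = 0.
  by move=> si; rewrite nth_default // (leq_trans sq).
rewrite [in RHS]Ep coefD coefC /= add0r mulrBr coefB coefMX coefMC /=.
by rewrite [q`_(size s).+1]cq ?mul0r ?subr0.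
Qed.

Lemma dd_poly0 (p : {poly F}) s : uniq s ->
  (size p < size s)%N -> dd (horner p) s = 0.
Proof.
case: s => // x s us sp; rewrite dd_poly //; last exact: ltnW.
by rewrite nth_default.
Qed.

Lemma nodal_cons z s : nodal (z :: s) = ('X - z%:P) * nodal s.
Proof. by rewrite /nodal big_cons. Qed.

Lemma horner_nodal_cons z s t : (nodal (z :: s)).[t] = (t - z) * (nodal s).[t].
Proof. by rewrite nodal_cons !hornerE. Qed.

Lemma horner_nodal_root s t : t \in s -> (nodal s).[t] = 0.
Proof. by move=> ts; apply/eqP; rewrite -rootE /nodal root_prod_XsubC. Qed.

(** Adding the node z replaces the coefficient of the error by the next divided
    difference times t - z, by the recurrence. *)
Lemma newton_err g s t : uniq (t :: s) ->
  g t - (newton g s).[t] = dd g (t :: s) * (nodal s).[t].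
Proof.
elim: s => [|z s IHs] /=.
  by move=> _; rewrite horner0 subr0 dd_single /nodal big_nil hornerC mulr1.
rewrite inE negb_or => /and3P[/andP[tz ts] zs us].
rewrite hornerD hornerZ opprD addrA IHs /= ?ts // -mulrBl -dd_rec /=; last first.
  by rewrite inE negb_or tz ts zs.
by rewrite horner_nodal_cons; ring.
Qed.

Lemma newton_interp g s : uniq s -> {in s, g =1 horner (newton g s)}.
Proof.
elim: s => [//|z s IHs] us t; have /= [zs us'] := andP us.
rewrite inE => /predU1P[->|ts].
  have := newton_err g us; rewrite hornerD hornerZ => <-.
  by rewrite addrC subrK.
by rewrite /= hornerD hornerZ (horner_nodal_root ts) mulr0 addr0 -IHs.
Qed.

End DividedDifferences.

(** * The two weighted models behind a divided difference *)

Lemma size_nodal (F : fieldType) (s : seq F) : size (nodal s) = (size s).+1.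
Proof. by rewrite /nodal size_prod_XsubC. Qed.

Lemma size_newton (F : fieldType) (g : F -> F) s : (size (newton g s) <= size s)%N.
Proof.
elim: s => [|z s IHs] /=; first by rewrite size_poly0.
rewrite (leq_trans (size_polyD _ _))// geq_max (leq_trans IHs)//=.
by rewrite (leq_trans (size_scale_leq _ _))// size_nodal.
Qed.

Section SignSplit.
Variable R : rcfType.
Implicit Types (s : seq R).

(** If fewer than k weights had the sign of c, the square of the polynomial that
    vanishes at their nodes would have degree less than 2k - 1, hence a zero
    divided difference, whereas the other nodes contribute terms of one strict
    sign. *)
Lemma dd_weight_sign_count s k (c : R) : uniq s -> size s = k.*2 -> c != 0 ->
  (k <= size [seq z <- s | (0 < c * dd_weight s z)%R])%N.
Proof.
move=> us sk c0; set a := seq.filter _ s; rewrite leqNgt; apply/negP => sa.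
have : dd (horner (nodal a ^+ 2)) s = 0.
  apply: dd_poly0 => //; rewrite (leq_ltn_trans (size_poly_exp_leq _ _))//.
  by rewrite size_nodal sk muln2 -doubleS leq_double.
move=> /(congr1 ( *%R (- c))); rewrite mulr0 /dd mulr_sumr big_seq => /eqP.
rewrite psumr_eq0 => [/allP za|z zs]; last first.
  rewrite horner_exp; have [cw|cw] := ltP 0 (c * dd_weight s z).
    by rewrite horner_nodal_root ?expr0n /= ?mul0r ?mulr0 // mem_filter cw.
  rewrite (_ : _ * _ = - (c * dd_weight s z) * (nodal a).[z] ^+ 2); last by ring.
  by rewrite mulr_ge0 ?sqr_ge0 ?oppr_ge0.
suff /(uniq_leq_size us) : (forall z, z \in s -> z \in a).
  by rewrite sk leqNgt (leq_trans sa) // -addnn leq_addr.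
move=> z zs; have := za _ zs; rewrite zs /= !mulf_eq0 oppr_eq0 (negPf c0).
by rewrite (negPf (dd_weight_neq0 _ _)) orbF horner_exp expf_eq0 /= -rootE root_prod_XsubC.
Qed.

Lemma size_dd_weight_sign s k (c : R) : uniq s -> size s = k.*2 -> c != 0 ->
  size [seq z <- s | (0 < c * dd_weight s z)%R] = k.
Proof.
move=> us sk c0; have h1 := dd_weight_sign_count us sk c0.
have Nc0 : - c != 0 by rewrite oppr_eq0.
have h2 := dd_weight_sign_count us sk Nc0.
suff : (size [seq z <- s | (0 < c * dd_weight s z)%R] +
        size [seq z <- s | (0 < - c * dd_weight s z)%R] = k.*2)%N.
  move=> AB; apply/eqP; rewrite eqn_leq h1 andbT.
  by rewrite -(leq_add2r (size [seq z <- s | (0 < - c * dd_weight s z)%R])) AB -addnn leq_add2l.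
rewrite !size_filter -sk -(count_predC (fun z => 0 < c * dd_weight s z) s).
congr addn; apply: eq_count => z /=; rewrite mulNr oppr_gt0 -leNgt le_eqVlt.
by rewrite mulf_eq0 (negPf c0) (negPf (dd_weight_neq0 _ _)).
Qed.

Lemma big_seq_ord (s : seq R) k (G : R -> R) : size s = k ->
  \sum_(z <- s) G z = \sum_(i < k) G s`_i.
Proof. by move=> sk; rewrite (big_nth 0) sk big_mkord. Qed.

(** A divided difference at 2k nodes is the difference of two positive quadrature
    rules, on the k nodes y and on the k nodes x, which agree up to degree
    2k - 2.  So polynomials of degree less than k embed isometrically into both
    weighted spaces, and onto by dimension: E q is the image of q at the nodes x,
    and W passes from the nodes x to the nodes y.  Multiplication by the variable
    is diagonal in each space; moved to the nodes x, the two multiplications differ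
    only by the coefficient of degree 2k - 1 of a product, which is the product of
    the leading coefficients: a rank one term. *)
Lemma dd_rank_one s k : uniq s -> size s = k.*2 ->
  exists (x y : 'rV[R]_k) (W : 'M[R]_k) (v : 'cV[R]_k) (E : {poly R} -> 'cV[R]_k),
  [/\ W^T *m W = 1%:M, W^T *m diag_mx y *m W = diag_mx x + v *m v^T,
      (forall i, x 0 i \in s), (forall i, y 0 i \in s) &
      forall (q : {poly R}) (g : R -> R), (size q <= k)%N ->
      dd (fun t => q.[t] ^+ 2 * g t) s =
      \sum_j g (y 0 j) * ((W *m E q) j 0) ^+ 2 - \sum_i g (x 0 i) * (E q i 0) ^+ 2].
Proof.
case: k => [|k] us sk.
  exists 0, 0, 0, 0, (fun=> 0); split=> [||[]//|[]//|q g _].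
  - by apply/matrixP => -[].
  - by apply/matrixP => -[].
  - by rewrite !big_ord0 subrr; case: (s) sk => // _; rewrite /dd big_nil.
pose a := [seq z <- s | 0 < -1 * dd_weight s z].
pose b := [seq z <- s | 0 < 1 * dd_weight s z].
have sa : size a = k.+1 by apply: size_dd_weight_sign => //; rewrite oppr_eq0 oner_eq0.
have sb : size b = k.+1 by apply: size_dd_weight_sign => //; rewrite oner_eq0.
have al0 (i : 'I_k.+1) : 0 < - dd_weight s a`_i.
  have : a`_i \in a by rewrite mem_nth ?sa ?ltn_ord.
  by rewrite mem_filter mulN1r => /andP[].
have be0 (i : 'I_k.+1) : 0 < dd_weight s b`_i.
  have : b`_i \in b by rewrite mem_nth ?sb ?ltn_ord.
  by rewrite mem_filter mul1r => /andP[].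
have ddE g : dd g s = \sum_(j < k.+1) g b`_j * dd_weight s b`_j -
                      \sum_(i < k.+1) g a`_i * - dd_weight s a`_i.
  rewrite -(big_seq_ord (fun z => g z * dd_weight s z) sb).
  rewrite -(big_seq_ord (fun z => g z * - dd_weight s z) sa) !big_filter /dd.
  rewrite (bigID (fun z => 0 < 1 * dd_weight s z)) /=; congr +%R.
  rewrite raddf_sum /= ; apply: eq_big => [z|z _]; last by rewrite mulrN opprK.
  by rewrite mul1r mulN1r oppr_gt0 -leNgt le_eqVlt (negPf (dd_weight_neq0 _ _)).
have ua : uniq a by rewrite filter_uniq.
(* the Lagrange basis at the nodes of negative weight *)
pose l (i : 'I_k.+1) : {poly R} := newton (fun t => (t == a`_i)%:R) a.
have sl i : (size (l i) <= k.+1)%N by rewrite -sa size_newton.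
have sll i i' : (size (l i * l i')%R <= k.*2.+1)%N.
  rewrite (leq_trans (size_polyMleq _ _)) //.
  by move: (sl i) (sl i'); move: (size _) (size _) => m n; clear; lia.
have la (i i' : 'I_k.+1) : (l i).[a`_i'] = (i' == i)%:R.
  have a_i' : a`_i' \in a by apply: mem_nth; rewrite sa.
  by rewrite -(newton_interp (fun t => (t == a`_i)%:R) ua a_i'); rewrite nth_uniq ?sa ?ltn_ord.
pose x : 'rV[R]_k.+1 := \row_i a`_i; pose y : 'rV[R]_k.+1 := \row_i b`_i.
pose sal (i : 'I_k.+1) := Num.sqrt (- dd_weight s a`_i).
pose sbe (i : 'I_k.+1) := Num.sqrt (dd_weight s b`_i).
have sal0 : forall j, sal j != 0.
  by move=> j; rewrite /sal sqrtr_eq0 -ltNge.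
have sbe2 : forall j, sbe j ^+ 2 = dd_weight s b`_j by move=> j; rewrite sqr_sqrtr // ltW.
have sal2 : forall j, sal j ^+ 2 = - dd_weight s a`_j by move=> j; rewrite sqr_sqrtr // ltW.
pose W : 'M[R]_k.+1 := \matrix_(j, i) (sbe j * (l i).[b`_j] / sal i).
pose v : 'cV[R]_k.+1 := \col_i ((l i)`_k / sal i).
pose E (q : {poly R}) : 'cV[R]_k.+1 := \col_i (sal i * q.[a`_i]).
have WE (q : {poly R}) : (size q <= k.+1)%N ->
    W *m E q = \col_j (sbe j * q.[b`_j]).
  move=> sq; apply/colP => j; rewrite !mxE.
  have -> : q = \sum_(i < k.+1) q.[a`_i] *: l i.
    apply/eqP; rewrite -subr_eq0; apply/eqP; apply: (roots_geq_poly_eq0 _ ua).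
      apply/allP => z za; rewrite rootE !hornerE.
      have [i ->] : exists i : 'I_k.+1, z = a`_i.
        have ia : (index z a < k.+1)%N by rewrite -sa index_mem.
        by exists (Ordinal ia); rewrite /= nth_index.
      rewrite horner_sum (bigD1 i) //= big1 => [|i' ne].
        by rewrite hornerZ la eqxx mulr1 addr0 subrr.
      by rewrite hornerZ la eq_sym (negPf ne) mulr0.
    rewrite sa (leq_trans (size_polyD _ _)) // geq_max sq size_polyN.
    rewrite (leq_trans (size_sum _ _ _)) //; apply/bigmax_leqP => i _.
    by rewrite (leq_trans (size_scale_leq _ _)).
  rewrite horner_sum mulr_sumr; apply: eq_bigr => i _.
  rewrite !mxE horner_sum (bigD1 i) //= big1 => [|i' ne]; last first.
    by rewrite hornerZ la eq_sym (negPf ne) mulr0.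
  rewrite !hornerZ la eqxx mulr1 addr0.
  by field.
exists x, y, W, v, E; split.
- apply/matrixP => i i'; rewrite !mxE.
  have : dd (horner (l i * l i')) s = 0.
    by apply: dd_poly0 => //; rewrite (leq_ltn_trans (sll _ _)) // sk doubleS.
  rewrite ddE => /eqP; rewrite subr_eq0 => /eqP h.
  transitivity ((\sum_(j < k.+1) (l i * l i').[b`_j] * dd_weight s b`_j) / (sal i * sal i')).
    rewrite mulr_suml; apply: eq_bigr => j _; rewrite !mxE hornerM -sbe2.
    by field; rewrite !sal0.
  rewrite h (bigD1 i) //= big1 => [|j ji]; last first.
    by rewrite hornerM la (negPf ji) !mul0r.
  rewrite hornerM !la eqxx addr0 mul1r -sal2.
  have [->|_] := eqVneq i i'; last by rewrite !mul0r.
  by field; rewrite sal0.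
- apply/matrixP => i i'; rewrite mul_mx_diag !mxE big_ord1 !mxE.
  have : dd (horner (l i * l i' * 'X)) s = (l i * l i' * 'X)`_k.*2.+1.
    have : size s = k.*2.+2 by rewrite sk.
    case: (s) us => // z s' us' [ss']; rewrite -ss' dd_poly // ss'.
    by rewrite (leq_trans (size_polyMleq _ _))// size_polyX addn2 /= ltnS sll.
  have lt_k : (k < k.*2.+1)%N by rewrite ltnS -addnn leq_addr.
  rewrite coefMX /= coefM (bigD1 (Ordinal lt_k)) //=.
  rewrite big1 => [|j jk]; last first.
    have [jk'|kj] := ltnP j k.
      rewrite [X in _ * X]nth_default ?mulr0 // (leq_trans (sl _)) //.
      by rewrite ltn_subRL -[X in (_ < X)%N]addnn ltn_add2r.
    have kj' : (k < j)%N.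
      by rewrite ltn_neqAle kj andbT; apply: contra_neq jk => /= kj'; apply: val_inj.
    by rewrite nth_default ?mul0r // (leq_trans (sl _)).
  rewrite addr0 -addnn addnK ddE => /eqP; rewrite subr_eq => /eqP h.
  transitivity ((\sum_(j < k.+1) (l i * l i' * 'X).[b`_j] * dd_weight s b`_j)
                / (sal i * sal i')).
    rewrite mulr_suml; apply: eq_bigr => j _; rewrite !mxE !hornerM hornerX -sbe2.
    by field; rewrite !sal0.
  rewrite h mulrDl addrC; congr +%R; first by field; rewrite !sal0.
  rewrite (bigD1 i) //= big1 => [|j ji]; last first.
    by rewrite !hornerM la (negPf ji) !mul0r.
  rewrite !hornerM !la eqxx addr0 mul1r hornerX -sal2.
  have [->|_] := eqVneq i i'; last by rewrite !mul0r.
  by rewrite /= mulr1n mul1r expr2 mulfK ?mulf_neq0 ?sal0.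
- move=> i; rewrite mxE; have : a`_i \in a by rewrite mem_nth ?sa ?ltn_ord.
  by rewrite mem_filter => /andP[].
- move=> i; rewrite mxE; have : b`_i \in b by rewrite mem_nth ?sb ?ltn_ord.
  by rewrite mem_filter => /andP[].
move=> q g sq; rewrite WE // ddE; congr (_ - _); apply: eq_bigr => i _; rewrite !mxE exprMn.
  by rewrite sbe2; ring.
by rewrite sal2; ring.
Qed.
End SignSplit.

(** * Functions with alternating divided differences *)

(** A list of n + 1 nodes gives a divided difference of order n; its sign is
    (-1)^(n - 1), as for the derivatives of the functions -1/(l + t). *)
Definition alternating (R : realType) (f : R -> R) := forall s : seq R,
  uniq s -> (1 < size s)%N -> {in s, forall z, 0 < z} -> 0 <= (-1) ^+ size s * dd f s.

Section Nodal.
Variable R : realType.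
Implicit Types (s : seq R) (t u z : R).

(** The factors z - X make the values nonnegative to the left of the nodes. *)
Definition pnodal s : {poly R} := \prod_(z <- s) (z%:P - 'X).

Lemma pnodal_cons z s : pnodal (z :: s) = (z%:P - 'X) * pnodal s.
Proof. by rewrite /pnodal big_cons. Qed.

Lemma pnodal_nil : pnodal [::] = 1.
Proof. by rewrite /pnodal big_nil. Qed.

Lemma nodalE s : nodal s = (-1) ^+ size s *: pnodal s.
Proof.
elim: s => [|z s IHs]; first by rewrite pnodal_nil expr0 scale1r /nodal big_nil.
by rewrite nodal_cons IHs pnodal_cons exprS mulN1r scaleNr -scalerAr -scalerN -mulNr opprB.
Qed.

Lemma pnodal_ge0 s t : {in s, forall z, t <= z} -> 0 <= (pnodal s).[t].
Proof.
elim: s => [_|z s IHs tz]; first by rewrite pnodal_nil hornerC.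
rewrite pnodal_cons !hornerE mulr_ge0 ?subr_ge0 ?tz ?mem_head // IHs // => w ws.
by rewrite tz // inE ws orbT.
Qed.

Lemma deriv_pnodal_cons z s t :
  (pnodal (z :: s))^`().[t] = - (pnodal s).[t] + (z - t) * (pnodal s)^`().[t].
Proof. by rewrite pnodal_cons derivM derivB derivC derivX sub0r !hornerE mulN1r. Qed.

Lemma pnodal_deriv_le0 s t : {in s, forall z, t <= z} -> (pnodal s)^`().[t] <= 0.
Proof.
elim: s => [_|z s IHs tz]; first by rewrite pnodal_nil derivC horner0.
have tz' : {in s, forall z, t <= z} by move=> w ws; rewrite tz // inE ws orbT.
rewrite deriv_pnodal_cons; have := pnodal_ge0 tz'; have := IHs tz'.
have : t <= z by rewrite tz ?mem_head.
by move=> h1 h2 h3; nra.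
Qed.

(** Convexity to the left of the nodes.  Multiplying the tangent inequality by the
    factor z - u leaves the surplus - P'(t) (u - t)^2, which is nonnegative. *)
Lemma pnodal_tangent s t u : {in s, forall z, t <= z} -> {in s, forall z, u <= z} ->
  (pnodal s).[t] + (pnodal s)^`().[t] * (u - t) <= (pnodal s).[u].
Proof.
elim: s => [_ _|z s IHs tz uz]; first by rewrite pnodal_nil derivC horner0 mul0r addr0 !hornerC.
have tz' : {in s, forall z, t <= z} by move=> w ws; rewrite tz // inE ws orbT.
have uz' : {in s, forall z, u <= z} by move=> w ws; rewrite uz // inE ws orbT.
rewrite deriv_pnodal_cons pnodal_cons !hornerM !hornerD !hornerN !hornerC !hornerX.
have uz0 : 0 <= z - u by rewrite subr_ge0 uz ?mem_head.
have := ler_wpM2l uz0 (IHs tz' uz'); have := pnodal_deriv_le0 tz'.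
set a := (pnodal s).[t]; set b := _.[t]; set d := _.[u] => b0 h.
apply: le_trans h; rewrite -subr_ge0.
rewrite (_ : _ - _ = - b * (u - t) ^+ 2); last by ring.
by rewrite mulr_ge0 ?sqr_ge0 ?oppr_ge0.
Qed.

End Nodal.

Section Alternating.
Variables (R : realType) (f : R -> R).
Hypothesis alt : alternating f.
Implicit Types (s : seq R) (t u x y z : R).

(** The sign of the divided difference compensates that of the nodal polynomial, so
    that each step after the first subtracts a nonnegative multiple of a product
    that is positive to the left of the nodes. *)
Lemma newton_consE z s :
  newton f (z :: s) = newton f s - ((-1) ^+ (size s).+1 * dd f (z :: s)) *: pnodal s.
Proof.
rewrite /= nodalE scalerA exprS mulN1r mulNr scaleNr opprK.
by rewrite [_ * (-1) ^+ _]mulrC.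
Qed.

Lemma alt_cons z s : uniq (z :: s) -> (0 < size s)%N -> {in z :: s, forall z, 0 < z} ->
  0 <= (-1) ^+ (size s).+1 * dd f (z :: s).
Proof. by move=> us s0 p; apply: (alt us). Qed.

(** Concavity: a constant minus a nonnegative combination of convex products. *)
Lemma newton_tangent s t u : uniq s -> {in s, forall z, 0 < z} ->
  {in s, forall z, t <= z} -> {in s, forall z, u <= z} ->
  (newton f s).[u] <= (newton f s).[t] + (newton f s)^`().[t] * (u - t).
Proof.
elim: s => [_ _ _ _|z s IHs us pz tz uz].
  by rewrite /= deriv0 !horner0 mul0r addr0.
have tz' : {in s, forall z, t <= z} by move=> w ws; rewrite tz // inE ws orbT.
have uz' : {in s, forall z, u <= z} by move=> w ws; rewrite uz // inE ws orbT.
have pz' : {in s, forall z, 0 < z} by move=> w ws; rewrite pz // inE ws orbT.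
have [->|s0] := eqVneq s [::].
  by rewrite /= add0r derivZ !hornerZ /nodal !big_nil derivC horner0 mulr0 mul0r addr0 !hornerC.
rewrite newton_consE derivB derivZ !hornerD !hornerN !hornerZ.
have := IHs (andP us).2 pz' tz' uz'; have := pnodal_tangent tz' uz'.
have := alt_cons us _ pz; rewrite lt0n size_eq0 s0 => /(_ isT).
set a := _ * dd _ _; set b := (pnodal s).[t]; set c := (pnodal s)^`().[t].
set d := (pnodal s).[u] => a0 h1 h2.
have := ler_wpM2l a0 h1; lra.
Qed.

Lemma newton_errE s t : uniq (t :: s) ->
  (newton f s).[t] - f t = (-1) ^+ (size s).+1 * dd f (t :: s) * (pnodal s).[t].
Proof.
move=> us; rewrite -opprB newton_err // nodalE hornerZ exprS; ring.
Qed.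

Lemma notin_lt t s : {in s, forall z, t < z} -> t \notin s.
Proof. by move=> h; apply/negP => /h; rewrite ltxx. Qed.

Lemma in_cons_pos t s : 0 < t -> {in s, forall z, t < z} -> {in t :: s, forall z, 0 < z}.
Proof. by move=> t0 ts z; rewrite inE => /predU1P[->//|/ts]; exact: lt_trans. Qed.

Lemma newton_ge s t : uniq s -> (0 < size s)%N -> 0 < t -> {in s, forall z, t < z} ->
  f t <= (newton f s).[t].
Proof.
move=> us s0 t0 ts; have uts : uniq (t :: s) by rewrite /= us notin_lt.
rewrite -subr_ge0 newton_errE // mulr_ge0 ?alt_cons //; first exact: in_cons_pos.
by apply: pnodal_ge0 => z /ts/ltW.
Qed.

Lemma newton_mono z s t : uniq (z :: s) -> (0 < size s)%N -> 0 < t ->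
  {in z :: s, forall z, t < z} -> (newton f (z :: s)).[t] <= (newton f s).[t].
Proof.
move=> us s0 t0 ts; rewrite newton_consE hornerD hornerN hornerZ gerBl.
rewrite mulr_ge0 ?alt_cons //.
  by move=> w /ts; exact: lt_trans.
by apply: pnodal_ge0 => w ws; rewrite ltW // ts // inE ws orbT.
Qed.

Lemma pnodal_ratio s (m0 m t b : R) : m0 < m -> m <= t -> m0 < b ->
  {in s, forall z, t <= z <= b} ->
  (pnodal s).[t] <= ((b - m) / (b - m0)) ^+ size s * (pnodal s).[m0].
Proof.
move=> m0m mt m0b; elim: s => [_|z s IHs hz].
  by rewrite pnodal_nil !hornerC expr0 mulr1.
have hz' : {in s, forall z, t <= z <= b} by move=> w ws; rewrite hz // inE ws orbT.
have /andP[tz zb] := hz z (mem_head _ _).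
rewrite !pnodal_cons !hornerM !hornerD !hornerN !hornerC !hornerX /= exprS.
rewrite mulrACA ler_pM ?subr_ge0 ?IHs //.
  by apply: pnodal_ge0 => w /hz' /andP[].
rewrite mulrAC ler_pdivlMr ?subr_gt0 //; nra.
Qed.

(** The error at t is a divided difference, which decreases in t, times a nodal
    product, each factor of which is at most (b - m) / (b - m0) times its value at
    m0.  So the error at m0 is contracted geometrically, and it is at most
    f z0 - f m0, because the values of the Newton polynomials at m0 decrease from
    f z0. *)
Lemma newton_err_geo s z0 (m0 m t b : R) : uniq (rcons s z0) -> 0 < m0 -> m0 < m -> m <= t ->
  {in rcons s z0, forall z, t < z <= b} ->
  (newton f (rcons s z0)).[t] - f t <=
    ((b - m) / (b - m0)) ^+ (size s).+1 * (f z0 - f m0).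
Proof.
move=> us m00 m0m mt hz; set S := rcons s z0.
have sS : (size s).+1 = size S by rewrite size_rcons.
have S0 : (0 < size S)%N by rewrite -sS.
have tS : {in S, forall z, t < z} by move=> z /hz/andP[].
have m0S : {in S, forall z, m0 < z} by move=> z /tS; apply: lt_trans; exact: lt_le_trans mt.
have t0 : 0 < t by rewrite (lt_trans m00) // (lt_le_trans m0m).
have ut : uniq (t :: S) by rewrite /= us notin_lt.
have um : uniq (m0 :: S) by rewrite /= us notin_lt.
have m0t : m0 < t by rewrite (lt_le_trans m0m).
have m0b : m0 < b.
  have /hz /andP[tz zb] : z0 \in S by rewrite mem_rcons mem_head.
  by rewrite (lt_trans m0t) // (lt_le_trans tz).
have rho0 : 0 <= (b - m) / (b - m0).
  have /hz /andP[tz zb] : z0 \in S by rewrite mem_rcons mem_head.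
  by rewrite divr_ge0 ?subr_ge0 ?(ltW m0b) // (le_trans mt) // (le_trans (ltW tz)).
have h1 : (newton f S).[m0] <= f z0.
  move: us m0S; rewrite /S; elim: (s) => [|z s' IHs] us' hs.
    by rewrite /= add0r hornerZ /nodal big_nil hornerC mulr1 dd_single.
  rewrite (le_trans (newton_mono us' _ _ hs)) ?size_rcons //.
  by apply: IHs => [|w ws]; [case/andP: us'|apply: hs; rewrite inE ws orbT].
have h2 : (-1) ^+ (size S).+1 * dd f (t :: S) <= (-1) ^+ (size S).+1 * dd f (m0 :: S).
  have u2 : uniq [:: m0, t & S].
    by rewrite cons_uniq ut andbT inE negb_or (lt_eqF m0t) notin_lt.
  have p2 : {in [:: m0, t & S], forall z, 0 < z}.
    move=> z; rewrite inE => /predU1P[->//|]; apply: in_cons_pos => //.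
  have := alt u2 isT p2; rewrite /= => h.
  rewrite -subr_ge0 -mulrBr -dd_rec // mulrCA -opprB mulNr -mulrN mulr_ge0 ?subr_ge0 ?(ltW m0t) //.
  by rewrite -mulNr -mulN1r -exprS.
rewrite newton_errE //.
apply: (@le_trans _ _ ((-1) ^+ (size S).+1 * dd f (m0 :: S) *
  (((b - m) / (b - m0)) ^+ size S * (pnodal S).[m0]))).
  rewrite ler_pM ?alt_cons //; first exact: in_cons_pos.
    by apply: pnodal_ge0 => z /tS/ltW.
  by apply: pnodal_ratio => // z /hz/andP[/ltW -> ->].
rewrite mulrCA -newton_errE // sS ler_wpM2l ?exprn_ge0 // lerD2r //.
Qed.

Lemma dd2_le0 x y z : uniq [:: x; y; z] -> 0 < x -> 0 < y -> 0 < z -> dd f [:: x; y; z] <= 0.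
Proof.
move=> us x0 y0 z0; have p : {in [:: x; y; z], forall w, 0 < w}.
  by move=> w; rewrite !inE => /or3P[] /eqP ->.
have := alt us isT p; rewrite /=.
by rewrite !exprS expr0 !mulN1r opprK mulN1r oppr_ge0.
Qed.

Lemma dd3_ge0 x y z w : uniq [:: x; y; z; w] -> 0 < x -> 0 < y -> 0 < z -> 0 < w ->
  0 <= dd f [:: x; y; z; w].
Proof.
move=> us x0 y0 z0 w0; have p : {in [:: x; y; z; w], forall v, 0 < v}.
  by move=> v; rewrite !inE => /or4P[] /eqP ->.
have := alt us isT p; rewrite /=.
by rewrite !exprS expr0 !mulN1r !opprK mul1r.
Qed.

Lemma dd1_ge0 x y : x != y -> 0 < x -> 0 < y -> 0 <= dd f [:: x; y].
Proof.
move=> xy x0 y0; have us : uniq [:: x; y] by rewrite /= inE xy.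
have p : {in [:: x; y], forall v, 0 < v}.
  by move=> v; rewrite !inE => /orP[] /eqP ->.
have := alt us isT p; rewrite /=.
by rewrite !exprS expr0 !mulN1r !opprK mul1r.
Qed.

Lemma uniq3P x y z : uniq [:: x; y; z] -> [/\ x != y, x != z & y != z].
Proof. by rewrite /= !inE negb_or => /and3P[/andP[]]. Qed.

(** Since third-order divided differences are nonnegative. *)
Lemma dd2_mono a x y z : 0 < a -> a < x -> a < y -> a < z -> uniq [:: x; y; z] ->
  dd f [:: a; y; z] <= dd f [:: x; y; z].
Proof.
move=> a0 ax ay az us; have [xy xz yz] := uniq3P us.
have u4 : uniq [:: x; a; y; z].
  by rewrite /= !inE !negb_or xy xz yz (gt_eqF ax) (lt_eqF ay) (lt_eqF az).
rewrite -subr_ge0 -dd_rec // mulr_ge0 ?subr_ge0 ?(ltW ax) //.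
by apply: dd3_ge0 => //; exact: lt_trans a0 _.
Qed.

(** By monotonicity, comparison with three fixed nodes to the left of a suffices. *)
Lemma dd2_bound a : 0 < a -> exists2 C, 0 <= C &
  forall x y z, a <= x -> a <= y -> a <= z -> uniq [:: x; y; z] -> - C <= dd f [:: x; y; z].
Proof.
(* any three points between 0 and a would do *)
move=> a0; pose a1 := a / 2; pose a2 := a / 3; pose a3 := a / 4.
have a10 : 0 < a1 by rewrite divr_gt0. have a20 : 0 < a2 by rewrite divr_gt0.
have a30 : 0 < a3 by rewrite divr_gt0.
have h1 : a1 < a by rewrite /a1; lra. have h2 : a2 < a1 by rewrite /a1 /a2; lra.
have h3 : a3 < a2 by rewrite /a3 /a2; lra.
exists (- dd f [:: a3; a2; a1]).
  by rewrite oppr_ge0 dd2_le0 //= !inE negb_or (lt_eqF h3) (lt_eqF h2) (lt_eqF (lt_trans h3 h2)).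
move=> x y z ax ay az; rewrite opprK => us.
have [xy xz yz] := uniq3P us.
have e1 := @dd2_mono a1 x y z a10 (lt_le_trans h1 ax) (lt_le_trans h1 ay) (lt_le_trans h1 az) us.
have l1 u : a <= u -> a1 < u by apply: lt_le_trans.
have l2 u : a <= u -> a2 < u by move=> /l1; apply: lt_trans.
have l3 u : a <= u -> a3 < u by move=> /l2; apply: lt_trans.
have e2 : dd f [:: a2; a1; z] <= dd f [:: y; a1; z].
  apply: dd2_mono => //; [exact: l2|exact: l2|].
  by rewrite /= !inE negb_or yz (gt_eqF (l1 _ ay)) (lt_eqF (l1 _ az)).
have e3 : dd f [:: a3; a2; a1] <= dd f [:: z; a2; a1].
  apply: dd2_mono => //; [exact: l3|exact: lt_trans h2|].
  by rewrite /= !inE negb_or (gt_eqF (l1 _ az)) (gt_eqF (l2 _ az)) (lt_eqF h2).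
rewrite (le_trans e3) // (@dd_perm _ _ _ [:: a2; a1; z]); last first.
  by rewrite (perm_catC [:: z] [:: a2; a1]).
rewrite (le_trans e2) // (@dd_perm _ _ _ [:: a1; y; z]) //.
by rewrite (perm_catCA [:: y] [:: a1] [:: z]).
Qed.

Lemma dd_pairE x y : x != y -> dd f [:: x; y] = (f x - f y) / (x - y).
Proof.
move=> xy; apply: (mulfI (x := x - y)); first by rewrite subr_eq0.
by rewrite dd_rec ?dd_single 1?mulrC ?divfK ?subr_eq0 //= inE xy.
Qed.

Lemma dd_pairC x y : dd f [:: x; y] = dd f [:: y; x].
Proof. by apply: dd_perm; rewrite (perm_catC [:: x] [:: y]). Qed.

Lemma dd_slope x y z : x != y -> x != z ->
  dd f [:: x; y] - dd f [:: x; z] = (y - z) * dd f [:: y; z; x].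
Proof.
move=> xy xz; have [->|yz] := eqVneq y z; first by rewrite !subrr mul0r.
by rewrite dd_rec ?(dd_pairC x) //= !inE negb_or yz eq_sym xy eq_sym xz.
Qed.

Lemma dd_antitone x y z : 0 < x -> 0 < y -> x != y -> x != z -> y <= z ->
  dd f [:: x; z] <= dd f [:: x; y].
Proof.
move=> x0 y0 xy xz yz; have [->//|yz'] := eqVneq y z.
have {}yz : y < z by rewrite lt_neqAle yz' yz.
rewrite -subr_ge0 dd_slope // nmulr_rge0 ?subr_lt0 //.
apply: dd2_le0 => //; last exact: lt_trans yz.
by rewrite /= !inE negb_or yz' eq_sym xy eq_sym xz.
Qed.

(** The slope of f between x and y decreases in y and varies by at most C |y - z|
    between y and z.  Its limit at x is the supremum of the slopes to the right. *)
Lemma alt_slope_limit a : 0 < a -> exists2 C, 0 <= C &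
  forall x, a < x -> exists l, [/\ 0 <= l,
    forall y, a <= y -> y != x -> `|l - dd f [:: x; y]| <= C * `|y - x| &
    forall y, a <= y -> f y <= f x + l * (y - x)].
Proof.
move=> a0; have [C C0 hC] := dd2_bound a0; exists C => // x ax.
have x0 := lt_trans a0 ax.
have lip y z : a <= y -> a <= z -> y != x -> z != x ->
    `|dd f [:: x; y] - dd f [:: x; z]| <= C * `|y - z|.
  move=> ay az yx zx; have [->|yz] := eqVneq y z; first by rewrite !subrr normr0 mulr0.
  rewrite dd_slope 1?eq_sym // normrM mulrC ler_wpM2r //.
  have u3 : uniq [:: y; z; x] by rewrite /= !inE negb_or yz yx zx.
  have d2 : dd f [:: y; z; x] <= 0 by apply: dd2_le0 => //; exact: lt_le_trans a0 _.
  by rewrite ler0_norm // lerNl; apply: hC => //; exact: ltW.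
pose S := [set dd f [:: x; y] | y in [set y | x < y]].
have S0 : S !=set0 by exists (dd f [:: x; x + 1]), (x + 1) => //=; rewrite ltrDl.
have ub z : a <= z -> z < x -> ubound S (dd f [:: x; z]).
  move=> az zx _ [y /= xy <-].
  apply: dd_antitone => //; first exact: lt_le_trans az.
  - by rewrite gt_eqF.
  - by rewrite lt_eqF.
  - by rewrite ltW // (lt_trans zx).
have hS : has_sup S by split=> //; exists (dd f [:: x; a]); exact: ub.
pose l := sup S.
have lge y : x < y -> dd f [:: x; y] <= l by move=> xy; apply: ub_le_sup; [exact: hS.2|exists y].
have lle z : a <= z -> z < x -> l <= dd f [:: x; z] by move=> az zx; apply: ge_sup => //; exact: ub.
have lup y : x < y -> l <= dd f [:: x; y] + C * (y - x).
  move=> xy; apply: ge_sup => // _ [w /= xw <-].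
  have [yw|wy] := leP y w.
    rewrite ler_wpDr ?mulr_ge0 ?subr_ge0 ?(ltW xy) //.
    by apply: dd_antitone => //; [exact: lt_trans xy|rewrite lt_eqF|rewrite lt_eqF].
  have := lip w y (ltW (lt_trans ax xw)) (ltW (lt_trans ax xy)); rewrite !gt_eqF // => /(_ isT isT).
  rewrite ler_norml => /andP[_]; rewrite lerBlDl => /le_trans; apply.
  rewrite lerD2l ler_wpM2l // ltr0_norm ?subr_lt0 // opprB lerD2l lerN2 ltW //.
exists l; split.
- by apply: le_trans (lge (x + 1) _); rewrite ?ltrDl // dd1_ge0 ?lt_eqF ?ltrDl // addr_gt0.
- move=> y ay yx; have [xy|yx'] := ltP x y.
    rewrite ger0_norm ?subr_ge0 ?lge // gtr0_norm ?subr_gt0 // lerBlDl.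
    exact: lup.
  have {}yx' : y < x by rewrite lt_neqAle yx.
  rewrite ler0_norm ?subr_le0 ?lle // opprB ltr0_norm ?subr_lt0 // opprB.
  apply/ler_addgt0Pr => e e0; pose w := x + e / (C + 1).
  have C1 : 0 < C + 1 by rewrite ltr_wpDl.
  have xw : x < w by rewrite ltrDl divr_gt0.
  have := lip y w ay (ltW (lt_trans ax xw)); rewrite lt_eqF // gt_eqF // => /(_ isT isT).
  rewrite ler_norml => /andP[_]; rewrite ltr0_norm ?subr_lt0 ?(lt_trans yx') // opprB.
  have := lge w xw.
  have : C * (w - y) <= C * (x - y) + e.
    rewrite /w (_ : C * _ = C * (x - y) + C * (e / (C + 1))); last by ring.
    rewrite lerD2l mulrCA ger_pMr // ler_pdivrMr // mul1r lerDl //.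
  lra.
move=> y ay; have [xy|yx|->] := ltgtP x y.
- have := lge y xy; rewrite dd_pairE ?lt_eqF // -[X in X <= _ -> _]mulrNN -invrN !opprB.
  rewrite ler_pdivrMr ?subr_gt0 //.
  by lra.
- have := lle y ay yx; rewrite dd_pairE ?gt_eqF // ler_pdivlMr ?subr_gt0 //.
  by lra.
- by rewrite subrr mulr0 addr0.
Qed.

Lemma slope_limit_derive1 a C x l : a < x -> 0 <= C ->
  (forall y, a <= y -> y != x -> `|l - dd f [:: x; y]| <= C * `|y - x|) ->
  (f^`())%classic x = l.
Proof.
move=> ax C0 h; rewrite /derive1; apply: cvg_lim => //.
apply/cvgrPdist_le => e e0.
have C1 : 0 < C + 1 by rewrite ltr_wpDl.
pose d := Num.min (x - a) (e / (C + 1)).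
have d0 : 0 < d by rewrite lt_min subr_gt0 ax divr_gt0.
near=> t.
have t0 : t != 0 by near: t; exact: nbhs_dnbhs_neq.
have td : `|t| < d.
  by near: t; exact: dnbhs0_lt.
have := h (t + x).
have -> : dd f [:: x; t + x] = t^-1 *: (f (t + x) - f x).
  rewrite dd_pairC dd_pairE ?addrK 1?mulrC //.
  by rewrite -subr_eq0 addrK.
rewrite /= addrK => h'; apply: le_trans (h' _ _) _.
- have : `|t| < x - a by rewrite (lt_le_trans td) // ge_min lexx.
  by rewrite ltr_norml => /andP[]; lra.
- by rewrite -subr_eq0 addrK.
have h1 : `|t| <= e / (C + 1) by rewrite (le_trans (ltW td)) // ge_min lexx orbT.
rewrite (le_trans (ler_wpM2l C0 h1)) // mulrCA ger_pMr // ler_pdivrMr // mul1r lerDl //.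
Unshelve. all: by end_near. Qed.

Lemma alt_derivative a : 0 < a -> exists2 C, 0 <= C &
  (forall x, a < x -> 0 <= (f^`())%classic x) /\
  (forall x y, a < x -> a <= y -> f y <= f x + (f^`())%classic x * (y - x)) /\
  (forall x y, a < x -> a < y -> `|(f^`())%classic x - (f^`())%classic y| <= C * `|x - y|).
Proof.
move=> a0; have [C C0 h] := alt_slope_limit a0; exists (2 * C); first by rewrite mulr_ge0.
have dE x l : a < x -> (forall y, a <= y -> y != x -> `|l - dd f [:: x; y]| <= C * `|y - x|) ->
  (f^`())%classic x = l by move=> ax hl; exact: slope_limit_derive1 ax C0 hl.
split; [|split].
- by move=> x ax; have [l [l0 h1 h2]] := h x ax; rewrite (dE _ _ ax h1).
- by move=> x y ax ay; have [l [l0 h1 h2]] := h x ax; rewrite (dE _ _ ax h1) h2.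
move=> x y ax ay; have [->|xy] := eqVneq x y; first by rewrite !subrr normr0 mulr0.
have [l [l0 h1 h2]] := h x ax; rewrite (dE _ _ ax h1).
have [k [k0 h3 h4]] := h y ay; rewrite (dE _ _ ay h3).
have := h1 y (ltW ay); rewrite eq_sym => /(_ xy); have := h3 x (ltW ax) xy.
rewrite dd_pairC (distrC y x) => e1 e2.
rewrite (_ : l - k = (l - dd f [:: x; y]) - (k - dd f [:: x; y])); last by ring.
rewrite (le_trans (ler_normB _ _)) // -mulrA mulr2n mulrDl mul1r; exact: lerD.
Qed.

End Alternating.

(** * The Hilbert space of complex n-tuples *)

(** The alias keeps the Euclidean norm away from the canonical sup norm of matrices. *)
Definition ell2 (R : realType) (n : nat) := 'cV[R[i]]_n.

Section Ell2.
Variables (R : realType) (n : nat).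
Local Notation V := (ell2 R n).

HB.instance Definition _ := GRing.Lmodule.copy V 'cV[R[i]]_n.
HB.instance Definition _ := Vector.copy V 'cV[R[i]]_n.

Definition edot (u v : V) : R[i] := \sum_i u i 0 * Num.conj (v i 0).

Fact edot_bilinear : bilinear_for
  (GRing.Scale.Law.clone _ _ ( *%R ) _) (GRing.Scale.Law.clone _ _ (Num.conj \; *%R ) _) edot.
Proof.
split=> [v a u u'|u a v v'] /=; rewrite /edot /= mulr_sumr -big_split;
  apply: eq_bigr => i _ /=; rewrite !mxE.
- by rewrite mulrDl mulrA.
- by rewrite rmorphD rmorphM mulrDr mulrCA.
Qed.

HB.instance Definition _ := bilinear_isBilinear.Build R[i] V V R[i]
  _ _ edot edot_bilinear.

Fact edot_herm (u v : V) : edot u v = (-1) ^+ false * Num.conj (edot v u).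
Proof.
rewrite mul1r rmorph_sum; apply: eq_bigr => i _ /=.
by rewrite rmorphM /= conjCK mulrC.
Qed.
HB.instance Definition _ := isHermitianSesquilinear.Build R[i] V false
  (@Num.conj R[i]) edot edot_herm.

Lemma edotE (u : V) : edot u u = \sum_i `|u i 0| ^+ 2.
Proof. by apply: eq_bigr => i _; rewrite normCK. Qed.

Fact edot_gt0 (u : V) : u != 0 -> 0 < edot u u.
Proof.
move=> u0; rewrite edotE lt_neqAle sumr_ge0 ?andbT; last first.
  by move=> i _; rewrite exprn_ge0.
apply: contra u0; rewrite eq_sym psumr_eq0 => [/allP h|i _]; last exact: exprn_ge0.
apply/eqP/colP => i; rewrite mxE; have := h i; rewrite mem_index_enum => /(_ isT) /=.
by rewrite expf_eq0 /= normr_eq0 => /eqP.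
Qed.
HB.instance Definition _ := isDotProduct.Build R[i] V edot edot_gt0.

Definition enorm (u : V) : R[i] := sqrtC (edot u u).

Fact enormD u v : enorm (u + v) <= enorm u + enorm v.
Proof. by rewrite /enorm; case: (triangle_lerif edot u v). Qed.

Fact enormZ c u : enorm (c *: u) = `|c| * enorm u.
Proof.
rewrite /enorm (dnormZ edot) sqrtCM ?nnegrE ?exprn_ge0 ?(dnorm_ge0 edot) //.
by rewrite sqrCK.
Qed.

Fact enorm_eq0 u : enorm u = 0 -> u = 0.
Proof. by move/eqP; rewrite (sqrt_dnorm_eq0 edot) => /eqP. Qed.

HB.instance Definition _ := @Lmodule_isNormed.Build R[i] V enorm enormD enormZ enorm_eq0.

Lemma enorm_coord (u : V) i : `|u i 0| <= `|u|.
Proof.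
rewrite -[X in X <= _](sqrCK (normr_ge0 _)) ler_sqrtC ?nnegrE ?exprn_ge0 //.
  by rewrite edotE (bigD1 i) //= lerDl sumr_ge0 // => j _; rewrite exprn_ge0.
exact: (dnorm_ge0 edot).
Qed.

Lemma enorm_sum (u : V) : `|u| <= \sum_i `|u i 0|.
Proof.
have -> : u = \sum_i u i 0 *: (delta_mx i 0 : V).
  apply/colP => i; rewrite summxE (bigD1 i) //= big1 => [|j ji].
    by rewrite !mxE !eqxx mulr1 addr0.
  by rewrite !mxE eq_sym (negPf ji) mulr0.
rewrite (le_trans (ler_norm_sum _ _ _)) // ler_sum // => i _.
rewrite normrZ; have -> : `|delta_mx i 0 : V| = 1.
  rewrite -[LHS]/(sqrtC _) edotE (bigD1 i) //= big1 => [|j ji].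
    by rewrite !mxE !eqxx normr1 expr1n addr0 sqrtC1.
  by rewrite !mxE (negPf ji) normr0 expr0n.
rewrite mulr1 summxE (bigD1 i) //= big1 => [|j ji].
  by rewrite !mxE !eqxx mulr1 addr0.
by rewrite !mxE eq_sym (negPf ji) mulr0.
Qed.

Lemma normC_ge_part (z : R[i]) :
  (`|complex.Re z| <= complex.Re `|z|) /\ (`|complex.Im z| <= complex.Re `|z|).
Proof.
case: z => a b; rewrite normc_def /=; split; rewrite -sqrtr_sqr ler_wsqrtr //.
  by rewrite lerDl sqr_ge0.
by rewrite lerDr sqr_ge0.
Qed.

Lemma normC_le_parts (z : R[i]) : `|z| <= (`|complex.Re z| + `|complex.Im z|)%:C.
Proof.
case: z => a b; rewrite normc_def lecR /=.
have ab0 : 0 <= `|a| + `|b| by rewrite addr_ge0.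
rewrite -(ger0_norm ab0) -sqrtr_sqr ler_wsqrtr // sqrrD !real_normK ?num_real //.
by rewrite lerD2r lerDl mulrn_wge0 // mulr_ge0.
Qed.

(** The real and imaginary parts of each entry converge in R. *)
Fact ell2_complete (F : set_system V) : ProperFilter F -> cauchy F -> cvg F.
Proof.
move=> FF /cauchyP Fc.
have part (phi : R[i] -> R) (i : 'I_n) : {morph phi : x y / x - y} ->
    (forall z, `|phi z| <= complex.Re `|z|) ->
    cvg ((fun u : V => phi (u i 0)) @ F).
  move=> phiB phi_le; apply/cauchy_cvgP/cauchy_exP => e e0.
  have [|x Fx] := Fc e%:C; first by rewrite ltcR.
  exists (phi (x i 0)); apply: (@filterS _ F _ _ _ _ Fx) => u; rewrite -!ball_normE /=.
  move=> xu.
  suff : `|phi (x i 0 - u i 0)| < e by rewrite phiB.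
  rewrite (le_lt_trans (phi_le _)) // -ltcR Re_normC.
  by rewrite (le_lt_trans _ xu) // (le_trans _ (enorm_coord _ i)) // !mxE.
have cRe i : cvg ((fun u : V => complex.Re (u i 0)) @ F).
  by apply: part => [[? ?] [? ?] //|z]; case: (normC_ge_part z).
have cIm i : cvg ((fun u : V => complex.Im (u i 0)) @ F).
  by apply: part => [[? ?] [? ?] //|z]; case: (normC_ge_part z).
pose L : V := \col_i (lim ((fun u : V => complex.Re (u i 0)) @ F) +i*
                      lim ((fun u : V => complex.Im (u i 0)) @ F)).
apply: (cvgP L); apply/cvgrPdist_le => e e0.
pose d : R := complex.Re e / 2 / n.+1%:R.
have e0' : 0 < complex.Re e by rewrite -ltcR RRe_real ?gtr0_real.
have d0 : 0 < d by rewrite !divr_gt0.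
have near_lim (phi : R[i] -> R) : (forall i, cvg ((fun u : V => phi (u i 0)) @ F)) ->
    \forall u \near F, forall i : 'I_n,
      `|lim ((fun u : V => phi (u i 0)) @ F) - phi ((u : V) i 0)| <= d.
  by move=> cphi; apply: filter_forall => i; have /cvgrPdist_le := cphi i; apply.
near=> u; rewrite (le_trans (enorm_sum _)) //.
apply: (@le_trans _ _ (\sum_(i < n) (d + d)%:C)).
  apply: ler_sum => i _; rewrite (le_trans (normC_le_parts _)) // lecR.
  have nR : forall i, `|lim ((fun u : V => complex.Re (u i 0)) @ F) - complex.Re (u i 0)| <= d.
    by near: u; exact: near_lim cRe.
  have nI : forall i, `|lim ((fun u : V => complex.Im (u i 0)) @ F) - complex.Im (u i 0)| <= d.
    by near: u; exact: near_lim cIm.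
  rewrite lerD //; [move: (nR i)|move: (nI i)]; rewrite !mxE; by case: (u i 0).
rewrite sumr_const card_ord -(RRe_real (gtr0_real e0)) -rmorphMn lecR.
rewrite /d -mulrDl -splitr -mulr_natr -mulrA ger_pMr // mulrC.
by rewrite ler_pdivrMr // mul1r ler_nat.
Unshelve. all: by end_near. Qed.
HB.instance Definition _ := Uniform_isComplete.Build V ell2_complete.

Fact edot_norm (u : V) : (edot : {dot V for (@Num.conj R[i])}) u u = `|u| ^+ 2.
Proof. by rewrite sqrtCK. Qed.
HB.instance Definition _ := isHilbert.Build R V edot_norm.
End Ell2.

(** * The real inner product and the operator norm *)

Lemma Re_add (R : realType) (u v : R[i]) :
  complex.Re (u + v) = complex.Re u + complex.Re v.
Proof. by case: u => a b; case: v. Qed.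

Lemma Re_conj (R : realType) (u : R[i]) : complex.Re (Num.conj u) = complex.Re u.
Proof. by case: u. Qed.

Lemma Re_rmul (R : realType) (a : R) (u : R[i]) :
  complex.Re (a%:C * u) = a * complex.Re u.
Proof. by case: u => b c; rewrite /= mul0r subr0. Qed.

Lemma Re_imul (R : realType) (u : R[i]) :
  complex.Re (Num.conj 'i%C * u) = complex.Im u.
Proof. by case: u => b c /=; ring. Qed.

Section RealInner.
Variables (R : realType) (H : hilbertType R).
Implicit Types (x y z : H) (A B T : bop H) (a b c : R).

(** Taking real parts makes H a real Euclidean space.  Self-adjointness and
    positivity can be tested there, away from the partial order of R[i]. *)
Definition rnorm x : R := complex.Re `|x|.
Definition rdot x y : R := complex.Re (inner x y).

Lemma rnormE x : (rnorm x)%:C = `|x|. Proof. exact: Re_norm. Qed.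

Lemma rnorm_ge0 x : 0 <= rnorm x.
Proof. by rewrite -ler0c rnormE normr_ge0. Qed.

Lemma rnorm_eq0 x : rnorm x = 0 -> x = 0.
Proof. by move=> x0; apply/normr0_eq0; rewrite -rnormE x0. Qed.

Lemma rnorm0 : rnorm 0 = 0. Proof. by rewrite /rnorm normr0. Qed.

Lemma rnormD x y : rnorm (x + y) <= rnorm x + rnorm y.
Proof. by rewrite -lecR rmorphD /= !rnormE ler_normD. Qed.

Lemma rnormN x : rnorm (- x) = rnorm x. Proof. by rewrite /rnorm normrN. Qed.

Lemma rnormB x y : rnorm (x - y) = rnorm (y - x).
Proof. by rewrite -rnormN opprB. Qed.

Lemma rnormZ (c : R[i]) x : rnorm (c *: x) = complex.Re `|c| * rnorm x.
Proof.
apply: (@complexI R); rewrite rnormE normrZ (rmorphM (real_complex R)) /=.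
by rewrite Re_normC rnormE.
Qed.

Lemma rnormZr a x : rnorm (a%:C *: x) = `|a| * rnorm x.
Proof. by rewrite rnormZ normc_def /= expr0n addr0 sqrtr_sqr. Qed.

Lemma innerC x y : inner x y = Num.conj (inner y x).
Proof. by rewrite /inner hermC mul1r. Qed.

Lemma rdotC x y : rdot x y = rdot y x.
Proof. by rewrite /rdot innerC Re_conj. Qed.

Lemma rdotDl x y z : rdot (x + y) z = rdot x z + rdot y z.
Proof. by rewrite /rdot /inner linearDl Re_add. Qed.

Lemma rdotDr x y z : rdot z (x + y) = rdot z x + rdot z y.
Proof. by rewrite !(rdotC z) rdotDl. Qed.

Lemma rdotZl a x y : rdot (a%:C *: x) y = a * rdot x y.
Proof.
by rewrite /rdot /inner linearZl_LR Re_rmul.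
Qed.

Lemma rdotZr a x y : rdot y (a%:C *: x) = a * rdot y x.
Proof. by rewrite !(rdotC y) rdotZl. Qed.

Lemma rdotNl x y : rdot (- x) y = - rdot x y.
Proof. by rewrite -[- x]scaleN1r -(rmorphN1 (real_complex R)) rdotZl mulN1r. Qed.

Lemma rdotNr x y : rdot y (- x) = - rdot y x.
Proof. by rewrite !(rdotC y) rdotNl. Qed.

Lemma rdotBl x y z : rdot (x - y) z = rdot x z - rdot y z.
Proof. by rewrite rdotDl rdotNl. Qed.

Lemma rdotBr x y z : rdot z (x - y) = rdot z x - rdot z y.
Proof. by rewrite rdotDr rdotNr. Qed.

Lemma rdotxx x : rdot x x = rnorm x ^+ 2.
Proof.
apply: (@complexI R); rewrite rmorphXn /= rnormE -hdotE /rdot /inner RRe_real //.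
by rewrite hdotE rpredX // ger0_real.
Qed.

Lemma Im_inner x y : complex.Im (inner x y) = rdot x ('i%C *: y).
Proof.
by rewrite /rdot /inner linearZr_LR Re_imul.
Qed.

Lemma form_CS A : (forall x y, rdot (A x) y = rdot x (A y)) ->
  (forall x, 0 <= rdot (A x) x) ->
  forall x y, rdot (A x) y ^+ 2 <= rdot (A x) x * rdot (A y) y.
Proof.
move=> sA pA x y.
have h a : 0 <= rdot (A x) x + 2 * a * rdot (A x) y + a ^+ 2 * rdot (A y) y.
  have := pA (x + a%:C *: y).
  rewrite !linearD !linearZ /= !(rdotDl, rdotDr) !rdotZl !rdotZr.
  by rewrite [rdot (A y) x]sA [rdot y _]rdotC; congr (_ <= _); ring.
move: (pA x) (pA y) h; move: (rdot (A x) x) (rdot (A x) y) (rdot (A y) y) => p q r p0 r0 h.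
have [r1|r1] := ltP 0 r.
  have := h (- (q / r)).
  have -> : p + 2 * - (q / r) * q + (- (q / r)) ^+ 2 * r = (p * r - q ^+ 2) / r.
    by field; rewrite gt_eqF.
  by rewrite pmulr_lge0 ?invr_gt0 // subr_ge0.
have {r1}r1 : r = 0 by apply/eqP; rewrite eq_le r1.
rewrite r1 mulr0; have [->|q0] := eqVneq q 0; first by rewrite expr0n.
have := h (- (p + 1) / (2 * q)); rewrite r1 mulr0 addr0.
have -> : p + 2 * (- (p + 1) / (2 * q)) * q = - 1 by field.
by rewrite lerNr oppr0 ler10.
Qed.

Lemma rdot_CS x y : rdot x y <= rnorm x * rnorm y.
Proof.
have := @form_CS 1 (fun _ _ => erefl) (fun x => ltac:(by rewrite rdotxx sqr_ge0)) x y.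
rewrite !rdotxx -exprMn => h; apply: le_trans (ler_norm _) _.
by rewrite -ler_sqr ?nnegrE ?mulr_ge0 ?rnorm_ge0 // real_normK ?num_real.
Qed.

Lemma is_adjointP A B :
  is_adjoint A B <-> (forall x y, rdot (A x) y = rdot x (B y)).
Proof.
split=> [AB x y|AB x y]; first by rewrite /rdot AB.
apply/eqP; rewrite eq_complex -!/(rdot _ _) AB eqxx !Im_inner AB.
by rewrite linearZ eqxx.
Qed.

Lemma saP A : self_adjoint A <-> (forall x y, rdot (A x) y = rdot x (A y)).
Proof. exact: is_adjointP. Qed.

Lemma adjointD A A' B B' : is_adjoint A A' -> is_adjoint B B' ->
  is_adjoint (A + B) (A' + B').
Proof.
move=> /is_adjointP hA /is_adjointP hB; apply/is_adjointP => x y.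
by rewrite rdotDl rdotDr hA hB.
Qed.

Lemma adjointZ a A A' : is_adjoint A A' -> is_adjoint (a%:C *: A) (a%:C *: A').
Proof.
move=> /is_adjointP hA; apply/is_adjointP => x y.
by rewrite rdotZl rdotZr hA.
Qed.

Lemma adjointM A A' B B' : is_adjoint A A' -> is_adjoint B B' ->
  is_adjoint (A * B) (B' * A').
Proof. by move=> hA hB x y; rewrite /= hA hB. Qed.

Lemma sa1 : self_adjoint (1 : bop H). Proof. by []. Qed.

Lemma sa0 : self_adjoint (0 : bop H).
Proof.
by apply/saP => x y; rewrite -(scaler0 _ 0) -(rmorph0 (real_complex R)) rdotZl rdotZr !mul0r.
Qed.

Lemma saD A B : self_adjoint A -> self_adjoint B -> self_adjoint (A + B).
Proof. exact: adjointD. Qed.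

Lemma saZ a A : self_adjoint A -> self_adjoint (a%:C *: A).
Proof. exact: adjointZ. Qed.

Lemma saN A : self_adjoint A -> self_adjoint (- A).
Proof.
by move=> /(@saZ (-1)); rewrite rmorphN1 scaleN1r.
Qed.

Lemma saB A B : self_adjoint A -> self_adjoint B -> self_adjoint (A - B).
Proof. by move=> sA sB; apply: saD => //; apply: saN. Qed.

Lemma saM A B : self_adjoint A -> self_adjoint B -> A * B = B * A ->
  self_adjoint (A * B).
Proof. by move=> sA sB AB; rewrite /self_adjoint {2}AB; apply: adjointM. Qed.

Lemma saX A n : self_adjoint A -> self_adjoint (A ^+ n).
Proof.
move=> sA; elim: n => [|n IHn]; first exact: sa1.
by rewrite exprS; apply: saM => //; rewrite -exprS -exprSr.
Qed.

Lemma sa_sum (I : Type) (r : seq I) (F : I -> bop H) :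
  (forall i, self_adjoint (F i)) -> self_adjoint (\sum_(i <- r) F i).
Proof.
move=> sF; elim/big_ind: _ => //; first exact: sa0.
exact: saD.
Qed.

Lemma opnorm_ge0 A : 0 <= opnorm A.
Proof. by apply: le_trans (opnorm_ub A (x := 0) _); rewrite ?normr0 //; exact: rnorm_ge0. Qed.

Lemma opnormP A x : rnorm (A x) <= opnorm A * rnorm x.
Proof.
have [->|x0] := eqVneq x 0; first by rewrite linear0 rnorm0 mulr0.
have nx0 : 0 < rnorm x.
  by rewrite lt_neqAle rnorm_ge0 andbT eq_sym; apply: contraNneq x0 => /rnorm_eq0 ->.
have : `|(rnorm x)^-1%:C *: x| <= 1.
  by rewrite -rnormE rnormZr ger0_norm ?invr_ge0 ?rnorm_ge0 // mulVf ?gt_eqF // rmorph1.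
move/(opnorm_ub A); rewrite linearZ /= -/(rnorm _) rnormZr ger0_norm ?invr_ge0 ?rnorm_ge0 //.
by rewrite ler_pdivrMl // mulrC.
Qed.

Lemma opnorm_le A c : 0 <= c -> (forall x, rnorm (A x) <= c * rnorm x) -> opnorm A <= c.
Proof.
move=> c0 h; apply: opnorm_lub => x; rewrite -rnormE -(rmorph1 (real_complex R)) lecR => x1.
by rewrite (le_trans (h x)) // ler_piMr.
Qed.

Lemma opnormM A B : opnorm (A * B) <= opnorm A * opnorm B.
Proof.
apply: opnorm_le => [|x]; first by rewrite mulr_ge0 ?opnorm_ge0.
by rewrite (le_trans (opnormP A (B x))) // -mulrA ler_wpM2l ?opnorm_ge0 ?opnormP.
Qed.

Lemma opnorm0 : opnorm (0 : bop H) = 0.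
Proof.
apply/eqP; rewrite eq_le opnorm_ge0 andbT; apply: opnorm_le => // x.
by rewrite rnorm0 mul0r.
Qed.

Lemma opnorm1 : opnorm (1 : bop H) <= 1.
Proof. by apply: opnorm_le => // x; rewrite mul1r. Qed.

Lemma opnormZr a A : opnorm (a%:C *: A) = `|a| * opnorm A.
Proof.
apply: (@complexI R); rewrite opnormZ (rmorphM (real_complex R)) /=.
by rewrite normc_def /= expr0n addr0 sqrtr_sqr.
Qed.

Lemma opnormN A : opnorm (- A) = opnorm A.
Proof. by rewrite -scaleN1r -(rmorphN1 (real_complex R)) opnormZr normrN1 mul1r. Qed.

Lemma opnormB A B : opnorm (A - B) = opnorm (B - A).
Proof. by rewrite -opnormN opprB. Qed.

Lemma opnormX A n : opnorm (A ^+ n) <= opnorm A ^+ n.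
Proof.
elim: n => [|n IHn]; first exact: opnorm1.
by rewrite !exprS (le_trans (opnormM _ _)) // ler_wpM2l ?opnorm_ge0.
Qed.

Lemma bopZAl (c : R[i]) A B : c *: (A * B) = (c *: A) * B.
Proof. exact: bopP. Qed.
Lemma bopZAr (c : R[i]) A B : A * (c *: B) = c *: (A * B).
Proof. by apply: bopP => x; rewrite /= linearZ. Qed.

(** Cauchy-Schwarz for the form of T, at x and Tx, gives
    |Tx|^4 <= <Tx, x> <T(Tx), Tx> <= (c |x|^2) (c |Tx|^2). *)
Lemma opnorm_pos T c : self_adjoint T ->
  (forall x, 0 <= rdot (T x) x <= c * rnorm x ^+ 2) -> 0 <= c -> opnorm T <= c.
Proof.
move=> /saP sT pT c0; apply: opnorm_le => // x.
have [p0 pc] := andP (pT x).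
have := @form_CS T sT (fun x => proj1 (andP (pT x))) x (T x).
rewrite rdotxx; have [q0 qc] := andP (pT (T x)).
have := rnorm_ge0 (T x); have := rnorm_ge0 x; move: p0 pc q0 qc.
move: (rdot (T x) x) (rdot (T (T x)) (T x)) (rnorm x) (rnorm (T x)).
move=> p q n t p0 pc q0 qc n0 t0 h.
have [->|t1] := eqVneq t 0; first by rewrite mulr_ge0.
have {t1}t1 : 0 < t by rewrite lt_neqAle eq_sym t1.
have h2 : t ^+ 2 * t ^+ 2 <= (c * n) ^+ 2 * t ^+ 2.
  rewrite -expr2 (le_trans h) // exprMn.
  by rewrite (_ : _ * _ * _ = (c * n ^+ 2) * (c * t ^+ 2)); [rewrite ler_pM|ring].
by rewrite ler_pM2r ?exprn_gt0 // ler_sqr ?nnegrE ?mulr_ge0 // in h2.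
Qed.

End RealInner.

(** * Norm limits of operators *)

Section Limits.
Variables (R : realType) (H : hilbertType R).
Implicit Types (x y z : H) (A B S T : bop H) (a b c : R) (u v : nat -> bop H).

Definition opcvg u T := forall e, 0 < e ->
  exists n0, forall n, (n0 <= n)%N -> opnorm (u n - T) <= e.

Definition opcauchy u := forall e, 0 < e ->
  exists n0, forall n m, (n0 <= n)%N -> (n0 <= m)%N -> opnorm (u n - u m) <= e.

Lemma opcvgE u T : opcvg u T <-> u @ \oo --> T.
Proof.
split=> [uT|/cvgrPdist_le uT e e0].
  apply/cvgrPdist_le => e e0.
  have e0' : 0 < complex.Re e by rewrite -ltcR RRe_real ?gtr0_real.
  have [n0 h] := uT _ e0'; exists n0 => // n /= n0n.
  by rewrite -(RRe_real (gtr0_real e0)) distrC -[leLHS]/((opnorm _)%:C) lecR h.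
have [|n0 _ h] := uT e%:C; first by rewrite ltcR.
exists n0 => n n0n; have := h n n0n.
by rewrite /= distrC -[leLHS]/((opnorm _)%:C) lecR.
Qed.

Lemma rnorm_cauchy_cvg (w : nat -> H) :
  (forall e, 0 < e -> exists n0, forall n m,
     (n0 <= n)%N -> (n0 <= m)%N -> rnorm (w n - w m) <= e) ->
  exists y, forall e, 0 < e -> exists n0, forall n,
     (n0 <= n)%N -> rnorm (w n - y) <= e.
Proof.
move=> wc.
have /cauchy_cvgP /cvg_ex [y /cvgrPdist_le wy] : cauchy (w @ \oo).
  apply/cauchy_exP => e e0.
  have e0' : 0 < complex.Re e / 2 by rewrite divr_gt0 // -ltcR RRe_real ?gtr0_real.
  have [n0 h] := wc _ e0'; exists (w n0); exists n0 => // n /= n0n.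
  rewrite -ball_normE /= -rnormE -(RRe_real (gtr0_real e0)) ltcR.
  by rewrite (le_lt_trans (h _ _ _ _)) // gtr_pMr ?invf_lt1 ?ltr1n // -ltcR RRe_real ?gtr0_real.
exists y => e e0; have [|n0 _ h] := wy e%:C; first by rewrite ltcR.
by exists n0 => n n0n; rewrite rnormB -lecR rnormE; exact: h.
Qed.

(** Pointwise limits exist because H is complete, and the uniform Cauchy estimate
    passes to them. *)
Lemma opcauchy_cvg u : opcauchy u -> exists T, opcvg u T.
Proof.
move=> uc.
have ux x : exists y, forall e, 0 < e ->
    exists n0, forall n, (n0 <= n)%N -> rnorm (u n x - y) <= e.
  apply: rnorm_cauchy_cvg => e e0.
  have [|n0 h] := uc (e / (rnorm x + 1)); first by rewrite divr_gt0 // ltr_wpDl ?rnorm_ge0.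
  exists n0 => n m n0n n0m; rewrite (le_trans (opnormP (u n - u m) x)) //.
  rewrite (le_trans (ler_wpM2r (rnorm_ge0 x) (h _ _ n0n n0m))) //.
  rewrite mulrAC -mulrA ger_pMr // ler_pdivrMr ?mul1r ?lerDl //.
  by rewrite ltr_wpDl ?rnorm_ge0.
have [F hF] := choice ux.
have F_near n0 e : 0 <= e ->
    (forall n m, (n0 <= n)%N -> (n0 <= m)%N -> opnorm (u n - u m) <= e) ->
    forall n x, (n0 <= n)%N -> rnorm (u n x - F x) <= e * rnorm x.
  move=> e0 h n x n0n; apply/ler_addgt0Pr => d d0.
  have [n1 h1] := hF x d d0; pose m := maxn n0 n1.
  rewrite (_ : u n x - F x = (u n x - u m x) + (u m x - F x)); last by rewrite addrA subrK.
  rewrite (le_trans (rnormD _ _)) // lerD ?h1 ?leq_maxr //.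
  rewrite (le_trans (opnormP (u n - u m) x)) // ler_wpM2r ?rnorm_ge0 // h //.
  exact: leq_maxl.
have lF : linear F.
  move=> a x y; apply/eqP; rewrite -subr_eq0; apply/eqP/rnorm_eq0/eqP.
  rewrite eq_le rnorm_ge0 andbT; apply/ler_addgt0Pr => d d0; rewrite add0r.
  have a0 : 0 <= complex.Re `|a| by rewrite -lecR Re_normC normr_ge0.
  pose K := 2 + complex.Re `|a|; have K0 : 0 < K by rewrite ltr_wpDr.
  have dK : 0 < d / K by rewrite divr_gt0.
  (* three errors, one of them scaled by a *)
  have [n1 h1] := hF (a *: x + y) _ dK; have [n2 h2] := hF x _ dK.
  have [n3 h3] := hF y _ dK; pose m := maxn n1 (maxn n2 n3).
  rewrite (_ : F _ - _ = - (u m (a *: x + y) - F (a *: x + y)) +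
                         (a *: (u m x - F x) + (u m y - F y))).
    rewrite (le_trans (rnormD _ _)) // rnormN.
    rewrite (le_trans (lerD (lexx _) (rnormD _ _))) // rnormZ.
    rewrite (_ : d = d / K + (complex.Re `|a| * (d / K) + d / K)).
      rewrite lerD ?lerD ?ler_wpM2l //.
      - by apply: h1; rewrite /m leq_maxl.
      - by apply: h2; rewrite /m !leq_max leqnn orbT.
      - by apply: h3; rewrite /m !leq_max leqnn !orbT.
    by rewrite /K; field; rewrite gt_eqF.
  by rewrite (bop_linear (u m)) scalerBr opprB [X in _ = _ + X]addrACA -opprD addrA subrK.
have [n0 h0] := uc 1 ltr01.
have bF : F \in @bounded_linear R H.
  apply/bounded_linearP; split=> //; exists (1 + opnorm (u n0)) => x.
  rewrite -!rnormE -(rmorphM (real_complex R)) lecR.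
  rewrite (_ : F x = - (u n0 x - F x) + u n0 x); last by rewrite opprB subrK.
  rewrite (le_trans (rnormD _ _)) // rnormN mulrDl lerD ?opnormP //.
  by rewrite (F_near n0) // ler01.
exists (Bop bF) => e e0; have [n1 h1] := uc e e0.
exists n1 => n n1n; apply: opnorm_le => [|x]; first exact: ltW.
by rewrite (F_near n1) // ltW.
Qed.

Lemma geo_small (C t e : R) : 0 <= t < 1 -> 0 < e ->
  exists n0, forall n, (n0 <= n)%N -> C * t ^+ n <= e.
Proof.
move=> /andP[t0 t1] e0.
have /cvgrPdist_le /(_ (e / (`|C| + 1))) : (fun n => t ^+ n) @ \oo --> (0 : R).
  by apply: cvg_expr; rewrite ger0_norm.
case=> [|n0 _ h]; first by rewrite divr_gt0 // ltr_wpDl.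
exists n0 => n /h /=; rewrite sub0r normrN ger0_norm ?exprn_ge0 // => h1.
apply: (@le_trans _ _ (`|C| * t ^+ n)); first by rewrite ler_wpM2r ?exprn_ge0 // ler_norm.
rewrite (le_trans (ler_wpM2l (normr_ge0 C) h1)) // mulrCA ger_pMr // ler_pdivrMr ?ltr_wpDl //.
by rewrite mul1r lerDl.
Qed.

Lemma opcvg_geo u (C t : R) : 0 <= t < 1 ->
  (forall n, opnorm (u n.+1 - u n) <= C * t ^+ n) -> exists T, opcvg u T.
Proof.
move=> t01 h; have /andP[t0 t1] := t01.
have C0 : 0 <= C by have := le_trans (opnorm_ge0 _) (h 0%N); rewrite expr0 mulr1.
have t10 : 0 < 1 - t by rewrite subr_gt0.
have step n k : opnorm (u (n + k)%N - u n) <= C / (1 - t) * t ^+ n * (1 - t ^+ k).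
  elim: k => [|k IHk]; first by rewrite addn0 subrr opnorm0 expr0 subrr mulr0.
  rewrite addnS (_ : _ - _ = (u (n + k).+1 - u (n + k)%N) + (u (n + k)%N - u n)); last first.
    by rewrite addrA subrK.
  rewrite (le_trans (opnormD _ _)) // (le_trans (lerD (h _) IHk)) // exprD exprS.
  by rewrite le_eqVlt; apply/orP; left; apply/eqP; field; rewrite gt_eqF.
have step' n k : opnorm (u (n + k)%N - u n) <= C / (1 - t) * t ^+ n.
  rewrite (le_trans (step _ _)) // ler_piMr //; last by rewrite lerBlDr lerDl exprn_ge0.
  by rewrite mulr_ge0 ?exprn_ge0 // divr_ge0 // ltW.
apply: opcauchy_cvg => e e0; have e2 : 0 < e / 2 by rewrite divr_gt0.
have [n0 hn] := geo_small (C / (1 - t)) t01 e2.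
exists n0 => n m /subnKC <- /subnKC <-.
rewrite (_ : u _ - u _ = (u (n0 + (n - n0))%N - u n0) + (u n0 - u (n0 + (m - n0))%N)).
  rewrite (le_trans (opnormD _ _)) // [e]splitr lerD // ?(opnormB (u n0)).
    by rewrite (le_trans (step' _ _)) ?hn.
  by rewrite (le_trans (step' _ _)) ?hn.
by rewrite addrA subrK.
Qed.

Lemma opcvg_uniq u T T' : opcvg u T -> opcvg u T' -> T = T'.
Proof.
move=> uT uT'; apply/eqP; rewrite -subr_eq0; apply/eqP/opnorm_eq0/eqP.
rewrite eq_le opnorm_ge0 andbT; apply/ler_addgt0Pr => e e0; rewrite add0r.
have e2 : 0 < e / 2 by rewrite divr_gt0.
have [n h] := uT _ e2; have [m h'] := uT' _ e2; pose k := maxn n m.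
rewrite (_ : T - T' = (T - u k) + (u k - T')); last by rewrite addrA subrK.
by rewrite (le_trans (opnormD _ _)) // [e]splitr lerD // ?(opnormB T) ?h ?h' ?leq_maxl ?leq_maxr.
Qed.

Lemma opcvg_sub u v T : opcvg u T ->
  (forall e, 0 < e -> exists n0, forall n, (n0 <= n)%N -> opnorm (v n - u n) <= e) ->
  opcvg v T.
Proof.
move=> uT vu e e0; have e2 : 0 < e / 2 by rewrite divr_gt0.
have [n h] := uT _ e2; have [m h'] := vu _ e2; exists (maxn n m) => k.
rewrite geq_max => /andP[nk mk].
rewrite (_ : v k - T = (v k - u k) + (u k - T)); last by rewrite addrA subrK.
by rewrite (le_trans (opnormD _ _)) // [e]splitr addrC lerD // ?h ?h'.
Qed.

Lemma opcvg_cst T : opcvg (fun=> T) T.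
Proof. by move=> e e0; exists 0%N => n _; rewrite subrr opnorm0 ltW. Qed.

Lemma opcvgD u v S T : opcvg u S -> opcvg v T -> opcvg (fun n => u n + v n) (S + T).
Proof. by move=> /opcvgE uS /opcvgE vT; apply/opcvgE; exact: cvgD. Qed.

Lemma opcvgZ (c : R[i]) u S : opcvg u S -> opcvg (fun n => c *: u n) (c *: S).
Proof. by move=> /opcvgE uS; apply/opcvgE; exact: cvgZr. Qed.

Lemma opcvgS u S : opcvg u S -> opcvg (fun n => u n.+1) S.
Proof. by move=> h e /h[n hn]; exists n => m nm; apply: hn; rewrite leqW. Qed.

Lemma opcvg_bounded u S : opcvg u S ->
  exists n0, forall n, (n0 <= n)%N -> opnorm (u n) <= opnorm S + 1.
Proof.
move=> uS; have [n0 h] := uS _ ltr01; exists n0 => n /h h1.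
rewrite -[u n](subrK S) addrC (le_trans (opnormD _ _)) // lerD2l //.
Qed.

Lemma opcvgM u v S T : opcvg u S -> opcvg v T -> opcvg (fun n => u n * v n) (S * T).
Proof.
move=> uS vT e e0.
pose K := opnorm S + opnorm T + 1; have K0 : 0 < K by rewrite ltr_wpDl ?addr_ge0 ?opnorm_ge0.
have eK : 0 < e / 2 / K by rewrite !divr_gt0.
have [n h] := uS _ eK; have [m h'] := vT _ eK; have [p hp] := opcvg_bounded uS.
exists (maxn p (maxn n m)) => k; rewrite !geq_max => /and3P[pk nk mk].
rewrite (_ : _ - _ = u k * (v k - T) + (u k - S) * T); last by rewrite mulrBr mulrBl addrA subrK.
rewrite (le_trans (opnormD _ _)) // [e]splitr; apply: lerD; rewrite (le_trans (opnormM _ _)) //.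
  rewrite (_ : e / 2 = K * (e / 2 / K)); last by rewrite [RHS]mulrC divfK // gt_eqF.
  by rewrite ler_pM ?opnorm_ge0 ?h' // (le_trans (hp _ pk)) // /K addrAC lerDl opnorm_ge0.
rewrite (_ : e / 2 = (e / 2 / K) * K); last by rewrite divfK // gt_eqF.
by rewrite ler_pM ?opnorm_ge0 ?h // /K -addrA [X in _ <= X]addrC -addrA lerDl addr_ge0 ?opnorm_ge0.
Qed.

Lemma opcvg_comm u S T : opcvg u S -> (forall n, u n * T = T * u n) -> S * T = T * S.
Proof.
move=> uS uT; apply: (opcvg_uniq (opcvgM uS (opcvg_cst T))).
have := opcvgM (opcvg_cst T) uS; congr (opcvg _ _).
by apply/funext => n; rewrite uT.
Qed.

Lemma opcvg_sa u S : opcvg u S -> (forall n, self_adjoint (u n)) -> self_adjoint S.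
Proof.
move=> uS su; apply/saP => x y; apply/eqP; rewrite -subr_eq0 -normr_eq0 eq_le normr_ge0 andbT.
apply/ler_addgt0Pr => e e0; rewrite add0r.
pose K := 2 * (rnorm x * rnorm y) + 1.
have xy0 : 0 <= rnorm x * rnorm y by rewrite mulr_ge0 ?rnorm_ge0.
have K0 : 0 < K by rewrite ltr_wpDl // mulr_ge0.
have [|n h] := uS (e / K); first by rewrite divr_gt0.
have {}h := h n (leqnn n); pose D := u n - S.
have -> : rdot (S x) y - rdot x (S y) = rdot x (D y) - rdot (D x) y.
  by rewrite /D /= -!/(bop_fun _ _) rdotBl rdotBr (iffLR (saP _) (su n)); ring.
have bnd z w : rdot (D z) w <= e / K * (rnorm z * rnorm w).
  rewrite (le_trans (rdot_CS _ _)) // mulrA ler_wpM2r ?rnorm_ge0 //.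
  by rewrite (le_trans (opnormP _ _)) // ler_wpM2r ?rnorm_ge0.
have eK : e / K * (rnorm x * rnorm y) + e / K * (rnorm x * rnorm y) <= e.
  rewrite (_ : _ + _ = e * (2 * (rnorm x * rnorm y) / K)); last by ring.
  by rewrite ger_pMr // ler_pdivrMr // mul1r lerDl.
have b1 := bnd x y; have b2 := bnd (- x) y; have b3 := bnd y x; have b4 := bnd (- y) x.
rewrite ler_norml; move: b2 b4; rewrite !linearN !rdotNl !rnormN [rdot (D y) x]rdotC.
rewrite [rdot (D y) x]rdotC in b3; rewrite [rnorm y * rnorm x]mulrC in b3 *.
by move=> b2 b4; apply/andP; split; lra.
Qed.

End Limits.

(** * The spectrum of a self-adjoint operator *)

Section Spectrum.
Variables (R : realType) (H : hilbertType R).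
Implicit Types (x y : H) (A B S T : bop H) (a b c m M t : R) (z : R[i]).

Definition invertible A := exists B, A * B = 1 /\ B * A = 1.

Lemma invertibleM A B : invertible A -> invertible B -> invertible (A * B).
Proof.
move=> [A' [AA A'A]] [B' [BB B'B]]; exists (B' * A'); split.
  by rewrite mulrA -(mulrA A) BB mulr1.
by rewrite mulrA -(mulrA B') A'A mulr1.
Qed.

Lemma invertible_commM A B : A * B = B * A -> invertible (A * B) -> invertible A.
Proof.
move=> AB [C [h1 h2]]; exists (B * C); split; first by rewrite mulrA.
have CAB : C * (B * A) = 1 by rewrite -AB.
suff -> : B * C = C * B by rewrite -mulrA.
have : C * B * (A * (B * C)) = C * B by rewrite (mulrA A) h1 mulr1.
by rewrite mulrA -(mulrA C B A) CAB mul1r.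
Qed.

Lemma invertibleZ (c : R[i]) A : c != 0 -> invertible A -> invertible (c *: A).
Proof.
move=> c0 [B [AB BA]]; exists (c^-1 *: B); split.
  by rewrite -bopZAl bopZAr scalerA divff // scale1r.
by rewrite -bopZAl bopZAr scalerA mulVf // scale1r.
Qed.

Lemma mul_scall (c : R[i]) A : c *: (1 : bop H) * A = c *: A.
Proof. by rewrite -bopZAl mul1r. Qed.
Lemma mul_scalr (c : R[i]) A : A * (c *: (1 : bop H)) = c *: A.
Proof. by rewrite bopZAr mulr1. Qed.

Lemma invertible1 : invertible 1. Proof. by exists 1; rewrite !mulr1. Qed.

Lemma spectrumP A z : spectrum A z <-> ~ invertible (A - z *: (1 : bop H)).
Proof. by []. Qed.

Lemma neumann T : opnorm T < 1 -> invertible (1 - T).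
Proof.
move=> T1; pose u n := \sum_(i < n) T ^+ i.
have t01 : 0 <= opnorm T < 1 by rewrite opnorm_ge0.
have [|S uS] := @opcvg_geo _ _ u 1 (opnorm T) t01.
  by move=> n; rewrite /u big_ord_recr /= addrAC subrr add0r mul1r opnormX.
have e1 n : (1 - T) * u n = 1 - T ^+ n.
  by rewrite -[RHS]opprB subrX1 -mulNr opprB.
have uT n : u n * T = T * u n.
  by rewrite /u mulr_suml mulr_sumr; apply: eq_bigr => i _; rewrite -exprSr -exprS.
have Tn : opcvg (fun n => 1 - T ^+ n) 1.
  move=> e e0; have [n0 hn] := geo_small 1 t01 e0; exists n0 => n /hn.
  by rewrite mul1r addrAC subrr sub0r opnormN => /(le_trans (opnormX _ _)).
have h1 : (1 - T) * S = 1.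
  apply: (opcvg_uniq _ Tn); have := opcvgM (opcvg_cst (1 - T)) uS.
  by congr (opcvg _ _); apply/funext => n; rewrite e1.
exists S; split=> //; rewrite -[RHS]h1 mulrBr mulrBl mulr1 mul1r.
by rewrite (opcvg_comm uS uT).
Qed.

(** For K larger than the norm of A, the operator 1 - A / K lies between 0 and
    1 - c / K, so a Neumann series inverts A / K. *)
Lemma invertible_coercive A c : self_adjoint A -> 0 < c ->
  (forall x, c * rnorm x ^+ 2 <= rdot (A x) x) -> invertible A.
Proof.
move=> sA c0 hA; pose K := opnorm A + c.
have K0 : 0 < K by rewrite ltr_wpDl ?opnorm_ge0.
have hK x : rdot (A x) x <= opnorm A * rnorm x ^+ 2.
  by rewrite (le_trans (rdot_CS _ _)) // expr2 mulrA ler_wpM2r ?rnorm_ge0 ?opnormP.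
pose T := 1 - K^-1%:C *: A.
have -> : A = K%:C *: (1 - T).
  by rewrite /T opprB addrC subrK scalerA -rmorphM mulfV ?gt_eqF // scale1r.
apply: invertibleZ; first by rewrite (inj_eq (@complexI R)) gt_eqF.
apply: neumann; apply: (@le_lt_trans _ _ (1 - c / K)); last first.
  by rewrite ltrBlDr ltrDl divr_gt0.
have rT x : rdot (T x) x = rnorm x ^+ 2 - rdot (A x) x / K.
  by rewrite /T /= rdotBl rdotZl rdotxx mulrC.
apply: opnorm_pos; first by apply: saB; [exact: sa1|exact: saZ].
  move=> x; rewrite rT mulrBl mul1r; apply/andP; split.
    rewrite subr_ge0 ler_pdivrMr // (le_trans (hK x)) // mulrC ler_wpM2l ?sqr_ge0 //.
    by rewrite lerDl ltW.
  by rewrite lerD2l lerN2 mulrAC ler_pM2r ?invr_gt0.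
by rewrite subr_ge0 ler_pdivrMr // mul1r lerDr opnorm_ge0.
Qed.

Lemma rdot_le A x : rdot (A x) x <= opnorm A * rnorm x ^+ 2.
Proof. by rewrite (le_trans (rdot_CS _ _)) // expr2 mulrA ler_wpM2r ?rnorm_ge0 ?opnormP. Qed.

Lemma rdot_ge A x : - opnorm A * rnorm x ^+ 2 <= rdot (A x) x.
Proof. by have := rdot_le (- A) x; rewrite opnormN rdotNl lerNl mulNr. Qed.

Lemma sa_scal c : self_adjoint (c%:C *: (1 : bop H)).
Proof. by apply: saZ; exact: sa1. Qed.

(** A nonreal a + ib is not in the spectrum because
    (A - a - ib)(A - a + ib) = (A - a)^2 + b^2 is coercive; for a real a outside
    [m, M], A - a or a - A is. *)
Lemma spectrum_itv A m M z : self_adjoint A ->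
  (forall x, m * rnorm x ^+ 2 <= rdot (A x) x <= M * rnorm x ^+ 2) ->
  spectrum A z -> exists2 t, z = t%:C & m <= t <= M.
Proof.
move=> sA hA; case: z => a b /spectrumP Anz.
have [b0|b0] := eqVneq b 0; last first.
  case: Anz; pose B := A - a%:C *: (1 : bop H); pose J : bop H := (b%:C * 'i%C) *: (1 : bop H).
  have sB : self_adjoint B by apply: saB => //; exact: sa_scal.
  have -> : A - (a +i* b) *: (1 : bop H) = B - J.
    by rewrite (_ : a +i* b = a%:C + b%:C * 'i%C) ?scalerDl ?opprD ?addrA //; simpc.
  have JB : J * B = B * J by rewrite -bopZAl mul1r bopZAr mulr1.
  have JJ : J * J = - ((b ^+ 2)%:C *: (1 : bop H)).
    rewrite -bopZAl mul1r scalerA -scaleNr; congr (_ *: _).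
    by simpc; rewrite expr2.
  clearbody B J.
  have BJ : (B - J) * (B + J) = B * B + (b ^+ 2)%:C *: (1 : bop H).
    by rewrite mulrDr !mulrBl JB JJ opprK addrA subrK.
  apply: (@invertible_commM _ (B + J)).
    by rewrite BJ mulrBr !mulrDl JB JJ opprD opprK addrA addrK.
  rewrite BJ; apply: (@invertible_coercive _ (b ^+ 2)).
  - by apply: saD; [apply: saM|exact: sa_scal].
  - by rewrite lt_neqAle sqr_ge0 eq_sym sqrf_eq0 b0.
  - move=> x; rewrite rdotDl rdotZl rdotxx lerDr.
    by rewrite (iffLR (saP _) sB) rdotxx sqr_ge0.
have zt : a +i* b = a%:C by rewrite b0.
exists a => //; rewrite zt in Anz; apply/andP; split; rewrite leNgt; apply/negP => lt.
  apply: Anz; apply: (@invertible_coercive _ (m - a)); rewrite ?subr_gt0 //.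
    by apply: saB => //; exact: sa_scal.
  move=> x; rewrite rdotBl rdotZl rdotxx mulrBl lerD2r.
  by have /andP[] := hA x.
apply: Anz; rewrite -[X in invertible X]opprB -scaleN1r; apply: invertibleZ.
  by rewrite oppr_eq0 oner_eq0.
apply: (@invertible_coercive _ (a - M)); rewrite ?subr_gt0 //.
  by apply: saB => //; exact: sa_scal.
move=> x; rewrite rdotBl rdotZl rdotxx mulrBl lerD2l lerN2.
by have /andP[] := hA x.
Qed.

Lemma spectrum_real A z : self_adjoint A -> spectrum A z ->
  exists2 t, z = t%:C & `|t| <= opnorm A.
Proof.
move=> sA /(spectrum_itv sA (m := - opnorm A) (M := opnorm A)) [x|t -> tA].
  by rewrite rdot_ge rdot_le.
by exists t => //; rewrite ler_norml.
Qed.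

(** Let c = |T|.  If both T - c and T + c were invertible, c^2 - T^2 would be bounded
    below, and |(c^2 - T^2)x|^2 <= 2 c^2 (c^2 |x|^2 - |Tx|^2) would then keep |Tx|
    away from c |x|. *)
Lemma spectral_radius T : (1 : bop H) != 0 -> self_adjoint T ->
  spectrum T (opnorm T)%:C \/ spectrum T (- opnorm T)%:C.
Proof.
move=> n10 sT; set c := opnorm T; apply/not_andP => -[inv1 inv2].
have [c0|c0] := eqVneq c 0.
  move: inv1; rewrite c0 rmorph0 scale0r subr0 (opnorm_eq0 c0) => -[B [h _]].
  by move/eqP: n10; rewrite -h mul0r.
have {c0} c0 : 0 < c by rewrite lt_neqAle eq_sym c0 opnorm_ge0.
have [B [_ hB]] := invertibleM inv1 inv2.
set b := opnorm B.
have b0 : 0 < b.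
  rewrite lt_neqAle opnorm_ge0 andbT eq_sym; apply/eqP => /opnorm_eq0 B0.
  by move/eqP: n10; rewrite -hB B0 mul0r.
have E x : ((T - c%:C *: (1 : bop H)) * (T - (- c)%:C *: (1 : bop H))) x =
    T (T x) - (c ^+ 2)%:C *: x.
  rewrite rmorphN scaleNr opprK mulrDr !mulrBl !mul_scalr mul_scall scalerA.
  by rewrite addrA subrK -rmorphM -expr2.
pose d := c ^+ 2 - (2 * b ^+ 2 * c ^+ 2)^-1.
have K0 : 0 < 2 * b ^+ 2 * c ^+ 2 by rewrite !mulr_gt0 ?exprn_gt0.
have hd x : rnorm (T x) ^+ 2 <= d * rnorm x ^+ 2.
  have h1 : rnorm x <= b * rnorm (T (T x) - (c ^+ 2)%:C *: x).
    by rewrite -E -[X in rnorm X <= _](congr1 (fun S : bop H => S x) hB); exact: (opnormP B).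
  have h2 : rnorm (T (T x) - (c ^+ 2)%:C *: x) ^+ 2 =
      rnorm (T (T x)) ^+ 2 - 2 * c ^+ 2 * rnorm (T x) ^+ 2 + c ^+ 4 * rnorm x ^+ 2.
    rewrite -!rdotxx rdotBl !rdotBr !rdotZl !rdotZr (rdotC x) !(iffLR (saP _) sT (T x) x).
    by ring.
  have h3 : rnorm (T (T x)) ^+ 2 <= c ^+ 2 * rnorm (T x) ^+ 2.
    by rewrite -exprMn ler_sqr ?nnegrE ?mulr_ge0 ?rnorm_ge0 ?(ltW c0) ?opnormP.
  have h4 : rnorm (T x) ^+ 2 <= c ^+ 2 * rnorm x ^+ 2.
    by rewrite -exprMn ler_sqr ?nnegrE ?mulr_ge0 ?rnorm_ge0 ?(ltW c0) ?opnormP.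
  have h5 : rnorm x ^+ 2 <= b ^+ 2 * rnorm (T (T x) - (c ^+ 2)%:C *: x) ^+ 2.
    by rewrite -exprMn ler_sqr ?nnegrE ?mulr_ge0 ?rnorm_ge0 ?(ltW b0).
  have h6 : rnorm x ^+ 2 <= 2 * b ^+ 2 * c ^+ 2 * (c ^+ 2 * rnorm x ^+ 2 - rnorm (T x) ^+ 2).
    rewrite (le_trans h5) // h2.
    rewrite (_ : 2 * b ^+ 2 * c ^+ 2 * _ = b ^+ 2 *
      (2 * c ^+ 2 * (c ^+ 2 * rnorm x ^+ 2 - rnorm (T x) ^+ 2))); last by ring.
    rewrite ler_wpM2l ?sqr_ge0 //.
    have -> : c ^+ 4 = c ^+ 2 * c ^+ 2 by rewrite -exprD.
    have : c ^+ 2 * rnorm (T x) ^+ 2 <= c ^+ 2 * (c ^+ 2 * rnorm x ^+ 2).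
      by rewrite ler_wpM2l ?sqr_ge0.
    by move: h3; lra.
  rewrite -ler_pdivrMl // in h6; rewrite /d mulrBl.
  by move: h6; lra.
suff : c <= Num.sqrt d.
  have [d0|d0] := leP 0 d; last by rewrite ltr0_sqrtr // leNgt c0.
  rewrite -ler_sqr ?nnegrE ?sqrtr_ge0 ?(ltW c0) // sqr_sqrtr // /d.
  by rewrite lerBrDr -lerBrDl subrr invr_le0 leNgt K0.
apply: opnorm_le => [|x]; first exact: sqrtr_ge0.
rewrite -ler_sqr ?nnegrE ?mulr_ge0 ?rnorm_ge0 ?sqrtr_ge0 // exprMn (le_trans (hd x)) //.
rewrite ler_wpM2r ?sqr_ge0 //; have [d0|d0] := leP 0 d; first by rewrite sqr_sqrtr.
by rewrite (le_trans (ltW d0)) ?sqr_ge0.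
Qed.

Lemma bop1_eq0 A : (1 : bop H) = 0 -> A = 0.
Proof. by move=> h; rewrite -[A]mulr1 h mulr0. Qed.

End Spectrum.

(** * Polynomial and continuous functional calculus *)

Section PolyCalculus.
Variables (R : realType) (H : hilbertType R).
Implicit Types (x y : H) (A B S T : bop H) (z : R[i]).

Definition ceval (p : {poly R[i]}) A : bop H := \sum_(i < size p) p`_i *: A ^+ i.

Lemma bop_polyE (p : {poly R}) A : bop_poly p A = ceval (map_poly (real_complex R) p) A.
Proof.
rewrite /bop_poly /ceval size_map_poly; apply: eq_bigr => i _.
by rewrite coef_map.
Qed.

Lemma ceval_wide n (p : {poly R[i]}) A : (size p <= n)%N ->
  ceval p A = \sum_(i < n) p`_i *: A ^+ i.
Proof.
move=> pn; rewrite /ceval (big_ord_widen n (fun i => p`_i *: A ^+ i) pn).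
rewrite [RHS](bigID (fun i : 'I_n => (i < size p)%N)) /=.
rewrite [X in _ = _ + X]big1 ?addr0 // => i; rewrite -leqNgt => pi.
by rewrite nth_default // scale0r.
Qed.

Lemma cevalD p q A : ceval (p + q) A = ceval p A + ceval q A.
Proof.
set n := maxn (size p) (size q).
rewrite !(@ceval_wide n) ?leq_maxl ?leq_maxr ?size_polyD // -big_split.
by apply: eq_bigr => i _; rewrite coefD scalerDl.
Qed.

Lemma cevalZ c p A : ceval (c *: p) A = c *: ceval p A.
Proof.
rewrite (@ceval_wide (size p)) ?size_scale_leq // scaler_sumr.
by apply: eq_bigr => i _; rewrite coefZ scalerA.
Qed.

Lemma cevalC c A : ceval c%:P A = c *: (1 : bop H).
Proof.
by rewrite (@ceval_wide 1) ?size_polyC_leq1 // big_ord1 coefC expr0.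
Qed.

Lemma cevalMX p A : ceval (p * 'X) A = ceval p A * A.
Proof.
rewrite (@ceval_wide (size p).+1); last first.
  by rewrite (leq_trans (size_polyMleq _ _)) // size_polyX addn2.
rewrite big_ord_recl coefMX scale0r add0r /ceval mulr_suml.
by apply: eq_bigr => i _; rewrite coefMX /= exprSr bopZAl.
Qed.

Lemma ceval_comm p A : ceval p A * A = A * ceval p A.
Proof.
rewrite /ceval mulr_suml mulr_sumr; apply: eq_bigr => i _.
by rewrite bopZAr -bopZAl -exprSr exprS.
Qed.

Lemma cevalM p q A : ceval (p * q) A = ceval p A * ceval q A.
Proof.
elim/poly_ind: p => [|p c IHp].
  by rewrite mul0r /ceval size_poly0 !big_ord0 mul0r.
rewrite mulrDl !cevalD -mulrA (mulrC 'X) mulrA !cevalMX IHp mul_polyC cevalZ cevalC.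
by rewrite mulrDl mul_scall -!mulrA ceval_comm.
Qed.

Lemma cevalXsubC z A : ceval ('X - z%:P) A = A - z *: (1 : bop H).
Proof.
have cX : ceval 'X A = A.
  rewrite (@ceval_wide 2) ?size_polyX // 2!big_ord_recl big_ord0 !coefX /=.
  by rewrite scale0r add0r scale1r addr0 expr1.
by rewrite -polyCN cevalD cX cevalC scaleNr.
Qed.

Lemma bop_polyD (p q : {poly R}) A : bop_poly (p + q) A = bop_poly p A + bop_poly q A.
Proof. by rewrite !bop_polyE rmorphD cevalD. Qed.

Lemma bop_polyM (p q : {poly R}) A : bop_poly (p * q) A = bop_poly p A * bop_poly q A.
Proof. by rewrite !bop_polyE rmorphM cevalM. Qed.

Lemma bop_polyC (c : R) A : bop_poly c%:P A = c%:C *: (1 : bop H).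
Proof. by rewrite !bop_polyE map_polyC cevalC. Qed.

Lemma bop_polyZ (c : R) p A : bop_poly (c *: p) A = c%:C *: bop_poly p A.
Proof. by rewrite -mul_polyC bop_polyM bop_polyC mul_scall. Qed.

Lemma bop_polyB (p q : {poly R}) A : bop_poly (p - q) A = bop_poly p A - bop_poly q A.
Proof. by rewrite bop_polyD -scaleN1r bop_polyZ rmorphN1 scaleN1r. Qed.

Lemma bop_polyXsubC (c : R) A : bop_poly ('X - c%:P) A = A - c%:C *: (1 : bop H).
Proof. by rewrite bop_polyE rmorphB /= map_polyX map_polyC cevalXsubC. Qed.

Lemma bop_poly_sa (p : {poly R}) A : self_adjoint A -> self_adjoint (bop_poly p A).
Proof. by move=> sA; apply: sa_sum => i; apply: saZ; exact: saX. Qed.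

(** Over R[i] the polynomial splits, and one of the linear factors must fail to be
    invertible at A. *)
Lemma ceval_spectrum p A : spectrum A !=set0 -> ~ invertible (ceval p A) ->
  exists2 z, spectrum A z & root p z.
Proof.
move=> [z0 Az0] np; have [p0|p0] := eqVneq p 0.
  by exists z0 => //; rewrite p0 root0.
have [r pr] := closed_field_poly_normal p.
have : exists2 z, z \in r & ~ invertible (A - z *: (1 : bop H)).
  apply: contra_notP np => /forall2NP invr.
  rewrite pr cevalZ; apply: invertibleZ; first by rewrite lead_coef_eq0.
  have {}invr z : z \in r -> invertible (A - z *: (1 : bop H)).
    by move=> zr; case: (invr z) => // /contrapT.
  elim: (r) invr => [|z s IHs] invr.
    by rewrite big_nil cevalC scale1r; exact: invertible1.
  rewrite big_cons cevalM cevalXsubC; apply: invertibleM; first by apply: invr; rewrite mem_head.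
  by apply: IHs => w ws; apply: invr; rewrite inE ws orbT.
case=> z zr nz; exists z => //.
by rewrite pr rootZ ?lead_coef_eq0 // root_prod_XsubC.
Qed.

Lemma spectrum_neq0 A : (1 : bop H) != 0 -> self_adjoint A -> spectrum A !=set0.
Proof. by move=> n10 sA; case: (spectral_radius n10 sA); eexists; eassumption. Qed.

(** Plus or minus the norm of p(A) is in the spectrum of p(A), hence is a value of p
    on the spectrum of A. *)
Lemma opnorm_poly_le (p : {poly R}) A K : self_adjoint A -> 0 <= K ->
  (forall t : R, spectrum A t%:C -> `|p.[t]| <= K) -> opnorm (bop_poly p A) <= K.
Proof.
move=> sA K0 pK; have [h|n10] := eqVneq (1 : bop H) 0.
  by rewrite (bop1_eq0 (bop_poly p A) h) opnorm0.
have key s : `|s| = opnorm (bop_poly p A) -> spectrum (bop_poly p A) s%:C ->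
    opnorm (bop_poly p A) <= K.
  move=> <- /spectrumP; rewrite bop_polyE.
  have -> : ceval (map_poly (real_complex R) p) A - s%:C *: (1 : bop H) =
      ceval (map_poly (real_complex R) (p - s%:P)) A.
    by rewrite -!bop_polyE bop_polyB bop_polyC.
  move=> /ceval_spectrum [|z zA].
  - exact: spectrum_neq0.
  - have [t zt _] := spectrum_real sA zA; rewrite zt in zA *.
    rewrite rootE horner_map !hornerE fmorph_eq0 subr_eq0 => /eqP <-.
    exact: pK.
case: (spectral_radius n10 (bop_poly_sa p sA)) => h; apply: key h.
  by rewrite ger0_norm ?opnorm_ge0.
by rewrite normrN ger0_norm ?opnorm_ge0.
Qed.

Lemma poly_spectrum_le (p : {poly R}) A (t : R) : self_adjoint A ->
  spectrum A t%:C -> `|p.[t]| <= opnorm (bop_poly p A).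
Proof.
move=> sA At.
have /factor_theorem [q pq] : root (p - p.[t]%:P) t by rewrite rootE !hornerE subrr.
have : spectrum (bop_poly p A) (p.[t])%:C.
  apply: contra_not At => h; apply: (@invertible_commM _ _ _ (bop_poly q A)).
    by rewrite -bop_polyXsubC -!bop_polyM mulrC.
  by rewrite -bop_polyXsubC -bop_polyM mulrC -pq bop_polyB bop_polyC.
by move/(spectrum_real (bop_poly_sa p sA)) => [s /(@complexI R) ->].
Qed.

Definition approx_on_spectrum A (g : R -> R) (p : nat -> {poly R}) :=
  forall e : R, 0 < e -> exists n0, forall n t, (n0 <= n)%N -> spectrum A t%:C ->
    `|(p n).[t] - g t| <= e.

Lemma approx_is_cfc A g p T : approx_on_spectrum A g p ->
  opcvg (fun n => bop_poly (p n) A) T ->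
  is_cfc g A T.
Proof.
move=> u c; exists p; split; last by apply/opcvgE.
move=> e e0; have [n0 h] := u (e / 2) (divr_gt0 e0 (ltr0Sn _ 1)).
exists n0 => // n /= n0n t At; rewrite (le_lt_trans (h _ _ n0n At)) //.
by rewrite gtr_pMr // invf_lt1 // ltr1n.
Qed.

Lemma is_cfc_approx A g T : is_cfc g A T ->
  exists2 p, approx_on_spectrum A g p & opcvg (fun n => bop_poly (p n) A) T.
Proof.
move=> [p [u c]]; exists p; last by apply/opcvgE.
move=> e e0; have [n0 _ h] := u e e0; exists n0 => n t n0n At; apply: ltW.
exact: h.
Qed.

Lemma approx_cauchy A g p q : self_adjoint A ->
  approx_on_spectrum A g p -> approx_on_spectrum A g q ->
  forall e, 0 < e -> exists n0, forall n m, (n0 <= n)%N -> (n0 <= m)%N ->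
    opnorm (bop_poly (p n) A - bop_poly (q m) A) <= e.
Proof.
move=> sA up uq e e0; have e2 : 0 < e / 2 by rewrite divr_gt0.
have [n0 h] := up _ e2; have [m0 h'] := uq _ e2; exists (maxn n0 m0) => n m.
rewrite !geq_max => /andP[n0n _] /andP[_ m0m].
rewrite -bop_polyB; apply: opnorm_poly_le; rewrite ?(ltW e0) // => t At.
rewrite !hornerE (_ : _ - _ = ((p n).[t] - g t) + (g t - (q m).[t])); last by ring.
by rewrite (le_trans (ler_normD _ _)) // [e]splitr lerD ?h // distrC h'.
Qed.

(** The value of [cfc] is a choice among limits of approximating sequences, all of
    which are equal by [opnorm_poly_le]. *)
Lemma cfc_cvg A g p : self_adjoint A -> approx_on_spectrum A g p ->
  opcvg (fun n => bop_poly (p n) A) (cfc g A).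
Proof.
move=> sA up; have [T pT] := opcauchy_cvg (approx_cauchy sA up up).
have /getPex/is_cfc_approx [q uq qT] : exists T, is_cfc g A T.
  by exists T; apply: approx_is_cfc pT.
apply: (opcvg_sub qT) => e e0; have [n0 h] := approx_cauchy sA up uq e0.
by exists n0 => n n0n; apply: h.
Qed.

Lemma cfc_sa A g p : self_adjoint A -> approx_on_spectrum A g p -> self_adjoint (cfc g A).
Proof. by move=> sA /(cfc_cvg sA)/opcvg_sa; apply => n; exact: bop_poly_sa. Qed.

Lemma cfc_poly A g p : self_adjoint A -> (forall t : R, spectrum A t%:C -> p.[t] = g t) ->
  cfc g A = bop_poly p A.
Proof.
move=> sA pg; apply: (opcvg_uniq (u := fun=> bop_poly p A)); last exact: opcvg_cst.
apply: (@cfc_cvg _ _ (fun=> p)) => // e e0; exists 0%N => n t _ /pg ->.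
by rewrite subrr normr0 ltW.
Qed.

Lemma cfc_ge A g p (t : R) : self_adjoint A -> approx_on_spectrum A g p ->
  spectrum A t%:C -> `|g t| <= opnorm (cfc g A).
Proof.
move=> sA up At; apply/ler_addgt0Pr => e e0; have e2 : 0 < e / 2 by rewrite divr_gt0.
have [n0 h] := up _ e2; have [m0 h'] := cfc_cvg sA up e2; pose n := maxn n0 m0.
have h1 := h n t (leq_maxl _ _) At; have {}h' := h' n (leq_maxr _ _).
have h2 := poly_spectrum_le (p n) sA At.
have h3 : opnorm (bop_poly (p n) A) <= opnorm (cfc g A) + e / 2.
  rewrite -[bop_poly _ _](subrK (cfc g A)) addrC (le_trans (opnormD _ _)) //.
  by rewrite lerD2l.
have h4 : `|g t| <= `|(p n).[t]| + e / 2.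
  rewrite -[g t](subrK (p n).[t]) addrC (le_trans (ler_normD _ _)) // lerD2l distrC.
  exact: h1.
lra.
Qed.

(** For B = |A| - A >= 0 the norm |B| is in the spectrum of B, so |A| - |B| is in that
    of A; it bounds A from below because |B| bounds B from above. *)
Lemma spectrum_min A : (1 : bop H) != 0 -> self_adjoint A ->
  exists2 m : R, spectrum A m%:C & forall x, m * rnorm x ^+ 2 <= rdot (A x) x.
Proof.
move=> n10 sA; pose M := opnorm A; pose B : bop H := M%:C *: (1 : bop H) - A.
have sB : self_adjoint B by apply: saB => //; exact: sa_scal.
have rB x : rdot (B x) x = M * rnorm x ^+ 2 - rdot (A x) x by rewrite rdotBl rdotZl rdotxx.
have hB x : 0 * rnorm x ^+ 2 <= rdot (B x) x <= opnorm B * rnorm x ^+ 2.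
  by rewrite rdot_le mul0r rB subr_ge0 rdot_le.
exists (M - opnorm B) => [|x]; last first.
  by have := rdot_le B x; rewrite rB mulrBl; lra.
have : spectrum B (opnorm B)%:C.
  have [//|h] := spectral_radius n10 sB.
  have [t /(@complexI R) ht /andP[t0 _]] := spectrum_itv sB hB h.
  have B0 : opnorm B = 0 by apply/eqP; rewrite eq_le opnorm_ge0 andbT -oppr_ge0 ht.
  by rewrite B0 oppr0 in h *.
have N1 : (-1 : R[i]) != 0 by rewrite oppr_eq0 oner_eq0.
apply: contra_not => /(invertibleZ N1); congr invertible.
by rewrite scaleN1r opprB rmorphB scalerBl addrAC.
Qed.

End PolyCalculus.

(** * Operator monotone functions have alternating divided differences *)

Lemma conjCr (R : realType) (a : R) : Num.conj (a%:C : R[i]) = a%:C.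
Proof. by apply/eqP; rewrite eq_complex /= oppr0 !eqxx. Qed.

Section MatrixOperators.
Variables (R : realType) (n : nat).
Local Notation V := (ell2 R n).
Implicit Types (M N : 'M[R[i]]_n).

Fact mxop_bounded M : (fun u : V => (M *m u : V)) \in @bounded_linear R V.
Proof.
apply/bounded_linearP; split=> [a u v|]; first by rewrite mulmxDr -scalemxAr.
exists (\sum_i \sum_j complex.Re `|M i j|) => u.
rewrite (le_trans (enorm_sum _)) // rmorph_sum mulr_suml ler_sum // => i _.
rewrite mxE rmorph_sum mulr_suml (le_trans (ler_norm_sum _ _ _)) // ler_sum // => j _.
by rewrite normrM /= Re_normC ler_wpM2l // enorm_coord.
Qed.
Definition mxop M : bop V := Bop (mxop_bounded M).

Lemma mxopM M N : mxop (M *m N) = mxop M * mxop N.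
Proof. by apply: bopP => u /=; rewrite mulmxA. Qed.

Lemma mxopD M N : mxop (M + N) = mxop M + mxop N.
Proof. by apply: bopP => u /=; rewrite mulmxDl. Qed.

Lemma mxopZ c M : mxop (c *: M) = c *: mxop M.
Proof. by apply: bopP => u /=; rewrite -scalemxAl. Qed.

Lemma mxop1 : mxop 1%:M = 1.
Proof. by apply: bopP => u /=; rewrite mul1mx. Qed.

Lemma mxopB M N : mxop (M - N) = mxop M - mxop N.
Proof. by rewrite mxopD -scaleN1r mxopZ scaleN1r. Qed.

Lemma innerE (u v : V) : inner u v = \sum_i u i 0 * Num.conj (v i 0).
Proof. by []. Qed.

Local Notation toC := (map_mx (real_complex R)).

Lemma mxop_adjoint (M : 'M[R]_n) : is_adjoint (mxop (toC M)) (mxop (toC M^T)).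
Proof.
move=> u v; rewrite !innerE /=.
under eq_bigr do rewrite !mxE mulr_suml.
under [RHS]eq_bigr do rewrite !mxE rmorph_sum mulr_sumr.
rewrite exchange_big /=; apply: eq_bigr => i _; apply: eq_bigr => j _.
by rewrite !mxE rmorphM /= conjCr mulrCA mulrA.
Qed.

Definition diagop (x : 'rV[R]_n) : bop V := mxop (toC (diag_mx x)).

Lemma diagopE x (u : V) i : (diagop x u : V) i 0 = (x 0 i)%:C * u i 0.
Proof.
rewrite /= mxE (bigD1 i) //= big1 => [|j ji].
  by rewrite !mxE eqxx mulr1n addr0.
by rewrite !mxE eq_sym (negPf ji) mulr0n mul0r.
Qed.

Lemma diagop_sa x : self_adjoint (diagop x).
Proof. by have := mxop_adjoint (diag_mx x); rewrite tr_diag_mx. Qed.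

Lemma diagop_spectrum x z : spectrum (diagop x) z -> exists i, z = (x 0 i)%:C.
Proof.
move=> /spectrumP; apply: contra_notP => nz.
pose d i := (x 0 i)%:C - z.
have d0 i : d i != 0 by rewrite subr_eq0; apply/eqP => xz; apply: nz; exists i.
have dE : diagop x - z *: (1 : bop V) = mxop (diag_mx (\row_i d i)).
  rewrite -mxop1 -mxopZ -mxopB; congr mxop; apply/matrixP => i j; rewrite !mxE.
  by case: eqVneq => [->|_]; rewrite ?mulr1n ?mulr0n ?rmorph0 ?mulr0 ?subr0 ?mulr1.
rewrite dE; exists (mxop (diag_mx (\row_i (d i)^-1))).
rewrite -!mxopM !mulmx_diag -mxop1.
by split; congr mxop; apply/matrixP => i j; rewrite !mxE; case: eqVneq => // ->;
  rewrite ?mulfV ?mulVf.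
Qed.

Lemma bop_poly_diagop (p : {poly R}) x (u : V) i :
  (bop_poly p (diagop x) u : V) i 0 = (p.[x 0 i])%:C * u i 0.
Proof.
have hX k : (((diagop x) ^+ k) u : V) i 0 = (x 0 i ^+ k)%:C * u i 0.
  elim: k => [|k IHk]; first by rewrite expr0 mul1r.
  by rewrite !exprS [LHS]diagopE IHk rmorphM mulrA.
rewrite /bop_poly horner_coef rmorph_sum mulr_suml.
elim/big_ind2: _ => [|a A b B hA hB|j _]; first by rewrite mxE.
  by rewrite mxE hA hB.
by rewrite /= mxE hX rmorphM mulrA.
Qed.

End MatrixOperators.

Lemma bop_poly_intertwine (R : realType) (H : hilbertType R) (p : {poly R})
  (A B V : bop H) : A * V = V * B -> bop_poly p A * V = V * bop_poly p B.
Proof.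
move=> AV; rewrite /bop_poly mulr_suml mulr_sumr; apply: eq_bigr => i _.
rewrite bopZAr -bopZAl; congr (_ *: _).
elim: (i : nat) => [|k IHk]; first by rewrite mul1r mulr1.
by rewrite exprSr -mulrA AV mulrA IHk -mulrA -exprSr.
Qed.

Section OperatorMonotone.
Variables (R : realType) (f : R -> R).
Hypothesis hf : operator_monotone `]0, +oo[ f.

(** In the two models of [dd_rank_one], f(A) <= f(B) tested at the vector of q is the
    claim.  On the nodes f coincides with its interpolation polynomial, which
    computes both f(A) and f(B). *)
Lemma opmono_dd_sqr (s : seq R) k (q : {poly R}) : uniq s -> size s = k.*2 ->
  {in s, forall z, 0 < z} -> (size q <= k)%N ->
  0 <= dd (fun t => q.[t] ^+ 2 * f t) s.
Proof.
move=> us sk s0 sq.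
have [x [y [W [v [E [WW BA xs ys ->]]]]]] := dd_rank_one us sk; last by [].
pose toC m n := @map_mx R R[i] (real_complex R) m n.
pose A := diagop x; pose D := diagop y.
pose U := mxop (toC _ _ W); pose U' := mxop (toC _ _ W^T).
have UU' : U * U' = 1 by rewrite -mxopM -map_mxM (mulmx1C WW) map_mx1 mxop1.
have U'U : U' * U = 1 by rewrite -mxopM -map_mxM WW map_mx1 mxop1.
pose B := U' * D * U.
have adjU : is_adjoint U U' by exact: mxop_adjoint.
have adjU' : is_adjoint U' U by have := mxop_adjoint W^T; rewrite trmxK.
have sB : self_adjoint B.
  rewrite /B /self_adjoint -[X in is_adjoint _ X]mulrA.
  by apply: adjointM => //; apply: adjointM => //; exact: diagop_sa.
have BE : B = A + mxop (toC _ _ (v *m v^T)).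
  by rewrite /B -!mxopM -!map_mxM BA map_mxD mxopD.
have le_AB : bop_le A B.
  move=> u; rewrite BE; set M := mxop _.
  have -> : inner ((A + M) u) u = inner (A u) u + inner (M u) u by rewrite /inner linearDl.
  rewrite lerDl innerE.
  pose c := \sum_j (v j 0)%:C * u j 0.
  have -> : \sum_i (M u : ell2 R k) i 0 * Num.conj (u i 0) = c * Num.conj c.
    rewrite rmorph_sum mulr_sumr; apply: eq_bigr => i _ /=.
    rewrite mxE rmorphM /= conjCr mulrA; congr (_ * _).
    rewrite mulr_suml; apply: eq_bigr => j _.
    by rewrite !mxE big_ord1 !mxE rmorphM /= [RHS]mulrC mulrA.
  by rewrite -normCK exprn_ge0.
have specA z : spectrum A z -> exists2 t, t \in s & z = t%:C.
  by move=> /diagop_spectrum[i ->]; exists (x 0 i).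
have specB z : spectrum B z -> exists2 t, t \in s & z = t%:C.
  move=> Bz; have /diagop_spectrum[i ->] : spectrum D z; last by exists (y 0 i).
  apply: contra_not Bz => Dz.
  have -> : B - z *: (1 : bop (ell2 R k)) = U' * (D - z *: (1 : bop (ell2 R k))) * U.
    by rewrite mulrBr mulrBl mul_scalr -bopZAl U'U.
  by apply: invertibleM; [apply: invertibleM => //; exists U|exists U'].
pose p := newton f s.
have pf t : t \in s -> p.[t] = f t by move=> ts; rewrite -(newton_interp f us ts).
have cA : cfc f A = bop_poly p A.
  by apply: cfc_poly => [|t /specA[t' ts /(@complexI R) ->]]; [exact: diagop_sa|exact: pf].
have cB : cfc f B = bop_poly p B.
  by apply: cfc_poly => // t /specB[t' ts /(@complexI R) ->]; exact: pf.
have pos t : t \in s -> [set` `]0, +oo[] t by move=> /s0; rewrite /= in_itv /= andbT.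
have iA : spectrum_in A [set` `]0, +oo[].
  by move=> z /specA[t ts ->]; exists t => //; exact: pos.
have iB : spectrum_in B [set` `]0, +oo[].
  by move=> z /specB[t ts ->]; exists t => //; exact: pos.
have := hf.2 _ A B (diagop_sa x) sB iA iB le_AB.
pose xi : ell2 R k := toC _ _ (E q).
move=> /(_ xi); rewrite cA cB.
have -> : bop_poly p B = U' * bop_poly p D * U.
  have h : B * U' = U' * D by rewrite /B -!mulrA UU' mulr1.
  by rewrite -(bop_poly_intertwine p h) -mulrA U'U mulr1.
rewrite [inner ((U' * _ * _) xi) _]adjU' !innerE.
have -> : \sum_i (bop_poly p A xi : ell2 R k) i 0 * Num.conj (xi i 0) =
    (\sum_i f (x 0 i) * (E q i 0) ^+ 2)%:C.
  rewrite rmorph_sum; apply: eq_bigr => i _; rewrite bop_poly_diagop !mxE /= conjCr.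
  by rewrite pf // -!rmorphM -mulrA -expr2.
have -> : \sum_i (bop_poly p D (U xi) : ell2 R k) i 0 * Num.conj ((U xi : ell2 R k) i 0) =
    (\sum_i f (y 0 i) * ((W *m E q) i 0) ^+ 2)%:C.
  rewrite rmorph_sum; apply: eq_bigr => i _; rewrite bop_poly_diagop pf //.
  have -> : (U xi : ell2 R k) = toC _ _ (W *m E q) by rewrite /toC map_mxM.
  by rewrite !mxE conjCr -!rmorphM -mulrA -expr2.
by rewrite lecR subr_ge0.
Qed.

Lemma opmono_dd_even (s : seq R) k : uniq s -> size s = k.*2 -> (0 < k)%N ->
  {in s, forall z, 0 < z} -> 0 <= dd f s.
Proof.
move=> us sk k0 s0.
rewrite (@eq_dd _ _ (fun t => (1%:P : {poly R}).[t] ^+ 2 * f t)).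
  by apply: opmono_dd_sqr sk _ _ => //; rewrite size_polyC oner_eq0.
by move=> t _ /=; rewrite hornerC expr1n mul1r.
Qed.

(** Add a node M and take q = X - M: the divided difference of q^2 f becomes that of
    (t - M) f at the given nodes, which for large M has the sign of that of -f. *)
Lemma opmono_dd_odd (s : seq R) k : uniq s -> size s = k.*2.+1 -> (0 < k)%N ->
  {in s, forall z, 0 < z} -> dd f s <= 0.
Proof.
move=> us sk k0 s0; rewrite leNgt; apply/negP => d0.
pose c := dd (fun t => t * f t) s.
(* large enough to exceed the nodes and to make M [s]f > [s](t f) *)
pose M := \sum_(z <- s) z + `|c| / dd f s + 1.
have zM z : z \in s -> z < M.
  move=> zs; rewrite /M -addrA (big_rem z) //= -addrA ltrDl ltr_wpDl //; last first.
    by rewrite ltr_wpDl // divr_ge0 // ltW.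
  by rewrite big_seq sumr_ge0 // => y /mem_rem/s0/ltW.
have Ms : M \notin s by apply/negP => /zM; rewrite ltxx.
have M0 : 0 < M.
  rewrite ltr_wpDl // addr_ge0 ?divr_ge0 ?(ltW d0) //.
  by rewrite big_seq sumr_ge0 // => y /s0/ltW.
have uMs : uniq (M :: s) by rewrite /= Ms.
have sMs : size (M :: s) = k.+1.*2 by rewrite /= sk.
have posMs : {in M :: s, forall z, 0 < z}.
  by move=> z; rewrite inE => /predU1P[->//|/s0].
have := opmono_dd_sqr uMs sMs posMs (q := 'X - M%:P).
rewrite size_XsubC ltnS => /(_ k0).
rewrite (@eq_dd _ _ (fun t => (t - M) * ((t - M) * f t))); last first.
  by move=> t _ /=; rewrite hornerXsubC expr2 mulrA.
rewrite dd_subX // leNgt => /negP; apply.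
rewrite (@eq_dd _ _ (fun t => t * f t + (- M) * f t)); last by move=> t _ /=; ring.
rewrite ddD ddZ -/c mulNr subr_lt0 -ltr_pdivrMr //.
apply: (@le_lt_trans _ _ (`|c| / dd f s)); first by rewrite ler_pM2r ?invr_gt0 ?ler_norm.
rewrite /M -addrA ltr_wpDl // ?ltrDl // big_seq sumr_ge0 // => y /s0/ltW //.
Qed.

Theorem opmono_alternating : alternating f.
Proof.
move=> s us s1 s0; rewrite -signr_odd; have := odd_double_half (size s).
case: (boolP (odd (size s))) => os /= hs.
  rewrite expr1 mulN1r oppr_ge0; apply: (@opmono_dd_odd _ (size s)./2) => //.
  by move: s1; rewrite -hs; case: (_./2).
rewrite expr0 mul1r; apply: (@opmono_dd_even _ (size s)./2) => //.
by move: s1; rewrite -hs; case: (_./2).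
Qed.
End OperatorMonotone.

(** * Newton polynomials approximate a function and its derivative *)

(** Here P is the slope at a point of a concave function that exceeds g there by at
    most eta and stays above g at distance d on both sides; Dm and Dp are slopes of
    g at these two points, and D its slope in the middle. *)
Lemma slope_squeeze (R : realFieldType) (d e k eta p pm pp g gm gp P D Dm Dp : R) :
  0 < d -> k <= e / 2 -> eta <= e * d / 2 -> p - g <= eta -> gm <= pm -> gp <= pp ->
  pm <= p + P * - d -> pp <= p + P * d -> g <= gm + Dm * d -> g <= gp + Dp * - d ->
  Dm - D <= k -> - k <= Dp - D -> `|P - D| <= e.
Proof.
move=> d0 ke he pg gm_pm gp_pp hm hp hgm hgp h1 h2; rewrite ler_norml.
have k1 : Dm * d <= (D + e / 2) * d by rewrite ler_pM2r //; lra.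
have k2 : (D - e / 2) * d <= Dp * d by rewrite ler_pM2r //; lra.
have l1 : (D - e) * d <= P * d by clear h1 h2 ke d0; lra.
have l2 : P * d <= (D + e) * d by clear h1 h2 ke d0; lra.
rewrite ler_pM2r // in l1; rewrite ler_pM2r // in l2.
by apply/andP; split; clear - l1 l2; lra.
Qed.

(** The nodes c + 1/(i + 1), with c = M + 1, stay in a bounded interval to the right
    of [m, M], so the errors of the values decay geometrically.  The Newton
    polynomials are concave and lie above f, which carries the convergence over to
    the derivatives. *)
Lemma newton_nodes (R : realType) (f : R -> R) (m M : R) : alternating f -> 0 < m -> m <= M ->
  exists s : nat -> seq R, [/\ forall n, uniq (s n), forall n, {in s n, forall z, M < z} &
    forall e, 0 < e -> exists n0, forall n t, (n0 <= n)%N -> m <= t <= M ->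
      `|(newton f (s n)).[t] - f t| <= e /\
      `|(newton f (s n))^`().[t] - (f^`())%classic t| <= e].
Proof.
move=> alt m0 mM; pose c := M + 1; pose b := c + 1.
pose g (i : nat) := c + i.+1%:R^-1; pose s n := rcons [seq g i | i <- iota 1 n] (g 0%N).
have gi : injective g by move=> i j /addrI/invr_inj/eqP; rewrite eqr_nat eqSS => /eqP.
have us n : uniq (s n).
  rewrite /s rcons_uniq map_inj_uniq ?iota_uniq // andbT.
  by apply/mapP => -[j]; rewrite mem_iota => /andP[j1 _] /gi j0; rewrite -j0 in j1.
have s_itv n z : z \in s n -> c < z <= b.
  rewrite /s -map_rcons => /mapP[i _ ->]; rewrite /g /b ltrDl invr_gt0 ltr0Sn /= lerD2l.
  by rewrite invf_le1 ?ltr0Sn // ler1n.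
have Mc : M < c by rewrite ltrDl.
have c0 : 0 < c by rewrite (lt_le_trans m0) // (le_trans mM) // ltW.
pose m2 := m / 2; have m20 : 0 < m2 by rewrite divr_gt0.
have m2m : m2 < m by rewrite /m2; lra.
have [C C0 [d0 [tang dlip]]] := alt_derivative alt m20.
pose p n := newton f (s n).
have p_ge n t : 0 < t -> t <= c -> f t <= (p n).[t].
  move=> t0 tc; apply: newton_ge => //; first by rewrite size_rcons.
  by move=> z /s_itv/andP[cz _]; exact: le_lt_trans cz.
pose rho := (b - m) / (b - m2).
have bm : m < b by rewrite /b /c; lra.
have rho01 : 0 <= rho < 1.
  rewrite divr_ge0 ?subr_ge0 ?(ltW bm) ?(ltW (lt_trans m2m bm)) //=.
  by rewrite ltr_pdivrMr ?subr_gt0 ?(lt_trans m2m) // mul1r; lra.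
pose K := f (g 0%N) - f m2.
have p_err n t : m <= t -> t <= c -> (p n).[t] - f t <= (rho * K) * rho ^+ n.
  move=> mt tc; have := @newton_err_geo _ f alt [seq g i | i <- iota 1 n] (g 0%N)
    m2 m t b (us n) m20 m2m mt.
  rewrite size_map size_iota exprS mulrAC [rho * _ * _]mulrAC mulrAC; apply.
  by move=> z /s_itv/andP[cz zb]; rewrite zb andbT (le_lt_trans tc).
exists s; split=> // [n z /s_itv/andP[cz _]|e e0]; first exact: lt_trans cz.
(* Moving by d costs C d in the slope of f, and the approximation error eta costs
   eta / d in the slope of the Newton polynomial; m / 3 and 1 keep t - d and t + d
   between m / 2 and c. *)
pose d := Num.min (Num.min (m / 3) 1) (e / (2 * (C + 1))).
have C1 : 0 < C + 1 by rewrite ltr_wpDl.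
have dp : 0 < d by rewrite !lt_min !divr_gt0 ?ltr01 ?mulr_gt0.
have dm : d <= m / 3 by rewrite /d !ge_min lexx.
have d1 : d <= 1 by rewrite /d !ge_min lexx orbT.
have dC : C * d <= e / 2.
  apply: (@le_trans _ _ (C * (e / (2 * (C + 1))))); first by rewrite ler_wpM2l // /d ge_min lexx orbT.
  rewrite (_ : C * _ = (e / 2) * (C / (C + 1))); last by field; rewrite gt_eqF.
  by rewrite ger_pMr ?divr_gt0 // ler_pdivrMr // mul1r lerDl.
pose eta := Num.min e (e * d / 2).
have eta0 : 0 < eta by rewrite lt_min e0 !divr_gt0 ?mulr_gt0.
have [n0 hn0] := geo_small (rho * K) rho01 eta0.
exists n0 => n t n0n /andP[mt tM].
have tc : t <= c by rewrite (le_trans tM) // ltW.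
have t0 : 0 < t by rewrite (lt_le_trans m0).
have := p_err n t mt tc; have := hn0 n n0n => h1 h2.
have err : (p n).[t] - f t <= eta by exact: le_trans h1.
have ge := p_ge n t t0 tc.
have eta_e : eta <= e by rewrite /eta ge_min lexx.
have eta_d : eta <= e * d / 2 by rewrite /eta ge_min lexx orbT.
split; first by rewrite ger0_norm ?subr_ge0 // (le_trans err).
have szs z : z \in s n -> c <= z by move=> /s_itv/andP[/ltW].
have s0 z : z \in s n -> 0 < z by move=> /szs; exact: lt_le_trans.
have tp u : u <= c -> (p n).[u] <= (p n).[t] + (p n)^`().[t] * (u - t).
  move=> uc; apply: newton_tangent => // z /szs; exact: le_trans.
have tlow : m2 < t - d by rewrite /m2; lra.
have tc1 : t - d <= c by lra.
have tc2 : t + d <= c by rewrite /c; lra.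
have e1 := tp (t - d) tc1; have e2 := tp (t + d) tc2.
have g1 := p_ge n (t - d) (lt_trans m20 tlow) tc1.
have g2 := p_ge n (t + d) (addr_gt0 t0 dp) tc2.
have m2t : m2 < t by lra. have m2td : m2 < t + d by lra.
have f1 := tang (t - d) t tlow (ltW m2t).
have f2 := tang (t + d) t m2td (ltW m2t).
have l1 := dlip (t - d) t tlow m2t; have l2 := dlip (t + d) t m2td m2t.
have Edm : t - d - t = - d by rewrite addrAC subrr sub0r.
have Edp : t + d - t = d by rewrite addrAC subrr add0r.
have Etm : t - (t - d) = d by rewrite opprB addrC subrK.
have Etp : t - (t + d) = - d by rewrite opprD addrA subrr sub0r.
rewrite Edm in e1 l1; rewrite Edp in e2 l2; rewrite Etm in f1; rewrite Etp in f2.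
rewrite normrN (gtr0_norm dp) ler_norml in l1; rewrite (gtr0_norm dp) ler_norml in l2.
have /andP[_ l1'] := l1; have /andP[l2' _] := l2.
exact: slope_squeeze dp dC eta_d err g1 g2 e1 e2 f1 f2 l1' l2'.
Qed.

(** * Unitarily invariant norms *)

Lemma comm_mulrDB (P : pzRingType) (x y : P) : x * y = y * x ->
  (x + y) * (x - y) = x * x - y * y.
Proof. by move=> xy; rewrite mulrDl !mulrBr xy addrA subrK. Qed.

Section UnitarilyInvariant.
Variables (R : realType) (H : hilbertType R) (N : bop H -> R).
Hypothesis hN : unitarily_invariant_norm N.
Implicit Types (A B S T X Y Z U V : bop H) (c m M t : R).

Lemma uinZ (c : R) A : N (c%:C *: A) = `|c| * N A.
Proof.
apply: (@complexI R); rewrite (uin_homogeneous hN) (rmorphM (real_complex R)) /=.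
by rewrite normc_def /= expr0n addr0 sqrtr_sqr.
Qed.

Lemma uin0 : N 0 = 0.
Proof. by rewrite -(scale0r (0 : bop H)) -(rmorph0 (real_complex R)) uinZ normr0 mul0r. Qed.

Lemma uinN A : N (- A) = N A.
Proof. by rewrite -scaleN1r -(rmorphN1 (real_complex R)) uinZ normrN1 mul1r. Qed.

Lemma uin_ge0 A : 0 <= N A.
Proof.
have := uin_triangle hN A (- A); rewrite subrr uin0 uinN -mulr2n -mulr_natl.
by rewrite pmulr_rge0.
Qed.

Lemma uinB A B : N (A - B) = N (B - A).
Proof. by rewrite -uinN opprB. Qed.

Lemma uin_sum (I : Type) (r : seq I) (F : I -> bop H) :
  N (\sum_(i <- r) F i) <= \sum_(i <- r) N (F i).
Proof.
elim/big_ind2: _ => [|A a B b hA hB|i _]; rewrite ?uin0 //.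
by rewrite (le_trans (uin_triangle hN _ _)) // lerD.
Qed.

(** With K = S^2 and k = |S|^2 < 1, the map Y |-> (K + Y^2) / 2 contracts the ball of
    radius k by the factor k, and its fixed point satisfies (1 - Y)^2 = 1 - K. *)
Lemma bop_sqrt S : self_adjoint S -> opnorm S < 1 ->
  exists Q, [/\ self_adjoint Q, S * Q = Q * S & Q * Q = 1 - S * S].
Proof.
move=> sS S1; pose K := S * S; pose k := opnorm S ^+ 2.
have k0 : 0 <= k by rewrite sqr_ge0.
have k1 : k < 1 by rewrite expr_lt1 ?opnorm_ge0.
have hK : opnorm K <= k by rewrite (le_trans (opnormM _ _)) // -expr2.
have sK : self_adjoint K by exact: saM.
pose h : R := 2^-1.
have h0 : 0 <= h by rewrite invr_ge0.
pose u := fix u n : bop H := if n is n'.+1 then h%:C *: (K + u n' * u n') else 0.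
have us n : u n.+1 = h%:C *: (K + u n * u n) by [].
have un n : opnorm (u n) <= k.
  elim: n => [|n IHn]; first by rewrite opnorm0.
  rewrite us opnormZr ger0_norm // mulrC ler_pdivrMr // (le_trans (opnormD _ _)) //.
  rewrite mulr_natr mulr2n lerD // (le_trans (opnormM _ _)) //.
  apply: (@le_trans _ _ (k * k)); first by rewrite ler_pM ?opnorm_ge0.
  by rewrite ler_piMr // ltW.
have uS n : u n * S = S * u n.
  elim: n => [|n IHn]; first by rewrite mul0r mulr0.
  rewrite us -bopZAl bopZAr; congr (_ *: _); rewrite mulrDl mulrDr /K mulrA; congr (_ + _).
  by rewrite -mulrA IHn mulrA IHn mulrA.
have su n : self_adjoint (u n).
  elim: n => [|n IHn]; first exact: sa0.
  by rewrite us; apply: saZ; apply: saD => //; exact: saM.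
have [||Y uY] := @opcvg_geo _ _ u k k; first by rewrite k0 k1.
  elim=> [|n IHn].
    rewrite expr0 mulr1 us [u 0%N]/= mulr0 addr0 subr0 opnormZr ger0_norm //.
    by rewrite (le_trans (ler_wpM2l h0 hK)) // ler_piMl // invf_le1 ?ler1n.
  rewrite us (us n) -scalerBr opprD addrACA subrr add0r opnormZr ger0_norm //.
  have -> : u n.+1 * u n.+1 - u n * u n = u n.+1 * (u n.+1 - u n) + (u n.+1 - u n) * u n.
    by rewrite mulrBr mulrBl addrA subrK.
  rewrite mulrC ler_pdivrMr // (le_trans (opnormD _ _)) // mulr_natr mulr2n exprS mulrCA.
  rewrite lerD // (le_trans (opnormM _ _)) //; first by rewrite ler_pM ?opnorm_ge0.
  by rewrite mulrC ler_pM ?opnorm_ge0.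
have EY : Y = h%:C *: (K + Y * Y).
  apply: (opcvg_uniq (opcvgS uY)).
  by apply: opcvgZ; apply: opcvgD; [exact: opcvg_cst|exact: opcvgM].
have hh : h + h = 1 by rewrite /h; field.
have YY : Y + Y = K + Y * Y.
  have := congr1 (fun T : bop H => T + T) EY.
  by rewrite -scalerDl -rmorphD hh scale1r.
exists (1 - Y); split.
- by apply: saB; [exact: sa1|exact: opcvg_sa uY su].
- by rewrite mulrBr mulrBl mulr1 mul1r (opcvg_comm uY uS).
- rewrite mulrBr mulr1 mulrBl mul1r opprB addrACA -opprD YY opprD addrACA.
  by rewrite subrr addr0.
Qed.

Lemma unitary1 : unitary (1 : bop H).
Proof. by exists 1; split=> //; rewrite mulr1. Qed.

(** S is the mean of the two unitaries S + iQ and S - iQ, where Q^2 = 1 - S^2. *)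
Lemma uin_contraction S Z : self_adjoint S -> opnorm S < 1 ->
  N (S * Z) <= N Z /\ N (Z * S) <= N Z.
Proof.
move=> sS S1; have [Q [sQ SQ QQ]] := bop_sqrt sS S1.
pose U := S + 'i%C *: Q; pose V := S - 'i%C *: Q.
have adj : is_adjoint U V.
  move=> x y; rewrite /inner linearDl linearBr linearZl_LR linearZr_LR /= -!/(inner _ _).
  rewrite sS sQ; congr (_ + _); rewrite -mulNr; congr (_ * _).
  by apply/eqP; rewrite eq_complex /= oppr0 opprK !eqxx.
have adj' : is_adjoint V U.
  by move=> x y; rewrite innerC -adj -innerC.
have ii : 'i%C * 'i%C = -1 :> R[i] by rewrite -expr2 sqr_i.
have SJ : S * ('i%C *: Q) = 'i%C *: Q * S by rewrite bopZAr -bopZAl SQ.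
have JJ : ('i%C *: Q) * ('i%C *: Q) = - (1 - S * S).
  by rewrite bopZAr -bopZAl scalerA ii scaleN1r QQ.
have UV : U * V = 1 by rewrite comm_mulrDB // JJ opprK addrC subrK.
have VU : V * U = 1.
  rewrite /U -[X in S + X]opprK comm_mulrDB; last by rewrite mulrN mulNr SJ.
  by rewrite mulrNN JJ opprK addrC subrK.
have uU : unitary U by exists V.
have uV : unitary V by exists U.
have SE : S = (2^-1)%:C *: (U + V).
  rewrite /U /V addrACA subrr addr0 scalerDr -scalerDl -rmorphD.
  by rewrite (_ : 2^-1 + 2^-1 = 1 :> R) ?scale1r //; field.
rewrite SE; split.
  rewrite -bopZAl uinZ ger0_norm ?invr_ge0 // mulrDl ler_pdivrMl // mulr_natl mulr2n.
  rewrite (le_trans (uin_triangle hN _ _)) // lerD //.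
    by rewrite -[U * Z]mulr1 (uin_unitary hN _ uU unitary1).
  by rewrite -[V * Z]mulr1 (uin_unitary hN _ uV unitary1).
rewrite bopZAr uinZ ger0_norm ?invr_ge0 // mulrDr ler_pdivrMl // mulr_natl mulr2n.
rewrite (le_trans (uin_triangle hN _ _)) // lerD //.
  by rewrite -{1}[Z]mul1r (uin_unitary hN _ unitary1 uU).
by rewrite -{1}[Z]mul1r (uin_unitary hN _ unitary1 uV).
Qed.

Lemma uin_saM c S Z : self_adjoint S -> opnorm S <= c ->
  N (S * Z) <= c * N Z /\ N (Z * S) <= c * N Z.
Proof.
move=> sS Sc.
have key e : 0 < e -> N (S * Z) <= (c + e) * N Z /\ N (Z * S) <= (c + e) * N Z.
  move=> e0; have c0 : 0 < c + e by rewrite ltr_wpDl // (le_trans (opnorm_ge0 S)).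
  pose T := (c + e)^-1%:C *: S.
  have sT : self_adjoint T by exact: saZ.
  have T1 : opnorm T < 1.
    rewrite opnormZr gtr0_norm ?invr_gt0 // ltr_pdivrMl // mulr1.
    by rewrite (le_lt_trans Sc) // ltrDl.
  have [h1 h2] := uin_contraction Z sT T1.
  have SE : S = (c + e)%:C *: T by rewrite scalerA -rmorphM mulfV ?gt_eqF // scale1r.
  by rewrite SE -bopZAl bopZAr !uinZ gtr0_norm // !ler_pM2l.
have N1 : 0 < N Z + 1 by rewrite ltr_wpDl ?uin_ge0.
have Ne e : 0 < e -> e / (N Z + 1) * N Z <= e.
  by move=> e0; rewrite mulrAC -mulrA ger_pMr // ler_pdivrMr // mul1r lerDl.
split; apply/ler_addgt0Pr => e e0; have eN : 0 < e / (N Z + 1) by rewrite divr_gt0.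
  by rewrite (le_trans (key _ eN).1) // mulrDl lerD2l Ne.
by rewrite (le_trans (key _ eN).2) // mulrDl lerD2l Ne.
Qed.

Lemma uin_sa_le S : self_adjoint S -> N S <= opnorm S * N 1.
Proof. by move=> sS; have := (uin_saM 1 sS (lexx _)).1; rewrite mulr1. Qed.

Definition op_between m M X := self_adjoint X /\
  forall x, m * rnorm x ^+ 2 <= rdot (X x) x <= M * rnorm x ^+ 2.

Lemma bop_polyCsubX z X : bop_poly (z%:P - 'X) X = z%:C *: (1 : bop H) - X.
Proof.
by rewrite -opprB -[- ('X - _)]scaleN1r bop_polyZ bop_polyXsubC rmorphN1 scaleN1r opprB.
Qed.

Lemma opnorm_node m M X z : op_between m M X -> m <= M -> M <= z ->
  opnorm (z%:C *: (1 : bop H) - X) <= z - m.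
Proof.
move=> [sX hX] mM Mz; apply: opnorm_pos; first by apply: saB => //; exact: sa_scal.
  move=> x; rewrite rdotBl rdotZl rdotxx; have /andP[h1 h2] := hX x.
  have := ler_wpM2r (sqr_ge0 (rnorm x)) Mz; rewrite mulrBl => h3.
  by apply/andP; split; lra.
by rewrite subr_ge0 (le_trans mM).
Qed.

(** Each factor z - X has norm at most z - m. *)
Lemma opnorm_pnodal m M X s : op_between m M X -> m <= M -> {in s, forall z, M <= z} ->
  opnorm (bop_poly (pnodal s) X) <= (pnodal s).[m].
Proof.
move=> hX mM; elim: s => [_|z s IHs hs].
  by rewrite pnodal_nil bop_polyC scale1r hornerC opnorm1.
have hs' : {in s, forall z, M <= z} by move=> w ws; rewrite hs // inE ws orbT.
rewrite pnodal_cons bop_polyM bop_polyCsubX hornerM (le_trans (opnormM _ _)) //.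
rewrite ler_pM ?opnorm_ge0 ?IHs // !hornerE; apply: opnorm_node hX mM _.
by rewrite hs ?mem_head.
Qed.

(** Induction with
    (z - X) P(X) - (z - Y) P(Y) = (z - X) (P(X) - P(Y)) + (Y - X) P(Y):
    bounding z - X by z - m and P(Y) by P(m) reproduces the product rule for
    the derivative at m. *)
Lemma pnodal_lip m M X Y s : op_between m M X -> op_between m M Y -> m <= M ->
  {in s, forall z, M <= z} ->
  N (bop_poly (pnodal s) X - bop_poly (pnodal s) Y) <= - (pnodal s)^`().[m] * N (X - Y).
Proof.
move=> hX hY mM; elim: s => [_|z s IHs hs].
  by rewrite pnodal_nil !bop_polyC subrr uin0 derivC horner0 oppr0 mul0r.
have hs' : {in s, forall z, M <= z} by move=> w ws; rewrite hs // inE ws orbT.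
have Mz : M <= z by rewrite hs ?mem_head.
rewrite deriv_pnodal_cons pnodal_cons !bop_polyM !bop_polyCsubX.
set P := bop_poly (pnodal s).
rewrite (_ : _ - _ = (z%:C *: (1 : bop H) - X) * (P X - P Y) + (Y - X) * P Y); last first.
  rewrite mulrBr -addrA; congr (_ + _); rewrite -!mulNr -mulrDl; congr (_ * _).
  by rewrite !opprB [RHS]addrC addrA subrK.
rewrite (le_trans (uin_triangle hN _ _)) // opprD opprK [leRHS]mulrDl [leLHS]addrC lerD //.
  rewrite [N (X - Y)]uinB; apply: (uin_saM _ _ _).2; first exact: bop_poly_sa hY.1.
  exact: opnorm_pnodal hY mM hs'.
have /(uin_saM (P X - P Y)) h := opnorm_node hX mM Mz.
have [|h1 _] := h _; first by apply: saB; [exact: sa_scal|exact: hX.1].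
rewrite (le_trans h1) // -mulrN -mulrA ler_wpM2l ?IHs // subr_ge0 (le_trans mM) //.
Qed.

End UnitarilyInvariant.

(** * The Lipschitz estimate for operator functions *)

Section Lipschitz.
Variables (R : realType) (H : hilbertType R).
Implicit Types (X Y : bop H) (m M : R) (N : bop H -> R).

Lemma uin_opnorm : unitarily_invariant_norm (@opnorm R H).
Proof.
split; [exact: opnormD|exact: opnormZ|exact: opnorm_eq0|].
have isom U : unitary U -> forall x, rnorm (U x) = rnorm x.
  move=> [V [/is_adjointP UV VU _]] x; apply/eqP.
  rewrite -(eqrXn2 (n := 2)) ?rnorm_ge0 // -!rdotxx UV.
  by rewrite -[V (U x)]/((V * U) x) VU.
have inv U : unitary U -> exists2 V : bop H, unitary V & V * U = 1 /\ U * V = 1.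
  move=> [V [UV VU UV1]]; exists V => //; exists U; split=> // x y.
  by rewrite innerC -UV -innerC.
have le U V A : unitary U -> unitary V -> opnorm (U * A * V) <= opnorm A.
  move=> uU uV; apply: opnorm_le => [|x]; first exact: opnorm_ge0.
  by rewrite -[_ x]/(U (A (V x))) isom // (le_trans (opnormP _ _)) // isom.
move=> U V A uU uV; apply/eqP; rewrite eq_le le //=.
have [U' uU' [U'U _]] := inv _ uU; have [V' uV' [_ VV']] := inv _ uV.
have {1}-> : A = U' * (U * A * V) * V' by rewrite !mulrA U'U mul1r -mulrA VV' mulr1.
exact: le.
Qed.

(** The bounds of [pnodal_lip] enter with the coefficients of [newton_consE], and add
    up to the derivative of the Newton polynomial at m. *)
Lemma newton_lip (f : R -> R) N m M X Y s : unitarily_invariant_norm N -> alternating f ->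
  0 < m -> op_between m M X -> op_between m M Y -> m <= M ->
  uniq s -> {in s, forall z, M < z} ->
  N (bop_poly (newton f s) X - bop_poly (newton f s) Y) <=
    (newton f s)^`().[m] * N (X - Y).
Proof.
move=> hN alt m0 hX hY mM; elim: s => [_ _|z s IHs us hs].
  by rewrite /= /bop_poly size_poly0 !big_ord0 subrr (uin0 hN) deriv0 horner0 mul0r.
have hs' : {in s, forall z, M < z} by move=> w ws; rewrite hs // inE ws orbT.
have [->|s0] := eqVneq s [::].
  rewrite /= add0r /nodal big_nil -mul_polyC mulr1 !bop_polyC subrr (uin0 hN).
  by rewrite derivC horner0 mul0r.
rewrite newton_consE derivB derivZ !bop_polyB !bop_polyZ hornerD hornerN hornerZ.
have := alt_cons alt us; rewrite lt0n size_eq0 s0 => /(_ isT) a0.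
have {}a0 : 0 <= (-1) ^+ (size s).+1 * dd f (z :: s).
  by apply: a0 => w /hs; apply: lt_trans; exact: lt_le_trans mM.
set a := _ * dd _ _ in a0 *; clearbody a.
set P := bop_poly (newton f s); set Q := bop_poly (pnodal s).
have -> : P X - a%:C *: Q X - (P Y - a%:C *: Q Y) = (P X - P Y) - a%:C *: (Q X - Q Y).
  by rewrite scalerBr !opprB [LHS]addrACA [RHS]addrACA [- _ + _]addrC; congr (_ + _); rewrite addrC.
rewrite (le_trans (uin_triangle hN _ _)) // (uinN hN) (uinZ hN) ger0_norm // mulrDl.
apply: lerD; first by apply: IHs => //; case/andP: us.
rewrite mulNr -mulrA -mulrN ler_wpM2l // -mulNr.
by apply: (pnodal_lip hN hX hY mM) => w /hs'/ltW.
Qed.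

Lemma between_approx X m M (g : R -> R) (p : nat -> {poly R}) : op_between m M X ->
  (forall e, 0 < e -> exists n0, forall n t, (n0 <= n)%N -> m <= t <= M ->
     `|(p n).[t] - g t| <= e) -> approx_on_spectrum X g p.
Proof.
move=> [sX hX] hp e /hp[n0 h]; exists n0 => n t n0n Xt.
by have [t' /(@complexI R) -> ht'] := spectrum_itv sX hX Xt; apply: h.
Qed.

(** The limit of [newton_lip]: N is controlled by the operator norm on self-adjoint
    operators. *)
Lemma cfc_lip (f : R -> R) N m M X Y : unitarily_invariant_norm N -> alternating f ->
  0 < m -> m <= M -> op_between m M X -> op_between m M Y ->
  N (cfc f X - cfc f Y) <= (f^`())%classic m * N (X - Y).
Proof.
move=> hN alt m0 mM hX hY; have [s [us hs ap]] := newton_nodes alt m0 mM.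
pose p n := newton f (s n).
have uX : approx_on_spectrum X f p.
  by apply: between_approx hX _ => e /ap[n0 h]; exists n0 => n t /h{}h /h[].
have uY : approx_on_spectrum Y f p.
  by apply: between_approx hY _ => e /ap[n0 h]; exists n0 => n t /h{}h /h[].
apply/ler_addgt0Pr => e e0.
pose K := N (X - Y) + N 1 + N 1 + 1.
have K0 : 0 < K by rewrite ltr_wpDl // !addr_ge0 ?(uin_ge0 hN).
have eK : 0 < e / K by rewrite divr_gt0.
have [n1 h1] := cfc_cvg hX.1 uX eK; have [n2 h2] := cfc_cvg hY.1 uY eK.
have [n3 h3] := ap _ eK; pose n := maxn n1 (maxn n2 n3).
have {}h1 := h1 n (leq_maxl _ _).
have {}h2 : opnorm (bop_poly (p n) Y - cfc f Y) <= e / K.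
  by apply: h2; rewrite /n !leq_max leqnn orbT.
have [||_ {}h3] := h3 n m; [by rewrite /n !leq_max leqnn !orbT|by rewrite lexx|].
have sc (Z : bop H) : op_between m M Z -> approx_on_spectrum Z f p ->
    self_adjoint (bop_poly (p n) Z - cfc f Z).
  by move=> hZ uZ; apply: saB; [exact: bop_poly_sa hZ.1|exact: cfc_sa hZ.1 uZ].
have k1 : N (bop_poly (p n) X - cfc f X) <= e / K * N 1.
  exact: le_trans (uin_sa_le hN (sc X hX uX)) (ler_wpM2r (uin_ge0 hN 1) h1).
have k2 : N (bop_poly (p n) Y - cfc f Y) <= e / K * N 1.
  exact: le_trans (uin_sa_le hN (sc Y hY uY)) (ler_wpM2r (uin_ge0 hN 1) h2).
have k3 := newton_lip hN alt m0 hX hY mM (us n) (hs n).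
have k4 : (p n)^`().[m] * N (X - Y) <= ((f^`())%classic m + e / K) * N (X - Y).
  rewrite ler_wpM2r ?(uin_ge0 hN) // addrC -lerBlDr.
  by rewrite (le_trans (ler_norm _)).
have -> : cfc f X - cfc f Y = (bop_poly (p n) X - bop_poly (p n) Y) +
   ((cfc f X - bop_poly (p n) X) + (bop_poly (p n) Y - cfc f Y)).
  by rewrite [RHS]addrCA [X in _ = _ + X]addrA subrK addrA subrK.
rewrite (le_trans (uin_triangle hN _ _)) //.
rewrite (le_trans (lerD k3 (uin_triangle hN _ _))) // (uinB hN (cfc f X)).
rewrite (le_trans (lerD k4 (lerD k1 k2))) //.
have -> : ((f^`())%classic m + e / K) * N (X - Y) + (e / K * N 1 + e / K * N 1) =
  (f^`())%classic m * N (X - Y) + e * ((K - 1) / K) by rewrite /K; ring.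
by rewrite lerD2l ger_pMr // ler_pdivrMr // mul1r gerBl.
Qed.

End Lipschitz.

(** * The Riemann integral as a limit of midpoint sums *)

Section Clamp.
Variable R : realType.
Implicit Types (x y t : R) (n i : nat).

(** The projection of x to the i-th of n equal pieces of [0, 1]. *)
Definition clamp n i x : R := Num.max (i%:R / n%:R) (Num.min x (i.+1%:R / n%:R)).
Definition mid n i : R := (2 * i%:R + 1) / (2 * n%:R).

Lemma clamp_mono n i x y : x <= y -> clamp n i x <= clamp n i y.
Proof.
move=> xy; rewrite /clamp ge_max le_max lexx /= le_max; apply/orP; right.
by rewrite le_min !ge_min xy lexx orbT.
Qed.

Lemma sum_clamp n x : (0 < n)%N -> 0 <= x <= 1 -> \sum_(i < n) (clamp n i x - i%:R / n%:R) = x.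
Proof.
move=> n0 /andP[x0 x1]; have n0' : 0 < n%:R :> R by rewrite ltr0n.
have key k : \sum_(i < k) (clamp n i x - i%:R / n%:R) = Num.min x (k%:R / n%:R).
  elim: k => [|k IHk]; first by rewrite big_ord0 mul0r; case: ltgtP x0.
  rewrite big_ord_recr /= IHk /clamp.
  have : k%:R / n%:R < k.+1%:R / n%:R :> R by rewrite ltr_pM2r ?invr_gt0 // ltr_nat.
  move: (k%:R / _) (k.+1%:R / _) => a b ab.
  rewrite /Num.max /Num.min; do !case: ifPn; rewrite -?leNgt; lra.
by rewrite key divff ?gt_eqF //; case: ltgtP x1.
Qed.

(** The projections of x and y differ only if the i-th piece meets [x, y]. *)
Lemma clamp_neq n i x y t : (0 < n)%N -> x <= y -> x <= t <= y -> clamp n i x != clamp n i y ->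
  `|mid n i - t| <= (y - x) + n%:R^-1.
Proof.
move=> n0 xy /andP[xt ty] ne; have n0' : 0 < n%:R :> R by rewrite ltr0n.
have iy : i%:R / n%:R < y.
  rewrite ltNge; apply: contraNN ne => yi; rewrite /clamp.
  by rewrite !max_l // ge_min ?yi ?(le_trans xy yi).
have xi : x < i.+1%:R / n%:R.
  rewrite ltNge; apply: contraNN ne => ix; rewrite /clamp.
  by rewrite !min_r // (le_trans ix).
have E1 : i.+1%:R / n%:R = i%:R / n%:R + n%:R^-1 :> R by rewrite -natr1 mulrDl mul1r.
have E2 : mid n i = i%:R / n%:R + n%:R^-1 / 2 by rewrite /mid; field; rewrite gt_eqF.
have b0 : 0 < n%:R^-1 :> R by rewrite invr_gt0.
rewrite E1 in xi; rewrite E2; move: iy xi b0.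
set a := i%:R / n%:R; set b := n%:R^-1; clearbody a b => iy xi b0.
by rewrite ler_norml; apply/andP; split; lra.
Qed.

Lemma clamp01 n i : (i < n)%N -> clamp n i 1 - clamp n i 0 = n%:R^-1.
Proof.
move=> i_n; have n0 : (0 < n)%N by exact: leq_ltn_trans i_n.
have n0' : 0 < n%:R :> R by rewrite ltr0n.
rewrite /clamp min_r; last by rewrite ler_pdivrMr // mul1r ler_nat.
rewrite min_l ?divr_ge0 // max_r; last by rewrite ler_pM2r ?invr_gt0 // ler_nat.
by rewrite max_l ?divr_ge0 // -mulrBl -natrB // subSnn mul1r.
Qed.

End Clamp.

Section RiemannLipschitz.
Variables (R : realType) (H : hilbertType R) (phi : R -> bop H) (L : R).
Hypothesis L0 : 0 <= L.
Hypothesis lip : forall s t, 0 <= s <= 1 -> 0 <= t <= 1 ->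
  opnorm (phi s - phi t) <= L * `|s - t|.

Lemma opnorm_sum (I : Type) (r : seq I) (F : I -> bop H) :
  opnorm (\sum_(i <- r) F i) <= \sum_(i <- r) opnorm (F i).
Proof.
elim/big_ind2: _ => [|A a B b hA hB|i _]; rewrite ?opnorm0 //.
by rewrite (le_trans (opnormD _ _)) // lerD.
Qed.

(** Up to a constant, the integral over [0, x] of the step function that takes the
    value phi (mid i) on the i-th piece.  A primitive turns the comparison of
    Riemann sums over unrelated partitions into a telescoping sum. *)
Definition step_primitive n (x : R) : bop H :=
  \sum_(i < n) (clamp n i x)%:C *: phi (mid R n i).

Lemma mid01 n i : (i < n)%N -> 0 <= mid R n i <= 1.
Proof.
move=> i_n; have n0 : (0 < n)%N by exact: leq_ltn_trans i_n.
have n0' : 0 < n%:R :> R by rewrite ltr0n.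
rewrite /mid divr_ge0 ?addr_ge0 ?mulr_ge0 //= ler_pdivrMr ?mulr_gt0 // mul1r.
have : i.+1%:R <= n%:R :> R by rewrite ler_nat.
by rewrite -natr1; lra.
Qed.

Lemma step_primitive_step n x y t : (0 < n)%N -> 0 <= x -> y <= 1 -> x <= t <= y ->
  opnorm ((y - x)%:C *: phi t - (step_primitive n y - step_primitive n x)) <=
    (y - x) * (L * ((y - x) + n%:R^-1)).
Proof.
move=> n0 x0 y1 /andP[xt ty]; have xy := le_trans xt ty.
have n0' : 0 < n%:R :> R by rewrite ltr0n.
have Exy : y - x = \sum_(i < n) (clamp n i y - clamp n i x).
  rewrite -{1}(@sum_clamp _ n y) ?y1 ?(le_trans x0 xy) //.
  rewrite -{1}(@sum_clamp _ n x) ?x0 ?(le_trans xy) //.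
  by rewrite -sumrB; apply: eq_bigr => i _; ring.
rewrite {1}Exy rmorph_sum scaler_suml /step_primitive -!sumrB.
rewrite [X in X * _]Exy mulr_suml (le_trans (opnorm_sum _ _)) //; apply: ler_sum => i _.
rewrite -scalerBl -rmorphB -scalerBr opnormZr ger0_norm ?subr_ge0 ?clamp_mono //.
have [->|ne] := eqVneq (clamp n i x) (clamp n i y); first by rewrite subrr !mul0r.
rewrite ler_wpM2l ?subr_ge0 ?clamp_mono //.
rewrite (le_trans (lip _ _)) ?mid01 ?(le_trans x0 xt) ?(le_trans ty y1) //.
by rewrite ler_wpM2l // distrC; apply: clamp_neq; rewrite ?xt.
Qed.

Definition mid_sum n : bop H := \sum_(i < n) (n%:R^-1)%:C *: phi (mid R n i).

Lemma mid_sumE n : mid_sum n = step_primitive n 1 - step_primitive n 0.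
Proof.
rewrite /step_primitive -sumrB; apply: eq_bigr => i _.
by rewrite -scalerBl -rmorphB clamp01.
Qed.

Lemma riemann_sum_mid n s (t : nat -> R) d : (0 < n)%N -> itv_partition 0 1 s ->
  (forall i, (i < size s)%N ->
       t i \in `[node 0 s i, node 0 s i.+1] /\ node 0 s i.+1 - node 0 s i < d) ->
  opnorm (riemann_sum 0 s t phi - mid_sum n) <= L * (d + n%:R^-1).
Proof.
move=> n0 ps hs; have nth_node i : (i <= size s)%N -> node 0 s i = nth 1 (0 :: s) i.
  by move=> i_s; rewrite /node (set_nth_default 1).
have node0 i : (i <= size s)%N -> 0 <= node 0 s i.
  by move=> i_s; rewrite nth_node //; apply: itv_partition_nth_ge ps.
have node1 i : (i <= size s)%N -> node 0 s i <= 1.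
  by move=> i_s; rewrite nth_node //; apply: itv_partition_nth_le ps.
have last1 : node 0 s (size s) = 1.
  by rewrite nth_node // (itv_partition_nth_size _ ps).
have tele (V : zmodType) (F : R -> V) :
    \sum_(i < size s) (F (node 0 s i.+1) - F (node 0 s i)) = F 1 - F 0.
  rewrite -(big_mkord xpredT (fun i => F (node 0 s i.+1) - F (node 0 s i))).
  by rewrite telescope_sumr // last1.
rewrite mid_sumE -(tele _ (step_primitive n)) /riemann_sum -sumrB (le_trans (opnorm_sum _ _)) //.
have <- : \sum_(i < size s) (node 0 s i.+1 - node 0 s i) * (L * (d + n%:R^-1)) =
    L * (d + n%:R^-1).
  by rewrite -mulr_suml (tele _ idfun) subr0 mul1r.
apply: ler_sum => i _; have [ti di] := hs i (ltn_ord i).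
rewrite (le_trans (step_primitive_step n0 _ _ _)) ?node0 ?node1 ?(ltnW (ltn_ord i)) //.
have := ti; rewrite in_itv /= => /andP[l1 l2].
by rewrite ler_wpM2l ?subr_ge0 ?(le_trans l1) // ler_wpM2l // lerD2r ltW.
Qed.

Lemma uniform_partition d : 0 < d -> exists s (t : nat -> R), itv_partition 0 1 s /\
  forall i, (i < size s)%N ->
       t i \in `[node 0 s i, node 0 s i.+1] /\ node 0 s i.+1 - node 0 s i < d.
Proof.
move=> d0; have [k kd] : exists k, (k.+1%:R)^-1 < d.
  exists (Num.truncn d^-1); rewrite invf_plt ?posrE // truncnS_gt //.
pose g (i : nat) : R := i%:R / k.+1%:R; pose s := [seq g i | i <- iota 1 k.+1].
have k0 : 0 < k.+1%:R :> R by rewrite ltr0n.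
have sz : size s = k.+1 by rewrite size_map size_iota.
have nodeE i : (i <= k.+1)%N -> node 0 s i = g i.
  case: i => [|i] ik; first by rewrite /node /g mul0r.
  by rewrite /node /= (nth_map 0%N) ?size_iota // nth_iota // add1n.
exists s, (node 0 s); split.
  split.
    have -> : 0 = g 0%N by rewrite /g mul0r.
    have p0 : path ltn 0%N (iota 1 k.+1) by exact: (iota_ltn_sorted 0 k.+2).
    rewrite /s path_map; apply: sub_path p0 => a b ab.
    by rewrite /= /g ltr_pM2r ?invr_gt0 // ltr_nat.
  by rewrite (last_nth 0) sz -/(node 0 s k.+1) nodeE // /g (divff (lt0r_neq0 k0)).
move=> i; rewrite sz => ik; rewrite !nodeE ?(ltnW ik) //.
have gg : g i.+1 - g i = k.+1%:R^-1 by rewrite /g -mulrBl -natrB // subSnn mul1r.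
split; last by rewrite gg.
by rewrite in_itv /= lexx /= -subr_ge0 gg invr_ge0 ler0n.
Qed.

Lemma mid_sum_cauchy n m : (0 < n)%N -> (0 < m)%N ->
  opnorm (mid_sum n - mid_sum m) <= L * (n%:R^-1 + m%:R^-1).
Proof.
move=> n0 m0; apply/ler_addgt0Pr => e e0.
have L1 : 0 < 2 * (L + 1) by rewrite mulr_gt0 // ltr_wpDl.
pose d := e / (2 * (L + 1)); have d0 : 0 < d by rewrite divr_gt0.
have [s [t [ps hs]]] := uniform_partition d0.
have h1 := riemann_sum_mid n0 ps hs; have h2 := riemann_sum_mid m0 ps hs.
rewrite (_ : mid_sum n - mid_sum m = - (riemann_sum 0 s t phi - mid_sum n) +
                                     (riemann_sum 0 s t phi - mid_sum m)).
  rewrite (le_trans (opnormD _ _)) // opnormN (le_trans (lerD h1 h2)) //.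
  rewrite (_ : _ + _ = L * (n%:R^-1 + m%:R^-1) + L * (2 * d)); last by ring.
  rewrite lerD2l (_ : L * _ = e * (L / (L + 1))); last first.
    by rewrite /d; field; rewrite gt_eqF // ltr_wpDl.
  by rewrite ger_pMr // ler_pdivrMr ?ltr_wpDl // mul1r lerDl.
by rewrite opprB addrA subrK.
Qed.

Lemma inv_small (e : R) : 0 < e -> exists n0, forall n, (n0 < n)%N -> n%:R^-1 <= e.
Proof.
move=> e0; exists (Num.truncn e^-1) => n hn.
have n0 : (0 < n)%N by exact: leq_ltn_trans hn.
rewrite invf_ple ?posrE ?ltr0n // ltW // (lt_le_trans (truncnS_gt _)) // ler_nat //.
Qed.

(** The midpoint sums are Cauchy, and any value of the integral is their limit because
    there are arbitrarily fine partitions; so the choice made by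
    [riemann_integral] is harmless. *)
Theorem riemann_integral_mid : opcvg (fun n => mid_sum n.+1) (riemann_integral 0 1 phi).
Proof.
have L1 : 0 < L + 1 by rewrite ltr_wpDl.
have small e : 0 < e -> exists n0, forall n, (n0 <= n)%N -> L * n.+1%:R^-1 <= e.
  move=> e0; have [|n0 h] := inv_small (e := e / (L + 1)); first by rewrite divr_gt0.
  exists n0 => n n0n; rewrite (le_trans (ler_wpM2l L0 (h _ _))) // mulrCA ger_pMr //.
  by rewrite ler_pdivrMr // mul1r lerDl.
have [|S hS] := opcauchy_cvg (u := fun n => mid_sum n.+1).
  move=> e e0; have e2 : 0 < e / 2 by rewrite divr_gt0.
  have [n0 h] := small _ e2; exists n0 => n m hn hm.
  by rewrite (le_trans (mid_sum_cauchy _ _)) // mulrDr [e]splitr lerD ?h.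
have key T : is_riemann_integral 0 1 phi T -> opcvg (fun n => mid_sum n.+1) T.
  move=> hT e e0; have e3 : 0 < e / 3 by rewrite divr_gt0.
  have [n0 h] := small _ e3; exists n0 => n hn.
  have [d d0 hd] := hT _ e3.
  have d'0 : 0 < Num.min d (e / 3 / (L + 1)) by rewrite lt_min d0 divr_gt0.
  have [s [t [ps hs]]] := uniform_partition d'0.
  have h1 := riemann_sum_mid (ltn0Sn n) ps hs.
  have h2 : opnorm (riemann_sum 0 s t phi - T) < e / 3.
    rewrite -ltcR; apply: hd => // i /hs [ti di]; split=> //.
    by rewrite (lt_le_trans di) // ge_min lexx.
  have h3 : L * Num.min d (e / 3 / (L + 1)) <= e / 3.
    rewrite (le_trans (ler_wpM2l L0 (_ : _ <= e / 3 / (L + 1)))) ?ge_min ?lexx ?orbT //.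
    by rewrite mulrCA ger_pMr // ler_pdivrMr // mul1r lerDl.
  rewrite (_ : mid_sum n.+1 - T = (riemann_sum 0 s t phi - T) -
                                  (riemann_sum 0 s t phi - mid_sum n.+1)).
    rewrite (le_trans (opnormD _ _)) // opnormN (le_trans (lerD (ltW h2) h1)) // (mulrDr L).
    have h4 := h n hn; rewrite (le_trans (lerD (lexx _) (lerD h3 h4))) //.
    lra.
  by rewrite opprB [RHS]addrC addrA subrK.
apply: key; rewrite /riemann_integral; apply: getPex; exists S => e e0.
have e3 : 0 < e / 4 by rewrite divr_gt0.
exists (e / 4 / (L + 1)) => [|s t ps hs]; first by rewrite divr_gt0.
have [n1 h1] := small _ e3; have [n2 h2] := hS _ e3; pose n := maxn n1 n2.
have h3 := riemann_sum_mid (ltn0Sn n) ps hs.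
have h4 := h1 n (leq_maxl _ _); have h5 := h2 n (leq_maxr _ _).
rewrite -[X in X < _]/((opnorm _)%:C) ltcR.
have h6 : L * (e / 4 / (L + 1)) <= e / 4.
  by rewrite mulrCA ger_pMr // ler_pdivrMr // mul1r lerDl.
rewrite -(subrK (mid_sum n.+1) (riemann_sum 0 s t phi)) -addrA.
rewrite (le_lt_trans (opnormD _ _)) // (le_lt_trans (lerD h3 h5)) // (mulrDr L).
rewrite (le_lt_trans (lerD (lerD h6 h4) (lexx _))) //.
lra.
Qed.

End RiemannLipschitz.

(** * The three-eighths rule *)

Lemma sum_odd (R : realType) (a b : nat) : (a <= b)%N ->
  \sum_(a <= i < b) (2 * i%:R + 1) = b%:R ^+ 2 - a%:R ^+ 2 :> R.
Proof.
move=> ab; rewrite -(telescope_sumr (fun i => i%:R ^+ 2) ab).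
by apply: eq_bigr => i _; rewrite -natr1; ring.
Qed.

(** Sums of consecutive odd numbers are differences of squares, so that the midpoint
    rule is exact for the distance to an end point of the piece. *)
Lemma sum_mid_dist (R : realType) (l a b c : nat) :
  (a <= b)%N -> c = a \/ c = b -> (0 < l)%N ->
  \sum_(a * l <= i < b * l) `|c%:R / 24 - mid R (24 * l) i| = l%:R * (b%:R - a%:R) ^+ 2 / 48.
Proof.
move=> ab hc l0; have l0' : 0 < l%:R :> R by rewrite ltr0n.
have abl : (a * l <= b * l)%N by rewrite leq_mul2r ab orbT.
have S1 : \sum_(a * l <= i < b * l) mid R (24 * l) i = l%:R * (b%:R ^+ 2 - a%:R ^+ 2) / 48.
  rewrite -mulr_suml sum_odd // !natrM; field; exact: lt0r_neq0.
have S2 : \sum_(a * l <= i < b * l) (c%:R / 24 : R) = l%:R * (b%:R - a%:R) * c%:R / 24.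
  by rewrite sumr_const_nat -[LHS]mulr_natr natrB // !natrM; ring.
have E i : mid R (24 * l) i = ((2 * i%:R + 1) / 2 / l%:R) / 24.
  by rewrite /mid natrM; field; exact: lt0r_neq0.
case: hc => ?; subst c.
  transitivity (\sum_(a * l <= i < b * l) (mid R (24 * l) i - a%:R / 24)).
    apply: eq_big_nat => i /andP[ai _]; rewrite distrC ger0_norm // subr_ge0 E ler_pM2r ?invr_gt0 //.
    rewrite ler_pdivlMr // ler_pdivlMr // -natrM.
    have : (a * l)%:R <= i%:R :> R by rewrite ler_nat.
    lra.
  by rewrite big_split /= sumrN S1 S2; field.
transitivity (\sum_(a * l <= i < b * l) (b%:R / 24 - mid R (24 * l) i)).
  apply: eq_big_nat => i /andP[_ ib]; rewrite ger0_norm // subr_ge0 E ler_pM2r ?invr_gt0 //.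
  rewrite ler_pdivrMr // ler_pdivrMr // -natrM.
  have : i.+1%:R <= (b * l)%:R :> R by rewrite ler_nat.
  by rewrite -natr1; lra.
by rewrite big_split /= sumrN S1 S2; field.
Qed.

Section ThreeEighths.
Variables (R : realType) (H : hilbertType R) (N : bop H -> R) (phi : R -> bop H) (K : R).
Hypothesis hN : unitarily_invariant_norm N.
Hypothesis lipN : forall s t, 0 <= s <= 1 -> 0 <= t <= 1 ->
  N (phi s - phi t) <= K * `|s - t|.

(** The contribution of [a/24, b/24] to the error, with the node c/24 in charge; all the
    break points and nodes of the rule are multiples of 1/24. *)
Definition midpoint_block l a b (c : nat) : bop H :=
  ((b%:R - a%:R) / 24)%:C *: phi (c%:R / 24) -
  \sum_(a * l <= i < b * l) ((24 * l)%:R^-1)%:C *: phi (mid R (24 * l) i).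

Lemma midpoint_block_le l a b c : (a <= b <= 24)%N -> c = a \/ c = b -> (0 < l)%N ->
  N (midpoint_block l a b c) <= K * ((b%:R - a%:R) ^+ 2 / 1152).
Proof.
move=> /andP[ab b24] hc l0; have l0' : 0 < l%:R :> R by rewrite ltr0n.
have abl : (a * l <= b * l)%N by rewrite leq_mul2r ab orbT.
have -> : midpoint_block l a b c = \sum_(a * l <= i < b * l)
    ((24 * l)%:R^-1)%:C *: (phi (c%:R / 24) - phi (mid R (24 * l) i)).
  rewrite /midpoint_block; under [RHS]eq_bigr do rewrite scalerBr.
  rewrite sumrB; congr (_ - _); rewrite sumr_const_nat -[RHS]scaler_nat scalerA.
  rewrite -(rmorph_nat (real_complex R)) -rmorphM; congr (_%:C *: _).
  by rewrite natrB // !natrM; field; exact: lt0r_neq0.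
have c24 : (c <= 24)%N by case: hc => ->; rewrite ?(leq_trans ab).
have c01 : 0 <= (c%:R / 24 : R) <= 1.
  by rewrite divr_ge0 //= ler_pdivrMr // mul1r ler_nat.
rewrite (le_trans (uin_sum hN _ _)) //.
apply: (@le_trans _ _ (\sum_(a * l <= i < b * l)
    (24 * l)%:R^-1 * (K * `|c%:R / 24 - mid R (24 * l) i|))).
  rewrite big_nat_cond [X in _ <= X]big_nat_cond; apply: ler_sum => i /andP[/andP[_ ib] _].
  rewrite (uinZ hN) ger0_norm ?invr_ge0 // ler_wpM2l ?invr_ge0 // lipN //.
  by apply: mid01; rewrite (leq_trans ib) // leq_mul2r b24 orbT.
rewrite -mulr_sumr -mulr_sumr sum_mid_dist // mulrCA natrM.
by rewrite le_eqVlt; apply/orP; left; apply/eqP; congr (_ * _); field; exact: lt0r_neq0.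
Qed.

(** The pieces of lengths 1/8, 3/8, 3/8, 1/8 around the nodes are cut at the nodes into
    blocks of lengths 3, 5, 4, 4, 5, 3 in units of 1/24.  The squares of these
    lengths sum to 100, and 100/1152 = 25/288. *)
Lemma three_eighths_mid_sum l : (0 < l)%N ->
  N ((8^-1)%:C *: (phi 0 + 3%:C *: phi (3^-1) + 3%:C *: phi (2 / 3) + phi 1) -
     mid_sum phi (24 * l)) <= 25 / 288 * K.
Proof.
move=> l0.
have Emid : mid_sum phi (24 * l) =
    \sum_(0 * l <= i < 3 * l) ((24 * l)%:R^-1)%:C *: phi (mid R (24 * l) i) +
    (\sum_(3 * l <= i < 8 * l) ((24 * l)%:R^-1)%:C *: phi (mid R (24 * l) i) +
    (\sum_(8 * l <= i < 12 * l) ((24 * l)%:R^-1)%:C *: phi (mid R (24 * l) i) +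
    (\sum_(12 * l <= i < 16 * l) ((24 * l)%:R^-1)%:C *: phi (mid R (24 * l) i) +
    (\sum_(16 * l <= i < 21 * l) ((24 * l)%:R^-1)%:C *: phi (mid R (24 * l) i) +
    \sum_(21 * l <= i < 24 * l) ((24 * l)%:R^-1)%:C *: phi (mid R (24 * l) i))))).
  rewrite /mid_sum -(big_mkord xpredT (fun i => ((24 * l)%:R^-1)%:C *: phi (mid R (24 * l) i))).
  by rewrite -!big_cat_nat ?leq_mul2r ?orbT ?mul0n.
have -> : (8^-1)%:C *: (phi 0 + 3%:C *: phi (3^-1) + 3%:C *: phi (2 / 3) + phi 1) -
    mid_sum phi (24 * l) = midpoint_block l 0 3 0 + (midpoint_block l 3 8 8 + (midpoint_block l 8 12 8 +
    (midpoint_block l 12 16 16 + (midpoint_block l 16 21 16 + midpoint_block l 21 24 24)))).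
  rewrite Emid /midpoint_block.
  have -> : 0%:R / 24 = 0 :> R by rewrite mul0r.
  have -> : 8%:R / 24 = 3^-1 :> R by field.
  have -> : 16%:R / 24 = 2 / 3 :> R by field.
  have -> : 24%:R / 24 = 1 :> R by field.
  have subDD (x y u v : bop H) : (x - y) + (u - v) = (x + u) - (y + v).
    by rewrite addrACA -opprD.
  rewrite !subDD; congr (_ - _).
  have addZ (u v : R) (x y : bop H) :
      u%:C *: x + (v%:C *: x + y) = (u + v)%:C *: x + y.
    by rewrite addrA -scalerDl -rmorphD.
  rewrite !addZ !scalerDr !scalerA -!rmorphM -!addrA.
  by congr (_%:C *: _ + (_%:C *: _ + (_%:C *: _ + _%:C *: _))); field.
have bl a b c : (a <= b <= 24)%N -> c = a \/ c = b ->
  N (midpoint_block l a b c) <= K * ((b%:R - a%:R) ^+ 2 / 1152) by move=> *; exact: midpoint_block_le.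
have tri (x y : bop H) (u v : R) : N x <= u -> N y <= v -> N (x + y) <= u + v.
  by move=> xu yv; rewrite (le_trans (uin_triangle hN _ _)) // lerD.
have b1 := bl 0%N 3%N 0%N isT (or_introl erefl).
have b2 := bl 3%N 8%N 8%N isT (or_intror erefl).
have b3 := bl 8%N 12%N 8%N isT (or_introl erefl).
have b4 := bl 12%N 16%N 16%N isT (or_intror erefl).
have b5 := bl 16%N 21%N 16%N isT (or_introl erefl).
have b6 := bl 21%N 24%N 24%N isT (or_intror erefl).
have {}b5 := tri _ _ _ _ b5 b6; have {}b4 := tri _ _ _ _ b4 b5.
have {}b3 := tri _ _ _ _ b3 b4; have {}b2 := tri _ _ _ _ b2 b3.
apply: le_trans (tri _ _ _ _ b1 b2) _.
by rewrite le_eqVlt; apply/orP; left; apply/eqP; field.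
Qed.

End ThreeEighths.

Section Main.
Variables (R : realType) (H : hilbertType R).

Definition cfc_path (f : R -> R) (A B : bop H) (t : R) : bop H :=
  cfc f ((1 - t)%:C *: A + t%:C *: B).

Lemma between_convex m M (A B : bop H) (t : R) : op_between m M A -> op_between m M B ->
  0 <= t <= 1 -> op_between m M ((1 - t)%:C *: A + t%:C *: B).
Proof.
move=> [sA hA] [sB hB] /andP[t0 t1]; split; first by apply: saD; apply: saZ.
move=> x; rewrite rdotDl !rdotZl; have /andP[a1 a2] := hA x; have /andP[b1 b2] := hB x.
have t1' : 0 <= 1 - t by rewrite subr_ge0.
have := lerD (ler_wpM2l t1' a1) (ler_wpM2l t0 b1).
have := lerD (ler_wpM2l t1' a2) (ler_wpM2l t0 b2).
by move=> h1 h2; apply/andP; split; lra.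
Qed.

Lemma three_eighths_cfc (f : R -> R) (N : bop H -> R) m M (A B : bop H) :
  unitarily_invariant_norm N -> alternating f -> 0 < m -> m <= M ->
  op_between m M A -> op_between m M B ->
  let phi := cfc_path f A B in
  is_true (N ((8^-1)%:C *: (phi 0 + 3%:C *: phi (3^-1) + 3%:C *: phi (2 / 3) + phi 1) -
     riemann_integral 0 1 phi) <= 25 / 288 * ((f^`())%classic m * N (B - A))).
Proof.
move=> hN alt m0 mM hA hB phi; set L := (f^`())%classic m.
have lip N' : unitarily_invariant_norm N' -> forall s t : R, 0 <= s <= 1 -> 0 <= t <= 1 ->
    N' (phi s - phi t) <= L * N' (B - A) * `|s - t|.
  move=> hN' s t s01 t01; have hs := between_convex hA hB s01.
  have ht := between_convex hA hB t01.
  rewrite (le_trans (cfc_lip hN' alt m0 mM hs ht)) // -mulrA.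
  rewrite (_ : _ - _ = (s - t)%:C *: (B - A)) ?(uinZ hN') 1?[N' _ * _]mulrC //.
  rewrite scalerBr !rmorphB !scalerBl !scale1r opprD addrACA opprB.
  by rewrite [_ + (_ - A)]addrC [X in X + _ = _]addrA subrK [LHS]addrC [in RHS]opprB.
have L0 : 0 <= L.
  have [C _ [d0 _]] := alt_derivative alt (divr_gt0 m0 (ltr0Sn _ 1) : 0 < m / 2).
  by apply: d0; rewrite gtr_pMr // invf_lt1 // ltr1n.
have LN0 : 0 <= L * opnorm (B - A) by rewrite mulr_ge0 ?opnorm_ge0.
have conv := riemann_integral_mid LN0 (lip _ (uin_opnorm H)).
have [s [us hs ap]] := newton_nodes alt m0 mM.
have sphi t : 0 <= t <= 1 -> self_adjoint (phi t).
  move=> t01; have ht := between_convex hA hB t01.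
  have uX : approx_on_spectrum ((1 - t)%:C *: A + t%:C *: B) f (fun n => newton f (s n)).
    by apply: between_approx ht _ => e /ap[n0 h]; exists n0 => n u /h{}h /h[].
  exact: cfc_sa ht.1 uX.
have smid n : self_adjoint (mid_sum phi n).
  by apply: sa_sum => i; apply: saZ; apply: sphi; exact: mid01.
have sS := opcvg_sa conv (fun n => smid n.+1).
set S := riemann_integral _ _ _ in conv sS *; set Q := _ *: _.
apply/ler_addgt0Pr => e e0.
have N1 : 0 < N 1 + 1 by rewrite ltr_wpDl ?(uin_ge0 hN).
have [n0 h] := conv _ (divr_gt0 e0 N1).
have E24 : (24 * n0.+1).-1.+1 = (24 * n0.+1)%N by rewrite prednK // muln_gt0.
have := h (24 * n0.+1).-1; rewrite E24 => /(_ _) h1.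
have {}h1 : opnorm (mid_sum phi (24 * n0.+1) - S) <= e / (N 1 + 1).
  by apply: h1; rewrite -ltnS E24 leq_pmull.
have h2 := three_eighths_mid_sum hN (lip _ hN) (ltn0Sn n0); rewrite -/Q in h2.
rewrite -(subrK (mid_sum phi (24 * n0.+1)) Q) -addrA.
rewrite (le_trans (uin_triangle hN _ _)) // lerD //.
rewrite (le_trans (uin_sa_le hN (saB (smid _) sS))) //.
rewrite (le_trans (ler_wpM2r (uin_ge0 hN 1) h1)) // mulrAC -mulrA ger_pMr //.
by rewrite ler_pdivrMr // mul1r lerDl.
Qed.

End Main.

Theorem theorem6 (R : realType) (H : hilbertType R) (f : R -> R)
    (hf : operator_monotone `]0, +oo[ f)
    (N : bop H -> R) (hN : unitarily_invariant_norm N)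
    (A B : bop H) (hA : positive_definite A) (hB : positive_definite B) :
  N (8^-1 *: (cfc f A + 3 *: cfc f (3^-1 *: (2 *: A + B))
              + 3 *: cfc f (3^-1 *: (A + 2 *: B)) + cfc f B)
     - riemann_integral 0 1 (fun t : R => cfc f ((1 - t)%:C *: A + t%:C *: B)))
  <= 25 / 288 * N (B - A)
     * Num.max (opnorm (cfc (f^`())%classic A)) (opnorm (cfc (f^`())%classic B)).
Proof.
have alt := opmono_alternating hf.
(* On the zero space the spectra are empty, and both sides vanish. *)
have [h|n10] := eqVneq (1 : bop H) 0.
  by rewrite [X in N X <= _](bop1_eq0 _ h) [B - A](bop1_eq0 _ h) (uin0 hN) mulr0 mul0r.
have [sA _ iA] := hA; have [sB _ iB] := hB.
have [a Aa hAa] := spectrum_min n10 sA; have [b Bb hBb] := spectrum_min n10 sB.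
have pos (T : bop H) (t : R) : spectrum_in T [set` `]0, +oo[] -> spectrum T t%:C -> 0 < t.
  move=> iT /iT[u uI]; rewrite /= in_itv /= andbT in uI.
  by case=> <-.
have a0 := pos _ _ iA Aa; have b0 := pos _ _ iB Bb.
pose m := Num.min a b; pose M := Num.max (opnorm A) (opnorm B).
have m0 : 0 < m by rewrite lt_min a0.
have aA : a <= opnorm A.
  by have [t [<-] /(le_trans (ler_norm _))] := spectrum_real sA Aa.
have mM : m <= M by rewrite ge_min le_max aA.
have bet (T : bop H) (t : R) : self_adjoint T -> m <= t -> opnorm T <= M ->
    (forall x, t * rnorm x ^+ 2 <= rdot (T x) x) ->
    op_between m M T.
  move=> sT mt TM hT; split=> // x; apply/andP; split.
    by rewrite (le_trans _ (hT x)) // ler_wpM2r ?sqr_ge0.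
  by rewrite (le_trans (rdot_le T x)) // ler_wpM2r ?sqr_ge0.
have hAm : op_between m M A by apply: bet hAa; rewrite ?ge_min ?le_max ?lexx.
have hBm : op_between m M B by apply: bet hBb; rewrite ?ge_min ?le_max ?lexx ?orbT.
have [s [us hs ap]] := newton_nodes alt m0 mM.
have fm : (f^`())%classic m <=
    Num.max (opnorm (cfc (f^`())%classic A)) (opnorm (cfc (f^`())%classic B)).
  have bnd (T : bop H) (t : R) : op_between m M T -> spectrum T t%:C ->
      (f^`())%classic t <= opnorm (cfc (f^`())%classic T).
    move=> hT Tt; apply: le_trans (ler_norm _) _.
    apply: (cfc_ge (p := fun n => (newton f (s n))^`()) hT.1 _ Tt).
    by apply: between_approx hT _ => e /ap[n0 h]; exists n0 => n u /h{}h /h[].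
  rewrite le_max; apply/orP; have [mE|mE] : m = a \/ m = b.
  - by rewrite /m; case: leP; [left|right].
  - by left; rewrite mE; exact: bnd hAm Aa.
  - by right; rewrite mE; exact: bnd hBm Bb.
have := three_eighths_cfc hN alt m0 mM hAm hBm.
rewrite /= /cfc_path.
rewrite !(subr0, rmorph0, rmorph1, subrr, scale0r, scale1r, addr0, add0r).
have C3 : (3^-1 : R[i]) = (3^-1)%:C by rewrite fmorphV rmorph_nat.
have C2 : (2 : R[i]) = 2%:C by rewrite rmorph_nat.
have -> : (1 - 3^-1)%:C *: A + (3^-1)%:C *: B = 3^-1 *: (2 *: A + B).
  rewrite C3 C2 scalerDr scalerA -(rmorphM (real_complex R)); congr (_%:C *: _ + _).
  by field.
have -> : (1 - 2 / 3)%:C *: A + (2 / 3)%:C *: B = 3^-1 *: (A + 2 *: B).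
  rewrite C3 C2 scalerDr scalerA -(rmorphM (real_complex R)); congr (_%:C *: _ + _%:C *: _).
    by field.
  by rewrite mulrC.
have -> : (3%:C : R[i]) = 3 by rewrite rmorph_nat.
have -> : ((8^-1)%:C : R[i]) = 8^-1 by rewrite fmorphV rmorph_nat.
move=> h; apply: le_trans h _.
rewrite -[leRHS]mulrA ler_wpM2l // [leLHS]mulrC ler_wpM2l ?(uin_ge0 hN) //.
Qed.
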